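(* Let $G$ be a mixed unit interval graph on $n$ vertices. A maximum cardinality cut of $G$ can be found in time $2^{\tilde{O}(\sqrt{n})}$.
   Context: A mixed unit interval graph is the intersection graph of a family of unit-length intervals on the real line, each of which may be closed $[x,x+1]$, open $(x,x+1)$, closed-open $[x,x+1)$ or open-closed $(x,x+1]$. A cut of $G$ is a partition $(S,V(G)\setminus S)$; its size is the number of edges with exactly one endpoint in $S$; a maximum cardinality cut is a cut of maximum size. $\tilde{O}$ suppresses polylogarithmic factors. *)

(* Defs.v *)
From HB Require Import structures.
From mathcomp Require Import all_boot all_order all_algebra.
From mathcomp Require Import all_classical all_reals all_analysis.
Set Implicit Arguments.
Unset Strict Implicit.
Unset Printing Implicit Defensive.
Import Order.TTheory GRing.Theory Num.Theory.
Import numFieldNormedType.Exports.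
Local Open Scope classical_set_scope.
Local Open Scope ring_scope.

Record sgraph (V : finType) := SGraph {
  adj :> rel V;
  adj_sym : symmetric adj;
  adj_irr : irreflexive adj }.

Definition is_unit_interval (R : realType) (I : interval R) : Prop :=
  exists x : R,
    [\/ I = `[x, x + 1], I = `]x, x + 1[, I = `[x, x + 1[ | I = `]x, x + 1]].

Definition mixed_unit_interval_graph (R : realType) (V : finType)
    (G : sgraph V) : Prop :=
  exists I : V -> interval R,
    (forall v, is_unit_interval (I v)) /\
    (forall u v, G u v <-> u <> v /\ [set` I u] `&` [set` I v] !=set0).

Definition edges (V : finType) (G : sgraph V) : {set {set V}} :=
  [set [set uv.1; uv.2]%SET | uv : V * V & G uv.1 uv.2]%SET.

(* The cut (S, V \ S) is represented by its side S. *)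
Definition cut_size (V : finType) (G : sgraph V) (S : {set V}) : nat :=
  #|[set E in edges G | #|E :&: S| == 1%N]%SET|.

Definition maximum_cut (V : finType) (G : sgraph V) (S : {set V}) : Prop :=
  forall T : {set V}, (cut_size G T <= cut_size G S)%N.

(* Time is measured on a random access machine with finitely many             *)
(* registers accessed by a fixed program and an unbounded memory, all holding *)
(* natural numbers.  Each instruction has unit cost; since the only           *)
(* arithmetic is addition and truncated subtraction (no multiplication or     *)
(* shift), a cell has O(t + log n) bits after t steps, so that time on this   *)
(* machine is polynomially related to Turing machine time.                    *)
Inductive instr :=
  | SetConst of nat & nat        (* r_i := c                    *)
  | Add of nat & nat & nat       (* r_i := r_j + r_k            *)
  | Sub of nat & nat & nat       (* r_i := r_j - r_k, truncated *)
  | Read of nat & nat            (* r_i := M[r_j]               *)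
  | Write of nat & nat           (* M[r_i] := r_j               *)
  | JumpZero of nat & nat.       (* if r_i = 0 goto l           *)

Definition program := seq instr.

Record config := Config { pc : nat; reg : nat -> nat; memory : nat -> nat }.

Definition update (f : nat -> nat) (a v : nat) : nat -> nat :=
  fun x => if x == a then v else f x.

Definition exec (i : instr) (c : config) : config :=
  let: Config p r m := c in
  match i with
  | SetConst i k => Config p.+1 (update r i k) m
  | Add i j k => Config p.+1 (update r i (r j + r k)%N) m
  | Sub i j k => Config p.+1 (update r i (r j - r k)%N) m
  | Read i j => Config p.+1 (update r i (m (r j))) m
  | Write i j => Config p.+1 r (update m (r i) (r j))
  | JumpZero i l => Config (if r i == 0%N then l else p.+1) r m
  end.

(* The machine halts when the program counter leaves the program. *)
Definition step (P : program) (c : config) : config :=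
  if onth P (pc c) is Some i then exec i c else c.

Definition halted (P : program) (c : config) : bool := (size P <= pc c)%N.

(* Input: register 0 holds n, and the first n * n memory cells hold the       *)
(* adjacency matrix in row-major order.                                       *)
Definition input (n : nat) (G : sgraph 'I_n) : config :=
  Config 0 (update (fun=> 0%N) 0 n)
    (nth 0%N [seq nat_of_bool (G i j) | i <- enum 'I_n, j <- enum 'I_n]).

(* Output: the vertices whose memory cell, among the first n, is nonzero.     *)
Definition output (n : nat) (c : config) : {set 'I_n} :=
  [set i : 'I_n | memory c i != 0%N]%SET.

Definition finds_maximum_cut_in (P : program) (n : nat) (G : sgraph 'I_n)
    (t : nat) : Prop :=
  let c := iter t (step P) (input G) in
  halted P c /\ maximum_cut G (output n c).

Definition softO (R : realType) (f g : nat -> R^o) : Prop :=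
  exists k : nat, f =O_\oo (fun n => g n * ln n%:R ^+ k : R^o).

(* Main.v *)
Require Import Defs.
From HB Require Import structures.
From mathcomp Require Import all_boot all_order all_algebra.
From mathcomp Require Import all_classical all_reals all_analysis.
From mathcomp Require Import zify ring lra.
Set Implicit Arguments.
Unset Strict Implicit.
Unset Printing Implicit Defensive.
Import Order.TTheory GRing.Theory Num.Theory.
Import numFieldNormedType.Exports.
Local Open Scope classical_set_scope.
Local Open Scope ring_scope.
Local Open Scope nat_scope.

(* Let z be a vertex with leftmost left endpoint in its component, and let the
   layers be the distance classes from z.  Left endpoints within a layer differ
   by at most 1 and increase (weakly) with the layer, so writing x for the left
   endpoint, the adjacency between consecutive layers is decided by comparing
   the rows x - (layer), up to ties in a row.  Some residue class modulo
   q = ceil(sqrt n) of layers has at most q vertices.  Order the component by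
   taking these separating layers first, and then, between two consecutive
   separating layers, by the size of the down-set of a vertex under the
   row comparisons that the adjacency matrix reveals.  At every prefix of this
   order, the processed vertices have only O(q) distinct neighbourhoods among the
   remaining ones.  Dynamic programming along the order, keeping one best partial
   cut for each vector of degrees (of the remaining vertices) into the chosen
   side, therefore has n^O(q) states.  The program does not know z and the residue:
   it tries all of them, gives up when there are too many states, and
   otherwise records an optimal cut of the component of z. *)

(** * A small language and its compilation *)

(** Only the adjacency matrix is given, so the interval model never enters the algorithm; it serves
    solely to prove that some guess succeeds. The dynamic program is exact for every vertex order as
    long as no table overflows. A bad guess therefore costs time but never correctness, and a later
    success on the same component may safely overwrite an earlier one. The obstacle is the mixed
    endpoints: when two left endpoints differ by exactly 1, the intervals may or may not meet, so
    adjacency cannot order vertices whose rows are tied. Vertices with equal left endpoint and equal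
    endpoint types are twins, however, so a few bits per layer repair the count. A label is one of
    [q.+1] numbers with seven bits, which gives the exponent [q.+1 * 128] of the table capacity
    [W = n.+1 ^ (q.+1 * 128)]. Everything else is polynomial in [W], hence the bound
    [n ^ O(sqrt n)], that is, 2 to the power [O(sqrt n * log n)]. The machine can only add and
    subtract. The program is therefore written in a language whose bounded sum acts as product,
    quotient, quantifier and search alike. *)

Inductive expr :=
  | ECst of nat
  | EVar of nat
  | EAdd of expr & expr
  | ESub of expr & expr
  | EDbl of expr
  | EMem of expr
  | EIf of expr & expr & expr
  | ESum of nat & nat & expr.

Fixpoint ev (e : expr) (r m : nat -> nat) : nat :=
  match e with
  | ECst c => c
  | EVar x => r x
  | EAdd a b => ev a r m + ev b r m
  | ESub a b => ev a r m - ev b r m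
  | EDbl a => ev a r m + ev a r m
  | EMem a => m (ev a r m)
  | EIf a b c => if ev a r m == 0 then ev c r m else ev b r m
  | ESum x y a => \sum_(i < r y) ev a (update r x i) m
  end.

Inductive cmd :=
  | CStore of expr & expr
  | CSeq of cmd & cmd
  | CFor of nat & nat & cmd.

Fixpoint den (c : cmd) (r m : nat -> nat) : nat -> nat :=
  match c with
  | CStore a b => update m (ev a r m) (ev b r m)
  | CSeq c1 c2 => den c2 r (den c1 r m)
  | CFor x y c => iteri (r y) (fun i m => den c (update r x i) m) m
  end.

Fixpoint below (v : nat) (e : expr) : bool :=
  match e with
  | ECst _ => true
  | EVar x => x < v
  | EAdd a b | ESub a b => below v a && below v b
  | EDbl a | EMem a => below v a
  | EIf a b c => [&& below v a, below v b & below v c]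
  | ESum x y a => [&& x < v, y < v & below v a]
  end.

Fixpoint cbelow (v : nat) (c : cmd) : bool :=
  match c with
  | CStore a b => below v a && below v b
  | CSeq c1 c2 => cbelow v c1 && cbelow v c2
  | CFor x y c => [&& x < v, y < v & cbelow v c]
  end.

Fixpoint bounded (rs : seq nat) (e : expr) : bool :=
  match e with
  | ECst _ | EVar _ => true
  | EAdd a b | ESub a b => bounded rs a && bounded rs b
  | EDbl a | EMem a => bounded rs a
  | EIf a b c => [&& bounded rs a, bounded rs b & bounded rs c]
  | ESum _ y a => (y \in rs) && bounded rs a
  end.

Fixpoint cbounded (rs : seq nat) (c : cmd) : bool :=
  match c with
  | CStore a b => bounded rs a && bounded rs b
  | CSeq c1 c2 => cbounded rs c1 && cbounded rs c2
  | CFor _ y c => (y \in rs) && cbounded rs c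
  end.

(* Bounds on the running time when every loop has at most [M] rounds. *)
Fixpoint ecost (e : expr) (M : nat) : nat :=
  match e with
  | ECst _ => 1
  | EVar _ => 2
  | EAdd a b | ESub a b => ecost a M + ecost b M + 1
  | EDbl a | EMem a => ecost a M + 1
  | EIf a b c => ecost a M + ecost b M + ecost c M + 3
  | ESum _ _ a => M * (ecost a M + 7) + 8
  end.

Fixpoint ccost (c : cmd) (M : nat) : nat :=
  match c with
  | CStore a b => ecost a M + ecost b M + 1
  | CSeq c1 c2 => ccost c1 M + ccost c2 M
  | CFor _ _ c => M * (ccost c M + 6) + 7
  end.

(** Scratch registers: [d] saves the old value of [x], [d.+1] is a zero used for copying, [d.+2]
    freezes the number of rounds, [d.+3] holds the test. The exit jumps to the last instruction,
    which restores [x], so a loop variable is local to its loop. *)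
Definition loop_code (d x y p : nat) (body : seq instr) : seq instr :=
  [:: SetConst d.+1 0; Add d x d.+1; Add d.+2 y d.+1; SetConst x 0;
      Defs.Sub d.+3 d.+2 x; JumpZero d.+3 (p + 10 + size body)] ++
  body ++
  [:: SetConst d.+3 1; Add x x d.+3; SetConst d.+3 0; JumpZero d.+3 (p + 4);
      Add x d d.+1].

(* Code at address [p] leaving the value of [e] in register [d] and the
   registers below [d] unchanged. *)
Fixpoint ecode (e : expr) (d p : nat) : seq instr :=
  match e with
  | ECst c => [:: SetConst d c]
  | EVar x => [:: SetConst d 0; Add d d x]
  | EAdd a b => let ca := ecode a d p in
      ca ++ ecode b d.+1 (p + size ca) ++ [:: Add d d d.+1]
  | ESub a b => let ca := ecode a d p in
      ca ++ ecode b d.+1 (p + size ca) ++ [:: Defs.Sub d d d.+1]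
  | EDbl a => ecode a d p ++ [:: Add d d d]
  | EMem a => ecode a d p ++ [:: Read d d]
  | EIf a b c =>
      let ca := ecode a d p in
      let cb := ecode b d (p + size ca + 1) in
      let p' := p + size ca + 1 + size cb + 2 in
      let cc := ecode c d p' in
      ca ++ [:: JumpZero d p'] ++ cb ++
        [:: SetConst d.+1 0; JumpZero d.+1 (p' + size cc)] ++ cc
  | ESum x y a =>
      SetConst d 0 ::
        loop_code d.+1 x y p.+1 (ecode a (d + 5) (p + 7) ++ [:: Add d d (d + 5)])
  end.

Fixpoint ccode (c : cmd) (d p : nat) : seq instr :=
  match c with
  | CStore a b => let ca := ecode a d p in
      ca ++ ecode b d.+1 (p + size ca) ++ [:: Write d d.+1]
  | CSeq c1 c2 => let cc := ccode c1 d p in cc ++ ccode c2 d (p + size cc)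
  | CFor x y c => loop_code d x y p (ccode c (d + 4) (p + 6))
  end.

Definition code_at (P : program) (p : nat) (c : seq instr) : Prop :=
  forall i, i < size c -> onth P (p + i) = onth c i.

Definition runs (P : program) (t : nat) (c c' : config) : Prop :=
  exists2 k, k <= t & iter k (step P) c = c'.

Lemma code_at_cat P p c1 c2 :
  code_at P p (c1 ++ c2) -> code_at P p c1 /\ code_at P (p + size c1) c2.
Proof.
move=> H; split=> i Hi.
  by rewrite H ?size_cat ?onth_cat ?Hi //; lia.
rewrite -addnA H ?size_cat ?ltn_add2l // onth_cat ifF; first by congr onth; lia.
by lia.
Qed.

Lemma code_at_cons P p i c :
  code_at P p (i :: c) -> onth P p = Some i /\ code_at P p.+1 c.
Proof.
move=> H; split; first by have := H 0 isT; rewrite addn0.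
by move=> j Hj; rewrite addSnnS H.
Qed.

Lemma runs_trans P t1 t2 c1 c2 c3 :
  runs P t1 c1 c2 -> runs P t2 c2 c3 -> runs P (t1 + t2) c1 c3.
Proof.
case=> k1 H1 E1 [k2 H2 E2]; exists (k2 + k1); first by lia.
by rewrite iterD E1.
Qed.

Lemma runs_step P i p r m :
  onth P p = Some i -> runs P 1 (Config p r m) (exec i (Config p r m)).
Proof. by move=> H; exists 1 => //=; rewrite /step /= H. Qed.

Lemma runs_cons P i p p' r m t c' : onth P p' = Some i -> p = p' ->
  runs P t (exec i (Config p r m)) c' -> runs P t.+1 (Config p r m) c'.
Proof. by move=> H -> H'; rewrite -add1n; apply: runs_trans H'; apply: runs_step. Qed.

Lemma runs_le P t t' c c' : t <= t' -> runs P t c c' -> runs P t' c c'.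
Proof. by move=> H [k Hk E]; exists k => //; apply: leq_trans Hk H. Qed.

Lemma runs_refl P c : runs P 0 c c.
Proof. by exists 0. Qed.

Lemma update_eq f a v : update f a v a = v.
Proof. by rewrite /update eqxx. Qed.

Lemma update_neq f a v x : x != a -> update f a v x = f x.
Proof. by rewrite /update => /negPf->. Qed.

Lemma update_ext f g a v x : f x = g x -> update f a v x = update g a v x.
Proof. by rewrite /update; case: eqP. Qed.

Lemma ev_ext v e r r' m : below v e -> (forall x, x < v -> r x = r' x) ->
  ev e r m = ev e r' m.
Proof.
elim: e r r' => //=.
- by move=> x r r' Hx; apply.
- by move=> a IHa b IHb r r' /andP[Ha Hb] H; rewrite (IHa _ r') ?(IHb _ r').
- by move=> a IHa b IHb r r' /andP[Ha Hb] H; rewrite (IHa _ r') ?(IHb _ r').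
- by move=> a IHa r r' Ha H; rewrite (IHa _ r').
- by move=> a IHa r r' Ha H; rewrite (IHa _ r').
- move=> a IHa b IHb c IHc r r' /and3P[Ha Hb Hc] H.
  by rewrite (IHa _ r') ?(IHb _ r') ?(IHc _ r').
- move=> x y a IHa r r' /and3P[Hx Hy Ha] H; rewrite (H y) //.
  by apply: eq_bigr => i _; apply: IHa => // z Hz; apply: update_ext; apply: H.
Qed.

Lemma den_ext v c r r' m : cbelow v c -> (forall x, x < v -> r x = r' x) ->
  den c r m = den c r' m.
Proof.
elim: c r r' m => /= [a b|c1 IH1 c2 IH2|x y c IH] r r' m.
- by move=> /andP[Ha Hb] H; rewrite (ev_ext _ Ha H) (ev_ext _ Hb H).
- by move=> /andP[H1 H2] H; rewrite (IH1 _ r') ?(IH2 _ r').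
- move=> /and3P[Hx Hy Hc] H; rewrite (H y) //; elim: (r' y) => //= k ->.
  by apply: IH => // z Hz; apply: update_ext; apply: H.
Qed.

(** [R i] and [m i] are the registers below [d] and the memory before round [i]. A sum lets its
    accumulator vary in [R], a command loop lets [m] vary; both are instances. *)
Lemma loop_code_runs P d x y p body (R m : nat -> nat -> nat) N T r0 :
  x < d -> y < d -> code_at P p (loop_code d x y p body) ->
  (forall i r, i < N -> (forall z, z < d -> r z = update (R i) x i z) ->
    exists r', [/\ runs P T (Config (p + 6) r (m i))
                          (Config (p + 6 + size body) r' (m i.+1)),
      (forall z, z < d -> r' z = update (R i.+1) x i z)
      & (forall z, d <= z < d + 3 -> r' z = r z)]) ->
  (forall z, z < d -> r0 z = R 0 z) -> r0 y = N ->
  exists2 r', runs P (N * (T + 6) + 7) (Config p r0 (m 0))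
                    (Config (p + size (loop_code d x y p body)) r' (m N))
    & forall z, z < d -> r' z = update (R N) x (r0 x) z.
Proof.
move=> xd yd /code_at_cat[/code_at_cons[c0] /code_at_cons[c1] /code_at_cons[c2]
  /code_at_cons[c3] /code_at_cons[c4] /code_at_cons[c5] _].
move=> /code_at_cat[cb] /code_at_cons[e0] /code_at_cons[e1] /code_at_cons[e2]
  /code_at_cons[e3] /code_at_cons[e4] _ Hbody H0 Hy.
pose head i (r : nat -> nat) := [/\ forall z, z < d -> r z = update (R i) x i z,
  r d = r0 x, r d.+1 = 0 & r d.+2 = N].
have nd z k : z < d -> (z == d + k) = false by lia.
have nd' z : z < d -> ((z == d) = false) * ((z == d.+1) = false) *
   ((z == d.+2) = false) * ((z == d.+3) = false) by move=> ?; do !split; lia.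
have dd : ((d.+1 == d) = false) * ((d.+2 == d) = false) *
   ((d == d.+1) = false) * ((d == d.+2) = false) * ((d == d.+3) = false) *
   ((d.+1 == d.+2) = false) * ((d.+2 == d.+1) = false) *
   ((d.+1 == d.+3) = false) * ((d.+2 == d.+3) = false) * ((d.+3 == d) = false) *
   ((d.+3 == d.+1) = false) * ((d.+3 == d.+2) = false)
   by do !split; lia.
have xdd : ((d == x) = false) * ((d.+1 == x) = false) * ((d.+2 == x) = false) *
   ((d.+3 == x) = false) by do !split; lia.
(* Induction on the number [k] of rounds left, starting each time at the loop test, at address
   [p + 4]. *)
have loop k : forall i r, i + k = N -> head i r ->
  exists2 r', runs P (k * (T + 6) + 3) (Config (p + 4) r (m i))
                 (Config (p + size (loop_code d x y p body)) r' (m N))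
    & forall z, z < d -> r' z = update (R N) x (r0 x) z.
  elim: k => [|k IH] i r Hi [Hr Hd Hd1 Hd2].
    have Ei : i = N by lia.
    eexists.
      apply: (runs_cons c4); first by lia.
      apply: (runs_cons c5); first by rewrite /=; lia.
      rewrite /= (Hr x) // !update_eq Hd2 Ei subnn eqxx.
      apply: (runs_cons e4); first by rewrite /=; lia.
      rewrite /= (_ : _.+1 = p + size (loop_code d x y p body)); last first.
        by rewrite /loop_code !size_cat /=; lia.
      exact: runs_refl.
    move=> z Hz /=; rewrite /update ?dd ?xdd; case: eqP => [_|/eqP/negPf zx].
      by rewrite Hd Hd1 addn0.
    by rewrite ?nd' // Hr // /update zx Ei.
  have Hbi : i < N by lia.
  pose r1 := update r d.+3 (N - i).
  have Hr1 z : z < d -> r1 z = update (R i) x i z.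
    by move=> Hz; rewrite /r1 {1}/update nd' // Hr.
  have [r' [Rb Hr' Hk]] := Hbody i r1 Hbi Hr1.
  pose r2 := update (update (update r' d.+3 1) x i.+1) d.+3 0.
  have Hh : head i.+1 r2.
    split; rewrite /r2.
    - move=> z Hz; rewrite /update nd' //; case: eqP => // /eqP/negPf zx.
      by rewrite ?nd' // Hr' // /update zx.
    - by rewrite /update ?dd ?xdd Hk ?leqnn ?ltnS ?leq_addr //; [rewrite /r1 /update dd|lia].
    - by rewrite /update ?dd ?xdd Hk; [rewrite /r1 /update dd|lia].
    - by rewrite /update ?dd ?xdd Hk; [rewrite /r1 /update dd|lia].
  have Hik : i.+1 + k = N by lia.
  have [rf Rf Hf] := IH i.+1 r2 Hik Hh.
  exists rf => //; rewrite mulSn -addnA.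
  apply: runs_trans Rf.
  apply: (@runs_le _ (T + 4).+2); first by lia.
  apply: (runs_cons c4); first by lia.
  apply: (runs_cons c5); first by rewrite /=; lia.
  rewrite /= (Hr x) // !update_eq Hd2 ifF; last by lia.
  rewrite (_ : (p + 4).+2 = p + 6); last by lia.
  apply: runs_trans Rb _.
  apply: (runs_cons e0); first by rewrite /=; lia.
  apply: (runs_cons e1); first by rewrite /=; lia.
  apply: (runs_cons e2); first by rewrite /=; lia.
  apply: (runs_cons e3); first by rewrite /=; lia.
  rewrite /= update_eq eqxx update_eq.
  rewrite (_ : update r' d.+3 1 x + 1 = i.+1); first exact: runs_refl.
  by rewrite /update nd' // Hr' // update_eq addn1.
pose r1 := update (update (update (update r0 d.+1 0) d (r0 x)) d.+2 N) x 0.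
have Hh : head 0 r1.
  split; rewrite /r1.
  - move=> z Hz; rewrite /update; case: eqP => // /eqP zx.
    by rewrite ?nd' // H0.
  - by rewrite /update ?dd ?xdd eqxx.
  - by rewrite /update ?dd ?xdd eqxx.
  - by rewrite /update ?dd ?xdd eqxx.
have [rf Rf Hf] := loop N 0 r1 (erefl _) Hh.
exists rf => //.
rewrite (_ : N * (T + 6) + 7 = (N * (T + 6) + 3).+4); last by lia.
apply: (runs_cons c0) => //.
apply: (runs_cons c1) => //.
apply: (runs_cons c2) => //.
apply: (runs_cons c3) => //.
move: Rf; rewrite /= (_ : p + 4 = p.+4); last by lia.
set ra := (X in runs _ _ (Config _ X _) _ -> _).
set rb := (X in _ -> runs _ _ (Config _ X _) _).
suff -> : ra = rb by [].
rewrite /ra /rb /r1; congr update.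
have -> : update r0 d.+1 0 x = r0 x by rewrite /update nd'.
have -> : update r0 d.+1 0 d.+1 = 0 by rewrite update_eq.
rewrite addn0; congr update.
have -> : update (update r0 d.+1 0) d (r0 x) y = N.
  by rewrite /update ?nd' ?Hy.
by rewrite /update dd eqxx addn0.
Qed.

Lemma ecode_runs v rs M P e : all (ltn^~ v) rs -> below v e -> bounded rs e ->
  forall d p r m, v <= d -> code_at P p (ecode e d p) ->
  (forall y, y \in rs -> r y <= M) ->
  exists r', [/\ runs P (ecost e M) (Config p r m)
                  (Config (p + size (ecode e d p)) r' m),
    r' d = ev e r m & forall x, x < d -> r' x = r x].
Proof.
move=> /allP Hrs.
have lift (r r' : nat -> nat) d : v <= d -> (forall x, x < d -> r' x = r x) ->
  (forall y, y \in rs -> r y <= M) -> forall y, y \in rs -> r' y <= M.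
  move=> vd H HM y Hy; rewrite H ?HM //; apply: leq_trans vd; exact: Hrs.
have nd z d : z < d -> ((z == d) = false) * ((z == d.+1) = false).
  by move=> ?; split; lia.
have bin a b op : (forall d p r m, v <= d -> code_at P p (ecode a d p) ->
    (forall y, y \in rs -> r y <= M) ->
    exists r', [/\ runs P (ecost a M) (Config p r m)
                  (Config (p + size (ecode a d p)) r' m),
    r' d = ev a r m & forall x, x < d -> r' x = r x]) ->
  (forall d p r m, v <= d -> code_at P p (ecode b d p) ->
    (forall y, y \in rs -> r y <= M) ->
    exists r', [/\ runs P (ecost b M) (Config p r m)
                  (Config (p + size (ecode b d p)) r' m),
    r' d = ev b r m & forall x, x < d -> r' x = r x]) -> below v b ->
  forall d p r m, v <= d ->
  code_at P p (ecode a d p ++ ecode b d.+1 (p + size (ecode a d p)) ++ [:: op]) ->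
  (forall y, y \in rs -> r y <= M) ->
  exists r', [/\ runs P (ecost a M + ecost b M) (Config p r m)
       (Config (p + size (ecode a d p) + size (ecode b d.+1 (p + size (ecode a d p)))) r' m),
    r' d = ev a r m, r' d.+1 = ev b r m, forall x, x < d -> r' x = r x
    & onth P (p + size (ecode a d p) + size (ecode b d.+1 (p + size (ecode a d p)))) = Some op].
  move=> IHa IHb Hb d p r m vd /code_at_cat[ca /code_at_cat[cb /code_at_cons[co _]]] HM.
  have [r1 [R1 E1 H1]] := IHa d p r m vd ca HM.
  have [r2 [R2 E2 H2]] := IHb d.+1 _ r1 m (leqW vd) cb (lift _ _ _ vd H1 HM).
  exists r2; split => //.
  - exact: runs_trans R1 R2.
  - by rewrite H2.
  - by rewrite E2; apply: ev_ext Hb _ => x Hx; rewrite H1 // (leq_trans Hx).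
  - by move=> x Hx; rewrite H2 ?H1 //; lia.
elim: e => [c|x|a IHa b IHb|a IHa b IHb|a IHa|a IHa|a IHa b IHb c IHc|x y a IHa] /=.
- move=> _ _ d p r m vd /code_at_cons[c0 _] HM; exists (update r d c).
  split; first by rewrite addn1; apply: (runs_cons c0) => //; exact: runs_refl.
    by rewrite update_eq.
  by move=> x Hx; rewrite /update nd.
- move=> xv _ d p r m vd /code_at_cons[c0 /code_at_cons[c1 _]] HM.
  exists (update (update r d 0) d (r x)).
  split; last by move=> z Hz; rewrite /update nd.
    apply: (runs_cons c0) => //; apply: (runs_cons c1) => //=.
    rewrite addn2 update_eq add0n (_ : update r d 0 x = r x); first exact: runs_refl.
    by rewrite /update (nd x d (leq_trans xv vd)).
  by rewrite update_eq.
- move=> /andP[Ba Bb] /andP[Ca Cb] d p r m vd cod HM.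
  have [r2 [R2 Ea Eb H2 co]] := bin a b _ (IHa Ba Ca) (IHb Bb Cb) Bb d p r m vd cod HM.
  exists (update r2 d (ev a r m + ev b r m)).
  split; last by move=> z Hz; rewrite /update nd // H2.
    apply: runs_trans R2 _; apply: (runs_cons co) => //=.
    rewrite Ea Eb !size_cat /= (_ : _.+1 = p + (size (ecode a d p)
       + (size (ecode b d.+1 (p + size (ecode a d p))) + 1))); last by lia.
    exact: runs_refl.
  by rewrite update_eq.
- move=> /andP[Ba Bb] /andP[Ca Cb] d p r m vd cod HM.
  have [r2 [R2 Ea Eb H2 co]] := bin a b _ (IHa Ba Ca) (IHb Bb Cb) Bb d p r m vd cod HM.
  exists (update r2 d (ev a r m - ev b r m)).
  split; last by move=> z Hz; rewrite /update nd // H2.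
    apply: runs_trans R2 _; apply: (runs_cons co) => //=.
    rewrite Ea Eb !size_cat /= (_ : _.+1 = p + (size (ecode a d p)
       + (size (ecode b d.+1 (p + size (ecode a d p))) + 1))); last by lia.
    exact: runs_refl.
  by rewrite update_eq.
- move=> Ba Ca d p r m vd /code_at_cat[ca /code_at_cons[co _]] HM.
  have [r1 [R1 E1 H1]] := IHa Ba Ca d p r m vd ca HM.
  exists (update r1 d (ev a r m + ev a r m)).
  split; last by move=> z Hz; rewrite /update nd // H1.
    apply: runs_trans R1 _; apply: (runs_cons co) => //=.
    by rewrite E1 size_cat /= addnA addn1; exact: runs_refl.
  by rewrite update_eq.
- move=> Ba Ca d p r m vd /code_at_cat[ca /code_at_cons[co _]] HM.
  have [r1 [R1 E1 H1]] := IHa Ba Ca d p r m vd ca HM.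
  exists (update r1 d (m (ev a r m))).
  split; last by move=> z Hz; rewrite /update nd // H1.
    apply: runs_trans R1 _; apply: (runs_cons co) => //=.
    by rewrite E1 size_cat /= addnA addn1; exact: runs_refl.
  by rewrite update_eq.
- move=> /and3P[Ba Bb Bc] /and3P[Ca Cb Cc] d p r m vd.
  move=> /code_at_cat[ca /code_at_cons[c0 /code_at_cat[cb]]].
  move=> /code_at_cons[c1 /code_at_cons[c2 cc]] HM.
  have [r1 [R1 E1 H1]] := IHa Ba Ca d p r m vd ca HM.
  have Hev e' : below v e' -> ev e' r1 m = ev e' r m.
    by move=> B; apply: ev_ext B _ => z Hz; rewrite H1 // (leq_trans Hz).
  set q := p + size (ecode a d p).
  set pc := q + 1 + size (ecode b d (q + 1)) + 2.
  rewrite -/q -/pc in c0 cb c1 c2 cc.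
  rewrite !size_cat /= !size_cat /= -/q -/pc.
  have [E0|E0] := eqVneq (ev a r m) 0.
    have ccc : code_at P pc (ecode c d pc).
      by move: cc; rewrite (_ : _.+2 = pc) // /pc; lia.
    have [r2 [R2 E2 H2]] := IHc Bc Cc d pc r1 m vd ccc (lift _ _ _ vd H1 HM).
    exists r2; split; [|by rewrite E2 Hev|by move=> z Hz; rewrite H2 // H1].
    apply: (@runs_le _ (ecost a M + (ecost c M).+1)); first by lia.
    apply: runs_trans R1 _; apply: (runs_cons c0) => //=.
    rewrite E1 E0 eqxx; move: R2; congr (runs _ _ _ (Config _ _ _)).
    by rewrite /pc /q; lia.
  rewrite -{1}(addn1 q) in cb.
  have [r2 [R2 E2 H2]] := IHb Bb Cb d (q + 1) r1 m vd cb (lift _ _ _ vd H1 HM).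
  (* There is no unconditional jump: the else branch is skipped by zeroing [d.+1] and testing it. *)
  exists (update r2 d.+1 0); split.
  - apply: (@runs_le _ (ecost a M + (ecost b M + 2).+1)); first by lia.
    apply: runs_trans R1 _; apply: (runs_cons c0) => //=.
    rewrite E1 (negPf E0) -{1}(addn1 q); apply: runs_trans R2 _.
    apply: (runs_cons c1) => //=; first by rewrite addn1.
    apply: (runs_cons c2) => //=; first by rewrite addn1.
    rewrite update_eq eqxx (_ : pc + _ = p + (size (ecode a d p) +
      (size (ecode b d (q + 1)) + (size (ecode c d pc)).+2).+1)).
      exact: runs_refl.
    by rewrite /pc /q; lia.
  - by rewrite /update ifF ?E2 ?Hev //; lia.
  - by move=> z Hz; rewrite /update ifF ?H2 // ?H1 //; lia.
- move=> /and3P[xv yv Ba] /andP[yrs Ca] d p r m vd /code_at_cons[c0 cl] HM.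
  pose S i := \sum_(j < i) ev a (update r x j) m.
  pose R i := update r d (S i).
  have xd : x < d := leq_trans xv vd.
  have yd : y < d := leq_trans yv vd.
  have S0 : S 0 = 0 by rewrite /S big_ord0.
  have [|z||rf Rf Hf] := @loop_code_runs P d.+1 x y p.+1 _ R (fun=> m) (r y)
    (ecost a M + 1) (update r d 0) (ltnW xd) (ltnW yd) cl.
  + move=> i r1 iN Hr1.
    move: cl => /code_at_cat[_ /code_at_cat[cb _]].
    move: cb; rewrite /= => /code_at_cat[ca /code_at_cons[co _]].
    have Hp : p.+1 + 6 = p + 7 by lia.
    rewrite Hp in ca co *.
    have Hr1' z : z < v -> r1 z = update r x i z.
      move=> Hz; rewrite Hr1 //; last by lia.
      by apply: update_ext; rewrite /R /update nd //; apply: leq_trans vd.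
    (* The loop variable may itself bound an inner loop; its value stays below [r y <= M]. *)
    have HM1 y' : y' \in rs -> r1 y' <= M.
      move=> Hy'; rewrite Hr1'; last exact: Hrs.
      rewrite /update; case: eqP => [_|_]; last exact: HM.
      by apply: (leq_trans (ltnW iN)); apply: HM.
    have vd5 : v <= d + 5 by lia.
    have [r2 [R2 E2 H2]] := IHa Ba Ca (d + 5) _ r1 m vd5 ca HM1.
    have Ed : r2 d = S i.
      by rewrite H2 ?Hr1 /R //; [rewrite /update eqxx ifF //|]; lia.
    exists (update r2 d (S i.+1)); split.
    * apply: runs_trans R2 _; apply: (runs_cons co) => //=.
      rewrite E2 (ev_ext _ Ba Hr1') Ed.
      rewrite (_ : S i + _ = S i.+1); last by rewrite /S big_ord_recr.
      rewrite size_cat /= (_ : _.+1 = p + 7 + (size (ecode a (d + 5) (p + 7)) + 1)).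
        exact: runs_refl.
      by lia.
    * move=> z Hz; rewrite /R /update; case: (z =P d) => [->|zd].
        by rewrite ifF //; lia.
      rewrite H2 ?Hr1 /R /update; [|lia|lia].
      by case: eqP => // _; case: eqP => // /zd.
    * by move=> z Hz; rewrite /update ifF ?H2 //; lia.
  + by move=> Hz; rewrite /R S0.
  + by rewrite /update nd.
  exists rf; split.
  + apply: (@runs_le _ ((r y * (ecost a M + 1 + 6) + 7).+1)).
      have := HM y yrs => Hy; have : r y * (ecost a M + 1 + 6) <= M * (ecost a M + 7).
        by rewrite leq_mul //; lia.
      by lia.
    by apply: (runs_cons c0) => //; move: Rf; rewrite addSnnS.
  + by rewrite Hf // /R /update eqxx ifF //; lia.
  + move=> z Hz; rewrite Hf; last by lia.
    rewrite /R /update; case: eqP => [->|_]; first by rewrite ifF //; lia.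
    by rewrite ifF //; lia.
Qed.

Lemma ccode_runs v rs M P c : all (ltn^~ v) rs -> cbelow v c -> cbounded rs c ->
  forall d p r m, v <= d -> code_at P p (ccode c d p) ->
  (forall y, y \in rs -> r y <= M) ->
  exists2 r', runs P (ccost c M) (Config p r m)
                  (Config (p + size (ccode c d p)) r' (den c r m))
    & forall x, x < d -> r' x = r x.
Proof.
move=> aHrs; have /allP Hrs := aHrs.
have lift (r r' : nat -> nat) d : v <= d -> (forall x, x < d -> r' x = r x) ->
  (forall y, y \in rs -> r y <= M) -> forall y, y \in rs -> r' y <= M.
  move=> vd H HM y Hy; rewrite H ?HM //; apply: leq_trans vd; exact: Hrs.
elim: c => [a b|c1 IH1 c2 IH2|x y c IH] /=.
- move=> /andP[Ba Bb] /andP[Ca Cb] d p r m vd.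
  move=> /code_at_cat[ca /code_at_cat[cb /code_at_cons[co _]]] HM.
  have [r1 [R1 E1 H1]] := ecode_runs aHrs Ba Ca m vd ca HM.
  have [r2 [R2 E2 H2]] := ecode_runs aHrs Bb Cb m (leqW vd) cb (lift _ _ _ vd H1 HM).
  exists r2; last by move=> x Hx; rewrite H2 ?H1 //; lia.
  rewrite addn1; apply: (@runs_le _ (ecost a M + (ecost b M + 1))); first by lia.
  apply: runs_trans R1 _; apply: runs_trans R2 _.
  apply: (runs_cons co) => //=.
  rewrite H2 // E1 E2 (@ev_ext v b r1 r) //; last first.
    by move=> x Hx; rewrite H1 // (leq_trans Hx).
  rewrite !size_cat /= (_ : _.+1 = p + (size (ecode a d p)
       + (size (ecode b d.+1 (p + size (ecode a d p))) + 1))); last by lia.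
  exact: runs_refl.
- move=> /andP[B1 B2] /andP[C1 C2] d p r m vd /code_at_cat[k1 k2] HM.
  have [r1 R1 H1] := IH1 B1 C1 d p r m vd k1 HM.
  have [r2 R2 H2] := IH2 B2 C2 d _ r1 (den c1 r m) vd k2 (lift _ _ _ vd H1 HM).
  exists r2; last by move=> x Hx; rewrite H2 ?H1.
  rewrite size_cat addnA; apply: runs_trans R1 _.
  rewrite (@den_ext v c2 r r1) // => x Hx; rewrite H1 //; exact: leq_trans vd.
- move=> /and3P[xv yv Bc] /andP[yrs Cc] d p r m vd cl HM.
  have xd : x < d := leq_trans xv vd.
  have yd : y < d := leq_trans yv vd.
  pose mm i := iteri i (fun i m => den c (update r x i) m) m.
  have [|//|//|rf Rf Hf] := @loop_code_runs P d x y p _ (fun=> r) mm (r y)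
    (ccost c M) r xd yd cl.
  + move=> i r1 iN Hr1.
    move: cl => /code_at_cat[_ /code_at_cat[cb _]].
    have Hr1' z : z < v -> r1 z = update r x i z.
      by move=> Hz; rewrite Hr1 //; lia.
    have HM1 y' : y' \in rs -> r1 y' <= M.
      move=> Hy'; rewrite Hr1'; last exact: Hrs.
      rewrite /update; case: eqP => [_|_]; last exact: HM.
      by apply: (leq_trans (ltnW iN)); apply: HM.
    have vd4 : v <= d + 4 by lia.
    have [r2 R2 H2] := IH Bc Cc (d + 4) _ r1 (mm i) vd4 cb HM1.
    exists r2; split.
    * by move: R2; rewrite (den_ext _ Bc Hr1').
    * by move=> z Hz; rewrite H2 ?Hr1 //; lia.
    * by move=> z Hz; rewrite H2 //; lia.
  exists rf.
    apply: runs_le Rf; rewrite leq_add2r leq_mul //; exact: HM.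
  by move=> z Hz; rewrite Hf // /update; case: eqP => // ->.
Qed.

(** The nesting depth is fixed by the expression and each loop raises the degree by one. The shape
    [K * M.+1 ^ D] is closed under sums because [M.+1] is at least 1. *)
Lemma ecost_poly e : exists K D, forall M, ecost e M <= K * M.+1 ^ D.
Proof.
have comb K1 D1 K2 D2 M : K1 * M.+1 ^ D1 + K2 * M.+1 ^ D2 <=
    (K1 + K2) * M.+1 ^ (D1 + D2).
  rewrite mulnDl leq_add // leq_mul2l leq_pexp2l ?orbT //; lia.
have one D M : 1 <= M.+1 ^ D by rewrite expn_gt0.
elim: e => [c|x|a [K1 [D1 H1]] b [K2 [D2 H2]]|a [K1 [D1 H1]] b [K2 [D2 H2]]
  |a [K1 [D1 H1]]|a [K1 [D1 H1]]
  |a [K1 [D1 H1]] b [K2 [D2 H2]] c [K3 [D3 H3]]|x y a [K1 [D1 H1]]] /=.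
- by exists 1, 0.
- by exists 2, 0.
- exists (K1 + K2 + 1), (D1 + D2) => M; have := comb K1 D1 K2 D2 M.
  by have := H1 M; have := H2 M; have := one (D1 + D2) M; lia.
- exists (K1 + K2 + 1), (D1 + D2) => M; have := comb K1 D1 K2 D2 M.
  by have := H1 M; have := H2 M; have := one (D1 + D2) M; lia.
- by exists (K1 + 1), D1 => M; have := H1 M; have := one D1 M; lia.
- by exists (K1 + 1), D1 => M; have := H1 M; have := one D1 M; lia.
- exists (K1 + K2 + K3 + 3), (D1 + D2 + D3) => M.
  have := comb K1 D1 K2 D2 M; have := comb (K1 + K2) (D1 + D2) K3 D3 M.
  by have := H1 M; have := H2 M; have := H3 M; have := one (D1 + D2 + D3) M; lia.
- exists (K1 + 15), D1.+1 => M; rewrite expnS.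
  have := H1 M; have := one D1 M; set X := M.+1 ^ D1 => X0 HX.
  have : M * (ecost a M + 7) <= M * ((K1 + 7) * X) by rewrite leq_mul2l; apply/orP; right; lia.
  by nia.
Qed.

Lemma ccost_poly c : exists K D, forall M, ccost c M <= K * M.+1 ^ D.
Proof.
have comb K1 D1 K2 D2 M : K1 * M.+1 ^ D1 + K2 * M.+1 ^ D2 <=
    (K1 + K2) * M.+1 ^ (D1 + D2).
  rewrite mulnDl leq_add // leq_mul2l leq_pexp2l ?orbT //; lia.
have one D M : 1 <= M.+1 ^ D by rewrite expn_gt0.
elim: c => [a b|c1 [K1 [D1 H1]] c2 [K2 [D2 H2]]|x y c [K1 [D1 H1]]] /=.
- have [K1 [D1 H1]] := ecost_poly a; have [K2 [D2 H2]] := ecost_poly b.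
  exists (K1 + K2 + 1), (D1 + D2) => M; have := comb K1 D1 K2 D2 M.
  by have := H1 M; have := H2 M; have := one (D1 + D2) M; lia.
- exists (K1 + K2), (D1 + D2) => M; have := comb K1 D1 K2 D2 M.
  by have := H1 M; have := H2 M; lia.
- exists (K1 + 13), D1.+1 => M; rewrite expnS.
  have := H1 M; have := one D1 M; set X := M.+1 ^ D1 => X0 HX.
  have : M * (ccost c M + 6) <= M * ((K1 + 6) * X) by rewrite leq_mul2l; apply/orP; right; lia.
  by nia.
Qed.

Lemma sum_ltn_ord n d : d <= n -> \sum_(x < n) (x < d) = d.
Proof.
move=> dn; rewrite (eq_bigr (fun x : 'I_n => nat_of_bool (x < d))) //.
rewrite -(big_mkord xpredT (fun x => nat_of_bool (x < d))) (big_cat_nat (n := d)) //=.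
rewrite (@eq_big_nat _ _ _ 0 d _ (fun=> 1)); last by move=> i /andP[_ ->].
rewrite (@eq_big_nat _ _ _ d n _ (fun=> 0)); last by move=> i /andP[Hi _]; rewrite ltnNge Hi.
by rewrite sum_nat_const_nat big1 // subn0 muln1 addn0.
Qed.

(** Division by counting: the quotient is the number of positive multiples of [w] up to [K],
    provided enough of them are tried. *)
Lemma sum_div n w K : 0 < w -> K %/ w <= n -> \sum_(x < n) (x.+1 * w <= K) = K %/ w.
Proof.
move=> w0 Hn; rewrite -[RHS](sum_ltn_ord Hn); apply: eq_bigr => x _.
by rewrite -leq_divRL.
Qed.

Lemma sum_bool_exists n (b : nat -> bool) :
  (0 < \sum_(x < n) b x) = [exists x : 'I_n, b x].
Proof.
rewrite lt0n sum_nat_eq0; apply/idP/idP.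
  case/forallPn => x; rewrite implyTb eqb0 negbK => H.
  by apply/existsP; exists x.
by case/existsP => x Hx; apply/forallPn; exists x; rewrite implyTb eqb0 negbK.
Qed.

(** * Ranking the elements of a set of numbers *)

Section Rank.
Variables (M : nat) (k : nat -> bool) (code : nat -> nat).

Definition rank (c : nat) : nat := \sum_(c' < M) (k c' && (code c' < code c)).

(** A search written as a sum: at most one term is nonzero when [code] is injective on [k]. A rank
    out of range yields 0. *)
Definition unrank (r : nat) : nat :=
  \sum_(c < M) if k c && (rank c == r) then c : nat else 0.

Lemma rank_lt c : c < M -> k c -> rank c < \sum_(c' < M) k c'.
Proof.
move=> cM kc; rewrite [rank c](bigD1 (Ordinal cM)) //= ltnn andbF add0n.
rewrite [X in _ < X](bigD1 (Ordinal cM)) //= kc add1n ltnS.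
by apply: leq_sum => i _; case: (k i) => //; case: (_ < _).
Qed.

Lemma rank_mono c c' : c < M -> k c -> code c < code c' -> rank c < rank c'.
Proof.
move=> cM kc H; rewrite [rank c'](bigD1 (Ordinal cM)) //= kc H.
rewrite [rank c](bigD1 (Ordinal cM)) //= ltnn andbF add0n add1n ltnS.
apply: leq_sum => i _; case: (k i) => //=.
by case H1: (_ < _) => //; rewrite (ltn_trans H1 H).
Qed.

Hypothesis code_inj : forall c c', c < M -> c' < M -> k c -> k c' ->
  code c = code c' -> c = c'.

Lemma rank_inj c c' : c < M -> c' < M -> k c -> k c' -> rank c = rank c' -> c = c'.
Proof.
move=> cM cM' kc kc' E; apply: code_inj => //.
case: (ltngtP (code c) (code c')) => // H.
  by have := rank_mono cM kc H; rewrite E ltnn.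
by have := rank_mono cM' kc' H; rewrite E ltnn.
Qed.

(** Pigeonhole: the ranks are distinct, lie below the number of elements, and there are as many of
    them. *)
Lemma rank_surj r : r < \sum_(c < M) k c ->
  exists c, [/\ c < M, k c & rank c = r].
Proof.
move=> rL; set L := \sum_(c < M) k c in rL.
pose s := [seq rank c | c <- [seq c <- iota 0 M | k c]].
have Es : size s = L.
  rewrite size_map size_filter -sum1_count big_mkcond /=.
  have -> : iota 0 M = index_iota 0 M by rewrite /index_iota subn0.
  by rewrite big_mkord; apply: eq_bigr => i _; case: (k i).
have Us : uniq s.
  rewrite map_inj_in_uniq ?filter_uniq ?iota_uniq // => c c'.
  by rewrite !mem_filter !mem_iota /= !add0n => /andP[? ?] /andP[? ?]; apply: rank_inj.
have Ss : {subset s <= iota 0 L}.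
  move=> x /mapP[c]; rewrite mem_filter mem_iota /= add0n => /andP[kc cM] ->.
  by rewrite mem_iota /= add0n rank_lt.
have sz : size (iota 0 L) <= size s by rewrite size_iota Es.
have [_ H] := uniq_min_size Us Ss sz.
have : r \in s by rewrite H mem_iota add0n.
case/mapP => c; rewrite mem_filter mem_iota /= add0n => /andP[kc cM] ->.
by exists c.
Qed.

Lemma unrank_rank c : c < M -> k c -> unrank (rank c) = c.
Proof.
move=> cM kc; rewrite /unrank (bigD1 (Ordinal cM)) //= kc eqxx big1 ?addn0 //.
move=> i /eqP Hi; case: ifP => // /andP[ki /eqP E]; case: Hi; apply: val_inj.
exact: rank_inj E.
Qed.

End Rank.

Lemma unrank_lt M (k : nat -> bool) (code : nat -> nat) r : 0 < M ->
  (forall c c', c < M -> c' < M -> k c -> k c' -> code c = code c' -> c = c') ->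
  unrank M k code r < M.
Proof.
move=> M0 cI; have [rL|rL] := ltnP r (\sum_(c < M) k c).
  by have [c [cM kc <-]] := rank_surj cI rL; rewrite unrank_rank.
rewrite /unrank big1 // => c _; rewrite ifF //; apply/andP => -[kc /eqP E].
by have := rank_lt code (ltn_ord c) kc; rewrite E ltnNge rL.
Qed.

(** * Dynamic programming along a vertex order *)

(* Vertices are named by their positions below [N] in the order.  After the
   first [j] vertices, the number of cut edges still to come depends on the
   chosen side [S] only through the degrees into [S] of the remaining vertices;
   [sig j S] packs them as digits in base [n.+1]. *)
Section DP.
Variables (n N W : nat) (a : nat -> nat -> bool).
Hypothesis Nn : N <= n.
Implicit Types (S : nat -> bool).

(** Earlier positions weigh more, so the digit of the next vertex to be processed is always the
    leading one: [digit] is a quotient and [below_digit] a remainder. *)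
Definition weight (j : nat) : nat := n.+1 ^ (N.-1 - j).
Definition deg_in (j : nat) S (l : nat) : nat := \sum_(x < j) (S x && a x l).
Definition sig (j : nat) S : nat := \sum_(j <= l < N) deg_in j S l * weight l.
Definition cutv (j : nat) S : nat := \sum_(x < j) \sum_(y < x) (a y x && (S x != S y)).
Definition setcode (j : nat) S : nat := \sum_(x < j) S x * weight x.

Definition digit (j K : nat) : nat := \sum_(x < n) (x.+1 * weight j <= K).
Definition below_digit (j K : nat) : nat := K - digit j K * weight j.
Definition back_deg (j : nat) : nat := \sum_(l < n) ((l < j) && a l j).
Definition fwd_code (j : nat) : nat :=
  \sum_(l < n) if [&& j < l, l < N & a j l] then weight l else 0.

Record level := Level { len : nat; lsig : nat -> nat; lval : nat -> nat;
                        lset : nat -> nat }.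

(* Candidate [c < W] extends entry [c] by leaving vertex [j] out of [S], and
   candidate [W + c] by putting it in. *)
Definition cstate (c : nat) : nat := if c < W then c else c - W.
Definition cvalid (s : level) (c : nat) : bool := cstate c < len s.
Definition csig (j : nat) (s : level) (c : nat) : nat :=
  below_digit j (lsig s (cstate c)) + if c < W then 0 else fwd_code j.
Definition cval (j : nat) (s : level) (c : nat) : nat :=
  lval s (cstate c) + if c < W then digit j (lsig s (cstate c))
                      else back_deg j - digit j (lsig s (cstate c)).
Definition cset (j : nat) (s : level) (c : nat) : nat :=
  lset s (cstate c) + if c < W then 0 else weight j.
Definition cbetter (j : nat) (s : level) (c c' : nat) : bool :=
  [&& cvalid s c', csig j s c' == csig j s c &
    (cval j s c < cval j s c') || (cval j s c' == cval j s c) && (c' < c)].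
Definition ckeep (j : nat) (s : level) (c : nat) : bool :=
  cvalid s c && (\sum_(c' < W + W) cbetter j s c c' == 0).
Definition next_level (j : nat) (s : level) : level :=
  let pickc := unrank (W + W) (ckeep j s) id in
  Level (\sum_(c < W + W) ckeep j s c) (fun r => csig j s (pickc r))
    (fun r => cval j s (pickc r)) (fun r => cset j s (pickc r)).
Definition levels (j : nat) : level :=
  iteri j next_level (Level 1 (fun=> 0) (fun=> 0) (fun=> 0)).

(** Attainable, dominating, free of duplicates. The last clause bounds the length of the table and,
    at level [N], leaves a single entry. *)
Definition sound_level (j : nat) (s : level) : Prop :=
  [/\ forall r, r < len s -> exists S,
        [/\ lsig s r = sig j S, lval s r = cutv j S & lset s r = setcode j S],
      forall S, exists2 r, r < len s & lsig s r = sig j S /\ cutv j S <= lval s r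
    & forall r r', r < len s -> r' < len s -> lsig s r = lsig s r' -> r = r'].

Lemma weight_gt0 j : 0 < weight j.
Proof. by rewrite expn_gt0. Qed.

Lemma deg_in_le j S l : j <= N -> deg_in j S l <= n.
Proof.
move=> jN; apply: (@leq_trans j); last exact: leq_trans Nn.
rewrite -[X in _ <= X]card_ord -sum1_card; apply: leq_sum => i _.
by case: (_ && _).
Qed.

Lemma deg_in_ext j S S' l : (forall x, x < j -> S x = S' x) ->
  deg_in j S l = deg_in j S' l.
Proof. by move=> H; apply: eq_bigr => x _; rewrite H. Qed.

(** Degrees are at most [n] and the base is [n.+1], so lower digits never carry into the leading
    one. *)
Lemma sum_weight_lt (d : nat -> nat) j : (forall l, d l <= n) -> j < N ->
  \sum_(j.+1 <= l < N) d l * weight l < weight j.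
Proof.
move=> Hd; have [k] := ubnP (N - j); elim: k j => // k IH j Hk jN.
have [jN1|jN1] := ltnP j.+1 N; last by rewrite big_geq // weight_gt0.
rewrite big_ltn //.
have Hk' : N - j.+1 < k by lia.
have := IH _ Hk' jN1.
have -> : weight j = n.+1 * weight j.+1.
  by rewrite /weight -expnS; congr (_ ^ _); lia.
have := Hd j.+1; set X := \sum_(_ <= _ < _) _; set w := weight j.+1; nia.
Qed.

Lemma sig_split j S : j < N -> sig j S =
  deg_in j S j * weight j + \sum_(j.+1 <= l < N) deg_in j S l * weight l.
Proof. by move=> jN; rewrite /sig big_ltn. Qed.

Lemma digit_sig j S : j < N -> digit j (sig j S) = deg_in j S j.
Proof.
move=> jN.
have Ht : \sum_(j.+1 <= l < N) deg_in j S l * weight l < weight j.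
  by apply: sum_weight_lt => // l; apply: deg_in_le; lia.
have E : sig j S %/ weight j = deg_in j S j.
  by rewrite sig_split // divnMDl ?weight_gt0 // divn_small // addn0.
by rewrite /digit sum_div ?weight_gt0 // E deg_in_le //; lia.
Qed.

Lemma below_digit_sig j S : j < N -> below_digit j (sig j S) =
  \sum_(j.+1 <= l < N) deg_in j S l * weight l.
Proof.
by move=> jN; rewrite /below_digit digit_sig // sig_split // addKn.
Qed.

(** Vertex [j] stops being a remaining vertex, which drops the leading digit; if it is chosen, the
    digit of each later neighbour grows by one. *)
Lemma sigS j S : j < N ->
  sig j.+1 S = below_digit j (sig j S) + if S j then fwd_code j else 0.
Proof.
move=> jN; rewrite below_digit_sig //.
have -> : (if S j then fwd_code j else 0) =
    \sum_(j.+1 <= l < N) (S j && a j l) * weight l.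
  case: (S j) => /=; last by rewrite big1 // => l _; rewrite mul0n.
  rewrite /fwd_code -(big_mkord xpredT (fun l => if [&& j < l, l < N & a j l] then weight l else 0)).
  rewrite (big_cat_nat (n := j.+1)) //=; last by lia.
  rewrite [X in X + _]big1_seq ?add0n; last first.
    by move=> l; rewrite mem_index_iota => /andP[_ /andP[_ H]]; rewrite ifF //; lia.
  rewrite (big_cat_nat (n := N)) //=.
  rewrite [X in _ + X]big1_seq ?addn0; last first.
    by move=> l; rewrite mem_index_iota => /andP[_ /andP[H _]]; rewrite ifF //; lia.
  apply: eq_big_nat => l /andP[H1 H2]; rewrite H1 H2 /=.
  by case: (a j l); rewrite ?mul1n ?mul0n.
rewrite -big_split /=; apply: eq_bigr => l _; rewrite -mulnDl; congr (_ * _).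
by rewrite /deg_in big_ord_recr.
Qed.

Lemma cutvS j S : j < N ->
  cutv j.+1 S = cutv j S + if S j then back_deg j - deg_in j S j else deg_in j S j.
Proof.
move=> jN; rewrite /cutv big_ord_recr /=; congr (_ + _).
have -> : back_deg j = \sum_(y < j) a y j.
  rewrite /back_deg -(big_mkord xpredT (fun l => nat_of_bool ((l < j) && a l j))).
  rewrite (big_cat_nat (n := j)) //=; last by lia.
  rewrite [X in _ + X]big1_seq ?addn0; last first.
    by move=> l; rewrite mem_index_iota => /andP[_ /andP[H _]]; rewrite ltnNge H.
  by rewrite big_mkord; apply: eq_bigr => y _; rewrite ltn_ord.
case: (S j); last by apply: eq_bigr => y _; case: (S y); case: (a y j).
rewrite -[LHS](addnK (deg_in j S j)); congr (_ - _).
rewrite /deg_in -big_split /=; apply: eq_bigr => y _.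
by case: (S y); case: (a y j).
Qed.

Lemma setcodeS j S : setcode j.+1 S = setcode j S + if S j then weight j else 0.
Proof. by rewrite /setcode big_ord_recr /=; case: (S j); rewrite ?mul1n ?mul0n. Qed.

Lemma ext_below j S S' : (forall x, x < j -> S x = S' x) ->
  [/\ sig j S = sig j S', cutv j S = cutv j S' & setcode j S = setcode j S'].
Proof.
move=> H; split.
- by apply: eq_bigr => l _; rewrite (deg_in_ext _ H).
- apply: eq_bigr => x _; apply: eq_bigr => y _; rewrite !H //.
  exact: ltn_trans (ltn_ord y) (ltn_ord x).
- by apply: eq_bigr => x _; rewrite H.
Qed.

Lemma cand_sound j s c : j < N -> sound_level j s -> cvalid s c -> exists S,
  [/\ csig j s c = sig j.+1 S, cval j s c = cutv j.+1 S
    & cset j s c = setcode j.+1 S].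
Proof.
move=> jN [H1 _ _] /H1[S0 [E1 E2 E3]].
pose S x := if x == j then ~~ (c < W) else S0 x.
have [F1 F2 F3] : [/\ sig j S = sig j S0, cutv j S = cutv j S0
  & setcode j S = setcode j S0].
  by apply: ext_below => x Hx; rewrite /S ifF //; lia.
exists S; rewrite sigS // cutvS // setcodeS F1 F2 F3 -digit_sig // F1.
by rewrite /csig /cval /cset E1 E2 E3 /S eqxx; case: (c < W).
Qed.

(** Equal signatures give equal gains at vertex [j], so the entry dominating [S] before the step has
    an extension dominating [S] after it. The bound [len s <= W] keeps its index among the
    candidates. *)
Lemma cand_complete j s S : j < N -> len s <= W -> sound_level j s ->
  exists c, [/\ c < W + W, cvalid s c, csig j s c = sig j.+1 S
    & cutv j.+1 S <= cval j s c].
Proof.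
move=> jN lW [_ H2 _]; have [r rs [E1 E2]] := H2 S.
exists (if S j then W + r else r).
have Est : cstate (if S j then W + r else r) = r.
  rewrite /cstate; case: (S j); first by rewrite ifF ?addKn //; lia.
  by rewrite ifT //; lia.
have EW : ((if S j then W + r else r) < W) = ~~ S j.
  by case: (S j); lia.
split.
- by case: (S j); lia.
- by rewrite /cvalid Est.
- by rewrite /csig Est EW E1 sigS //; case: (S j).
- rewrite /cval Est EW E1 cutvS // digit_sig //.
  by case: (S j) => /=; rewrite leq_add2r.
Qed.

Lemma ckeep_best j s c : c < W + W -> cvalid s c -> exists c',
  [/\ c' < W + W, ckeep j s c', csig j s c' = csig j s c
    & cval j s c <= cval j s c'].
Proof.
move=> cW vc.
pose P (d : 'I_(W + W)) := cvalid s d && (csig j s d == csig j s c).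
(* Value and index packed into one number: a maximum of [F] has the best value and, among those, the
   smallest index, which is exactly what no [cbetter] candidate beats. *)
pose F (d : 'I_(W + W)) := cval j s d * (W + W) + (W + W - d).
have P0 : P (Ordinal cW) by rewrite /P vc eqxx.
have [d /andP[vd /eqP Ed] Hd] := @arg_maxnP _ (Ordinal cW) P F P0.
exists d; split => //.
  rewrite /ckeep vd /= -leqn0 leqNgt (sum_bool_exists _ (cbetter j s d)).
  apply/existsP => -[d' /and3P[vd' /eqP E' H]].
  have := Hd d'; rewrite /P vd' E' Ed eqxx => /(_ isT); rewrite /F.
  have := ltn_ord d; have := ltn_ord d'.
  by case/orP: H => [H|/andP[/eqP H H']]; nia.
have := Hd (Ordinal cW) P0; rewrite /F /=; have := ltn_ord d; nia.
Qed.

Lemma ckeep_uniq j s c c' : c < W + W -> c' < W + W ->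
  ckeep j s c -> ckeep j s c' -> csig j s c = csig j s c' -> c = c'.
Proof.
have H c1 c2 : c1 < W + W -> c2 < W + W -> ckeep j s c1 -> ckeep j s c2 ->
    csig j s c1 = csig j s c2 -> cbetter j s c1 c2 -> False.
  move=> H1 H2 /andP[_ K1] _ _ Hb; move: K1.
  by rewrite (bigD1 (Ordinal H2)) //= Hb.
move=> H1 H2 K1 K2 E; have := H _ _ H1 H2 K1 K2 E; have := H _ _ H2 H1 K2 K1 (esym E).
case/andP: K1 => v1 _; case/andP: K2 => v2 _; rewrite /cbetter v1 v2 E eqxx /=.
case: (ltngtP (cval j s c) (cval j s c')) => // _ /=.
  by move=> _ H3; case: H3.
  by move=> H3; case: H3.
by case: (ltngtP c c') => // _; [move=> []|move=> _ []].
Qed.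

Lemma next_level_sound j s : j < N -> len s <= W -> sound_level j s ->
  sound_level j.+1 (next_level j s).
Proof.
move=> jN lW Hs.
have idI c c' : c < W + W -> c' < W + W -> ckeep j s c -> ckeep j s c' ->
  id c = id c' -> c = c' by [].
have Hr r : r < len (next_level j s) -> exists c,
    [/\ c < W + W, ckeep j s c, rank (W + W) (ckeep j s) id c = r
      & unrank (W + W) (ckeep j s) id r = c].
  move=> /(rank_surj idI)[c [cW kc <-]]; exists c; split => //.
  exact: unrank_rank.
split.
- move=> r /Hr[c [cW kc _ Er]]; rewrite /= Er; apply: cand_sound => //.
  by case/andP: kc.
- move=> S; have [c [cW vc E1 E2]] := cand_complete S jN lW Hs.
  have [c' [cW' kc' E1' E2']] := ckeep_best j cW vc.
  exists (rank (W + W) (ckeep j s) id c'); first exact: rank_lt.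
  rewrite /= unrank_rank // E1' E1; split=> //; exact: leq_trans E2'.
- move=> r r' /Hr[c [cW kc Ec Er]] /Hr[c' [cW' kc' Ec' Er']].
  by rewrite /= Er Er' -Ec -Ec' => /(ckeep_uniq cW cW' kc kc') ->.
Qed.

Lemma levels_sound j : j <= N -> (forall i, i < j -> len (levels i) <= W) ->
  sound_level j (levels j).
Proof.
elim: j => [|j IH] jN H.
  split=> /=.
  - move=> r _; exists (fun=> false); rewrite /sig /cutv /setcode !big_ord0.
    by split=> //; rewrite big1 // => l _; rewrite /deg_in big_ord0.
  - move=> S; exists 0 => //; rewrite /cutv big_ord0; split=> //.
    by rewrite /sig big1 // => l _; rewrite /deg_in big_ord0.
  - by move=> [|r] [|r'].
rewrite /levels /=; apply: next_level_sound => //; first exact: H.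
by apply: IH; [lia|move=> i Hi; apply: H; lia].
Qed.

(* Two vertices with equal labels see the same remaining vertices, so the
   signature only depends on how many vertices of each label are chosen. *)
Lemma sound_level_len j s (T : finType) (tau : nat -> T) : j <= N ->
  sound_level j s ->
  (forall x x' l, x < j -> x' < j -> tau x = tau x' -> j <= l < N -> a x l = a x' l) ->
  len s <= n.+1 ^ #|T|.
Proof.
move=> jN [H1 _ H3] Ht.
pose cnt S t := \sum_(x < j) (S x && (tau x == t)).
have cntE S S' : cnt S =1 cnt S' -> sig j S = sig j S'.
  move=> E.
  (* A label class is either entirely adjacent or entirely non-adjacent to [l], so only the numbers
     of chosen vertices per class matter. *)
  have degE S1 l : j <= l < N -> deg_in j S1 l =
      \sum_(t : T) cnt S1 t * [exists x : 'I_j, (tau x == t) && a x l].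
    move=> Hl; rewrite /deg_in /cnt.
    under [RHS]eq_bigr do rewrite big_distrl /=.
    rewrite exchange_big /=; apply: eq_bigr => x _.
    rewrite (bigD1 (tau x)) //= eqxx andbT big1 ?addn0; last first.
      by move=> t /negPf; rewrite eq_sym => ->; rewrite andbF.
    case: (S1 x) => //=; rewrite mul1n; congr nat_of_bool.
    apply/idP/existsP => [Ha|[x' /andP[/eqP Ex Ha]]]; first by exists x; rewrite eqxx.
    by rewrite -(Ht x' x l).
  rewrite /sig; apply: eq_big_nat => l Hl; congr (_ * _).
  by rewrite !degE //; apply: eq_bigr => t _; rewrite E.
have cnt_lt S t : cnt S t < n.+1.
  rewrite ltnS; apply: (@leq_trans j); last exact: leq_trans Nn.
  rewrite -[X in _ <= X]card_ord -sum1_card; apply: leq_sum => i _.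
  by case: (_ && _).
have /fin_all_exists [f Hf] : forall r : 'I_(len s), exists S : nat -> bool,
    lsig s r = sig j S.
  by move=> r; have [S []] := H1 r (ltn_ord r); exists S.
pose g (r : 'I_(len s)) : {ffun T -> 'I_n.+1} := [ffun t => Ordinal (cnt_lt (f r) t)].
have gI : injective g.
  move=> r r' /ffunP E; apply: val_inj; apply: H3; try exact: ltn_ord.
  rewrite [LHS]Hf [RHS]Hf; apply: cntE => t; have := E t; rewrite !ffunE.
  by move=> /(congr1 val).
by have := leq_card g gI; rewrite card_ffun !card_ord.
Qed.

(** Greedy expansion of a set code: the digits are 0 or 1, so comparing with [weight y] reads off
    the leading digit. *)
Definition peel (x K : nat) : nat :=
  iteri x (fun y K => if weight y <= K then K - weight y else K) K.

Definition chosen (x : nat) : bool := weight x <= peel x (lset (levels N) 0).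

Lemma peel_setcode S x : x <= N ->
  peel x (setcode N S) = \sum_(x <= l < N) S l * weight l.
Proof.
elim: x => [|x IH] xN; first by rewrite /peel /setcode /= big_mkord.
rewrite /peel /= -/(peel x _) IH; last exact: ltnW.
have n0 : 0 < n by lia.
have := @sum_weight_lt (fun l => S l) x (fun l => leq_trans (leq_b1 (S l)) n0) xN.
rewrite [\sum_(x <= _ < _) _]big_ltn //.
set X := \sum_(_ <= _ < _) _; set w := weight x => Xw.
have w0 : 0 < w := weight_gt0 x.
case: (S x); rewrite ?mul1n ?mul0n ?add0n; first by rewrite leq_addr addKn.
by rewrite ifF //; lia.
Qed.

(** At level [N] no vertex remains, all signatures are 0, and the table has one entry. It dominates
    every set, and its set code decodes to [chosen]. *)
Theorem dp_optimal : (forall j, j <= N -> len (levels j) <= W) ->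
  forall S, cutv N S <= cutv N chosen.
Proof.
move=> H S.
have [H1 H2 H3] := levels_sound (leqnn N) (fun i Hi => H i (ltnW Hi)).
have sig0 S' : sig N S' = 0 by rewrite /sig big_geq.
have L1 r : r < len (levels N) -> r = 0.
  move=> rl; have l0 : 0 < len (levels N) by exact: leq_ltn_trans rl.
  apply: H3 => //; have [S1 [-> _ _]] := H1 _ rl; have [S2 [-> _ _]] := H1 _ l0.
  by rewrite !sig0.
have [r rl [_ E]] := H2 S; have r0 := L1 _ rl; rewrite r0 in rl E.
have [S0 [_ E2 E3]] := H1 _ rl; rewrite (leq_trans E) // E2.
have [_ -> _] // : [/\ sig N S0 = sig N chosen, cutv N S0 = cutv N chosen
  & setcode N S0 = setcode N chosen].
apply: ext_below => x xN; rewrite /chosen E3 peel_setcode; last exact: ltnW.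
rewrite big_ltn //.
have n0 : 0 < n by lia.
have := @sum_weight_lt (fun l => S0 l) x (fun l => leq_trans (leq_b1 (S0 l)) n0) xN.
case: (S0 x); rewrite ?mul1n ?mul0n ?leq_addr // add0n => Xw.
by apply/esym/negbTE; rewrite -ltnNge.
Qed.

End DP.

(** * Arrays *)

(* Array [k < 32] at index [x] lives at address [b + 32 * x + k], where register
   1 holds the base address [b], beyond the input. *)
Definition arr (b : nat) (m : nat -> nat) (k x : nat) : nat := m (b + 32 * x + k).

Definition agrees (b : nat) (ks : seq nat) (m m' : nat -> nat) : Prop :=
  (forall y, y < b -> m' y = m y) /\
  (forall k, k < 32 -> k \notin ks -> arr b m' k = arr b m k).

Definition addrE (k : nat) (e : expr) : expr :=
  EAdd (EAdd (EVar 1) (EDbl (EDbl (EDbl (EDbl (EDbl e)))))) (ECst k).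
Definition arrE (k : nat) (e : expr) : expr := EMem (addrE k e).
Definition storeC (k : nat) (i e : expr) : cmd := CStore (addrE k i) e.

Lemma agrees_refl b ks m : agrees b ks m m.
Proof. by []. Qed.

Lemma agrees_trans b ks1 ks2 ks m1 m2 m3 : {subset ks1 <= ks} -> {subset ks2 <= ks} ->
  agrees b ks1 m1 m2 -> agrees b ks2 m2 m3 -> agrees b ks m1 m3.
Proof.
move=> s1 s2 [H1 H2] [H3 H4]; split=> [y yb|k k32 kks]; first by rewrite H3 ?H1.
by rewrite H4 ?H2 //; apply: contra kks; [apply: s1|apply: s2].
Qed.

Lemma ev_addrE k e r m : ev (addrE k e) r m = r 1 + 32 * ev e r m + k.
Proof. by rewrite /=; lia. Qed.

Lemma ev_arrE k e r m x : arr (r 1) m k (ev e r m) = x -> ev (arrE k e) r m = x.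
Proof. by move=> <-; rewrite /arr -ev_addrE. Qed.

Lemma arr_store k i e r m k' x : k < 32 -> k' < 32 ->
  arr (r 1) (den (storeC k i e) r m) k' x =
  if (k' == k) && (x == ev i r m) then ev e r m else arr (r 1) m k' x.
Proof.
move=> k32 k32'.
have -> : den (storeC k i e) r m = update m (ev (addrE k i) r m) (ev e r m) by [].
rewrite ev_addrE /arr /update.
case: (k' =P k) => [->|kk] /=; last by rewrite ifF //; lia.
case: (x =P _) => [->|xx]; first by rewrite eqxx.
by rewrite ifF //; lia.
Qed.

Lemma store_agrees k i e r m : k < 32 -> agrees (r 1) [:: k] m (den (storeC k i e) r m).
Proof.
move=> k32; split=> [y yb|k' k32' Hk'].
  have -> : den (storeC k i e) r m = update m (ev (addrE k i) r m) (ev e r m) by [].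
  by rewrite ev_addrE /update ifF //; lia.
by apply/funext => x; rewrite arr_store // ifF //; move: Hk'; rewrite inE => /negPf->.
Qed.

Lemma for_inv (I : nat -> (nat -> nat) -> Prop) x y c r m : I 0 m ->
  (forall t m', t < r y -> I t m' -> I t.+1 (den c (update r x t) m')) ->
  I (r y) (den (CFor x y c) r m).
Proof.
move=> H0 HS; rewrite /=.
have : r y <= r y by []; elim: {-2}(r y) => //= t IH Ht.
by apply: HS => //; apply: IH; exact: ltnW.
Qed.

(** The premise offers the cells already written, so that an array may be filled by recurrence on
    itself (powers, [peel]). It says nothing of cells in the range that are still to be written. *)
Lemma for_fill c k x y i e r m (f g : nat -> nat) :
  c = CFor x y (storeC k i e) -> k < 32 -> x != 1 ->
  (forall t t', t < r y -> t' < r y -> f t = f t' -> t = t') ->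
  (forall t m', t < r y -> agrees (r 1) [:: k] m m' ->
     (forall s, s < t -> arr (r 1) m' k (f s) = g s) ->
     (forall z, (forall s, s < r y -> z <> f s) -> arr (r 1) m' k z = arr (r 1) m k z) ->
     ev i (update r x t) m' = f t /\ ev e (update r x t) m' = g t) ->
  let m' := den c r m in
  [/\ agrees (r 1) [:: k] m m', forall t, t < r y -> arr (r 1) m' k (f t) = g t
    & forall z, (forall t, t < r y -> z <> f t) -> arr (r 1) m' k z = arr (r 1) m k z].
Proof.
move=> -> k32 x1 fI H.
pose I t m' := [/\ agrees (r 1) [:: k] m m',
  forall s, s < t -> arr (r 1) m' k (f s) = g s
  & forall z, (forall s, s < r y -> z <> f s) -> arr (r 1) m' k z = arr (r 1) m k z].
apply: (@for_inv I); first by split; [exact: agrees_refl| |].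
move=> t m' tN [I1 I2 I3]; have [Ei Ee] := H t m' tN I1 I2 I3.
have r1 : update r x t 1 = r 1 by rewrite update_neq // eq_sym.
split.
- apply: (@agrees_trans _ [:: k] [:: k] _ _ m') => //.
  by rewrite -r1; apply: store_agrees.
- move=> s st; rewrite -r1 arr_store // eqxx Ei Ee r1.
  have [Es|Es] := eqVneq (f s) (f t).
    by rewrite (fI s t) //=; lia.
  by rewrite I2 //; move: st; rewrite ltnS leq_eqVlt => /orP[/eqP E|//]; rewrite E eqxx in Es.
- move=> z Hz; rewrite -r1 arr_store // eqxx Ei Ee r1 ifF ?I3 //.
  by apply/eqP; apply: Hz.
Qed.

Lemma for_fill2 c k x1 y1 x2 y2 i e r m (f g : nat -> nat -> nat) :
  c = CFor x1 y1 (CFor x2 y2 (storeC k i e)) -> k < 32 -> x1 != 1 -> x2 != 1 -> x1 != y2 ->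
  (forall s t s' t', s < r y1 -> t < r y2 -> s' < r y1 -> t' < r y2 ->
     f s t = f s' t' -> s = s' /\ t = t') ->
  (forall s t m', s < r y1 -> t < r y2 -> agrees (r 1) [:: k] m m' ->
     (forall s' t', s' < s -> t' < r y2 -> arr (r 1) m' k (f s' t') = g s' t') ->
     (forall t', t' < t -> arr (r 1) m' k (f s t') = g s t') ->
     ev i (update (update r x1 s) x2 t) m' = f s t /\
     ev e (update (update r x1 s) x2 t) m' = g s t) ->
  let m' := den c r m in
  agrees (r 1) [:: k] m m' /\
  forall s t, s < r y1 -> t < r y2 -> arr (r 1) m' k (f s t) = g s t.
Proof.
move=> -> k32 x11 x21 xy fI H.
pose I s m' := agrees (r 1) [:: k] m m' /\
  forall s' t', s' < s -> t' < r y2 -> arr (r 1) m' k (f s' t') = g s' t'.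
apply: (@for_inv I); first by split; [exact: agrees_refl|].
move=> s m' sN [I1 I2].
have E1 : update r x1 s 1 = r 1 by rewrite update_neq // eq_sym.
have E2 : update r x1 s y2 = r y2 by rewrite update_neq // eq_sym.
have := @for_fill _ k x2 y2 i e (update r x1 s) m' (f s) (g s) (erefl _) k32 x21.
rewrite E1 E2; case.
- by move=> t t' tN tN' /fI[].
- move=> t m'' tN A2 K1 K2; apply: H => //.
    exact: (@agrees_trans _ [:: k] [:: k] _ _ m').
  move=> s' t' ss tt; rewrite K2 ?I2 // => t'' tN'' /fI[] //; lia.
move=> J1 J2 J3; split; first exact: (@agrees_trans _ [:: k] [:: k] _ _ m').
move=> s' t' ss tt; have [E|ns] := eqVneq s' s; first by rewrite E J2.
by rewrite J3 ?I2 //; [lia|move=> t'' tN'' /fI[] //; lia].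
Qed.

(** * Derived expressions *)

Definition leE (a b : expr) : expr := ESub (ECst 1) (ESub a b).
Definition ltE (a b : expr) : expr := leE (EAdd a (ECst 1)) b.
Definition andE (a b : expr) : expr := EIf a b (ECst 0).
Definition orE (a b : expr) : expr := EIf a (ECst 1) b.
Definition notE (a : expr) : expr := ESub (ECst 1) a.
Definition eqE (a b : expr) : expr := andE (leE a b) (leE b a).

(* Multiplication by repeated addition; the value of [a] must be at most that of
   the variable [y], and variable 30 is reserved for the loop. *)
Definition mulE (y : nat) (a b : expr) : expr :=
  ESum 30 y (EIf (ltE (EVar 30) a) b (ECst 0)).

(** A sum that rebinds [x] counts as fresh for [x]. This allows products to be nested although all
    of them use variable 30. *)
Fixpoint fresh (x : nat) (e : expr) : bool :=
  match e with
  | ECst _ => true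
  | EVar y => y != x
  | EAdd a b | ESub a b => fresh x a && fresh x b
  | EDbl a | EMem a => fresh x a
  | EIf a b c => [&& fresh x a, fresh x b & fresh x c]
  | ESum y z a => (z != x) && ((y == x) || fresh x a)
  end.

Lemma ev_fresh x e r v m : fresh x e -> ev e (update r x v) m = ev e r m.
Proof.
have gen r' : (forall y, y != x -> r y = r' y) -> fresh x e -> ev e r m = ev e r' m.
  elim: e r r' => //=.
  - by move=> y r r'; apply.
  - by move=> a IHa b IHb r r' H /andP[Ha Hb]; rewrite (IHa r r') ?(IHb r r').
  - by move=> a IHa b IHb r r' H /andP[Ha Hb]; rewrite (IHa r r') ?(IHb r r').
  - by move=> a IHa r r' H Ha; rewrite (IHa r r').
  - by move=> a IHa r r' H Ha; rewrite (IHa r r').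
  - move=> a IHa b IHb c IHc r r' H /and3P[Ha Hb Hc].
    by rewrite (IHa r r') ?(IHb r r') ?(IHc r r').
  - move=> y z a IHa r r' H /andP[zx Ha]; rewrite (H z) //.
    apply: eq_bigr => i _; case/orP: Ha => [/eqP ->|Ha].
      congr (ev a _ m); apply/funext => w; rewrite /update.
      by case: eqP => // /eqP; apply: H.
    by apply: IHa => // w wx; apply: update_ext; apply: H.
by move=> H; apply/esym; apply: gen => // y yx; rewrite update_neq.
Qed.

Lemma ev_leE a b r m x y : ev a r m = x -> ev b r m = y -> ev (leE a b) r m = (x <= y).
Proof. by move=> <- <- /=; case: leqP; lia. Qed.

Lemma ev_ltE a b r m x y : ev a r m = x -> ev b r m = y -> ev (ltE a b) r m = (x < y).
Proof. by move=> Ea Eb; apply: ev_leE => //=; rewrite Ea addn1. Qed.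

Lemma ev_andE a b r m (p p' : bool) : ev a r m = p -> (p -> ev b r m = p') ->
  ev (andE a b) r m = (p && p').
Proof. by move=> /= ->; case: p => //= ->. Qed.

Lemma ev_orE a b r m (p p' : bool) : ev a r m = p -> (~~ p -> ev b r m = p') ->
  ev (orE a b) r m = (p || p').
Proof. by move=> /= ->; case: p => //= ->. Qed.

Lemma ev_notE a r m (p : bool) : ev a r m = p -> ev (notE a) r m = ~~ p.
Proof. by move=> /= ->; case: p. Qed.

Lemma ev_eqE a b r m x y : ev a r m = x -> ev b r m = y -> ev (eqE a b) r m = (x == y).
Proof.
move=> Ea Eb; rewrite eqn_leq; apply: ev_andE => [|_]; exact: ev_leE.
Qed.

Lemma ev_ifE a b c r m (p : bool) x y : ev a r m = p ->
  (p -> ev b r m = x) -> (~~ p -> ev c r m = y) ->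
  ev (EIf a b c) r m = if p then x else y.
Proof. by move=> /= ->; case: p => /= [->|_ ->]. Qed.

Lemma ev_sumE z y e r m (F : 'I_(r y) -> nat) :
  (forall i : 'I_(r y), ev e (update r z i) m = F i) ->
  ev (ESum z y e) r m = \sum_(i < r y) F i.
Proof. by move=> H /=; apply: eq_bigr. Qed.

Lemma ev_mulE y a b r m u v : fresh 30 a -> fresh 30 b -> ev a r m = u ->
  ev b r m = v -> u <= r y -> ev (mulE y a b) r m = u * v.
Proof.
move=> fa fb Ea Eb uy.
rewrite (@ev_sumE _ _ _ _ _ (fun i => (i < u) * v)).
  by rewrite -big_distrl /= sum_ltn_ord.
move=> i; have -> : (i < u) * v = if i < u then v else 0.
  by case: (i < u); rewrite ?mul1n ?mul0n.
apply: ev_ifE => [|_|//]; last by rewrite ev_fresh.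
by apply: ev_ltE => //; rewrite ev_fresh.
Qed.

Lemma ev_addE a b r m x y : ev a r m = x -> ev b r m = y -> ev (EAdd a b) r m = x + y.
Proof. by move=> /= -> ->. Qed.

Lemma ev_subE a b r m x y : ev a r m = x -> ev b r m = y -> ev (ESub a b) r m = x - y.
Proof. by move=> /= -> ->. Qed.

Definition arr2E (k : nat) (c v : expr) : expr := arrE k (EAdd (mulE 0 c (EVar 0)) v).

Lemma ev_arr2E k c v r m s t x : fresh 30 c -> ev c r m = s -> ev v r m = t ->
  s <= r 0 -> arr (r 1) m k (s * r 0 + t) = x -> ev (arr2E k c v) r m = x.
Proof.
move=> fc Ec Ev cn <-; apply: ev_arrE; congr arr.
by apply: ev_addE => //; apply: ev_mulE.
Qed.

(** * Distances *)

Section Reach.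
Variables (n : nat) (e : nat -> nat -> bool) (src : nat).

Fixpoint reach (c v : nat) : bool :=
  if c is c'.+1 then reach c' v || (0 < \sum_(u < n) (reach c' u && e u v))
  else v == src.

(** The number of radii too small to reach [v]: the distance if [v] is reachable, and [n] otherwise.
    Membership in the component thus becomes [dist v < n]. *)
Definition dist (v : nat) : nat := \sum_(c < n) ~~ reach c v.

Hypothesis src_lt : src < n.
Local Notation er := (fun u v : 'I_n => e u v).
Local Notation s := (Ordinal src_lt).

Lemma reachS c (v : 'I_n) :
  reach c.+1 v = reach c v || [exists u : 'I_n, reach c u && e u v].
Proof. by rewrite /= (sum_bool_exists _ (fun u => reach c u && e u v)). Qed.

Lemma reach_mono c c' v : c <= c' -> reach c v -> reach c' v.
Proof.
move=> /subnKC <-; elim: (c' - c) => [|k IH]; first by rewrite addn0.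
by rewrite addnS /= => /IH ->.
Qed.

Lemma reachP c (v : 'I_n) :
  reflect (exists p, [/\ path er s p, last s p = v & size p <= c]) (reach c v).
Proof.
elim: c v => [|c IH] v.
  apply: (iffP eqP) => [E|[p [_ L]]].
    by exists [::]; split=> //; apply: val_inj.
  by case: p L => //= <-.
rewrite reachS; apply: (iffP orP).
  case=> [/IH[p [H1 H2 H3]]|]; first by exists p; split=> //; exact: leqW.
  case/existsP => u /andP[/IH[p [H1 H2 H3]] euv].
  by exists (rcons p v); rewrite rcons_path last_rcons size_rcons H1 H2.
case=> p; case/lastP: p => [|p w].
  by case=> _ L _; left; apply/IH; exists [::].
rewrite rcons_path last_rcons size_rcons => -[/andP[H1 H2] Ew H3]; right.
apply/existsP; exists (last s p); rewrite -Ew H2 andbT; apply/IH.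
by exists p.
Qed.

(** A path can be shortened to one without repetition, which has fewer than [n] steps. *)
Lemma reach_connect c (v : 'I_n) : n <= c.+1 -> reach c v = connect er s v.
Proof.
move=> nc; apply/reachP/connectP => [[p [H1 H2 _]]|[p H1 H2]]; first by exists p.
case/shortenP: H1 H2 => p' H1 H2 _ E; exists p'; split=> //.
rewrite -ltnS (leq_trans _ nc) //.
by have := card_uniqP H2; rewrite /= => <-; apply: leq_trans (max_card _) _; rewrite card_ord.
Qed.

(** Reachability is monotone in the radius, so the radii counted by [dist] form an initial
    segment. *)
Lemma dist_le c v : c < n -> (dist v <= c) = reach c v.
Proof.
move=> cn; apply/idP/idP => [|H].
  apply: contraLR => H; rewrite -ltnNge -{1}(sum_ltn_ord cn).
  apply: leq_sum => i _; case: ltnP => // ic.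
  by rewrite (contra (@reach_mono i c v _)).
rewrite -[X in _ <= X](sum_ltn_ord (ltnW cn)); apply: leq_sum => i _.
by case: ltnP => ic; [exact: leq_b1|rewrite (reach_mono ic H)].
Qed.

Lemma dist_lt (v : 'I_n) : (dist v < n) = connect er s v.
Proof.
have n0 : 0 < n by exact: leq_ltn_trans (ltn_ord v).
by rewrite -(@reach_connect n.-1) ?prednK // -dist_le ?prednK //; lia.
Qed.

Lemma dist_eq0 (v : 'I_n) : dist v = 0 -> v = s.
Proof.
move=> d0; have n0 : 0 < n by exact: leq_ltn_trans (ltn_ord v).
by apply/val_inj/eqP; have := dist_le v n0; rewrite d0 leqnn => /esym.
Qed.

Lemma dist_adj (u v : 'I_n) : dist u < n -> e u v -> dist v < n /\ dist v <= (dist u).+1.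
Proof.
move=> Hu euv; have Hv : dist v < n.
  move: Hu; rewrite !dist_lt => H; apply: connect_trans H _; exact: connect1.
split=> //; have [Hn|Hn] := ltnP (dist u).+1 n; last by apply: leq_trans Hn; exact: ltnW.
rewrite dist_le // reachS; apply/orP; right; apply/existsP; exists u.
by rewrite -dist_le // leqnn.
Qed.

Lemma dist_parent (v : 'I_n) c : dist v < n -> dist v = c.+1 ->
  exists u : 'I_n, [/\ dist u < n, e u v & dist u = c].
Proof.
move=> Hv E; have cn : c < n by lia.
have : reach (dist v) v by rewrite -dist_le.
rewrite E reachS -dist_le // E ltnn /= => /existsP[u /andP[Hu euv]].
have un : dist u <= c by rewrite dist_le.
exists u; split=> //; first exact: leq_ltn_trans cn.
have [|_] := @dist_adj u v _ euv; first exact: leq_ltn_trans cn.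
by rewrite E ltnS => cu; apply/eqP; rewrite eqn_leq un.
Qed.

End Reach.

(** * A vertex order of small width *)

(* [x v] is the left endpoint of the unit interval of [v], and [lc v], [rc v]
   tell whether it contains its left and right endpoints.  [D] is the distance
   from a leftmost vertex [z] of the component [C]; [q] and [i] select the
   separating layers. *)
Section Width.
Variables (R : realType) (n : nat) (G : sgraph 'I_n).
Variables (x : 'I_n -> R) (lc rc : 'I_n -> bool).
Hypothesis near_adj : forall u v, u != v -> (x u < x v + 1)%R -> (x v < x u + 1)%R -> G u v.
Hypothesis adj_near : forall u v, G u v -> (x u <= x v + 1)%R.
Hypothesis twins : forall u v w, x u = x v -> lc u = lc v -> rc u = rc v ->
  w != u -> w != v -> G u w = G v w.
Variables (C : pred 'I_n) (D : 'I_n -> nat) (z : 'I_n) (q i : nat).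
Hypothesis leftmost : forall v, C v -> (x z <= x v)%R.
Hypothesis D0 : forall v, C v -> D v = 0 -> v = z.
Hypothesis D_adj : forall u v, C u -> G u v -> C v /\ D v <= (D u).+1.
Hypothesis D_parent : forall v c, C v -> D v = c.+1 -> exists u, [/\ C u, G u v & D u = c].
Hypothesis iq : i < q.

(** Adding [q] before subtracting [i < q] avoids truncation. The separating layers are those
    congruent to [i], and [piece] numbers the blocks that start at them. *)
Definition piece v := (D v + q - i) %/ q.
Definition residue v := (D v + q - i) %% q.
Definition separator v := residue v == 0.
(** Either disjunct certifies that the row of [u] is at most the row of [v]: a non-neighbour one
    layer further lies at least 1 to the right, a neighbour at most 1. Two vertices of consecutive
    non-separating layers are always related in exactly one direction. *)
Definition arrow u v := [&& C u, C v, ~~ separator u, ~~ separator v &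
  (D v == (D u).+1) && ~~ G u v || (D u == (D v).+1) && G u v].
(** Ties of rows can create cycles of arrows, so a topological order may not exist. The size of the
    down-set is monotone along arrows and takes one value on each cycle. *)
Definition height v := #|[pred u | connect arrow u v]|.
Definition stage v := if separator v then 0 else (piece v).+1.

(** Induction on the layer. Were [w] left of [u], a parent [p] of [u] would satisfy
    [x p <= x w < x u <= x p + 1]; then [p] and [w] are adjacent and [w] is no farther than [u]. *)
Lemma farther_right u w : C u -> C w -> D u < D w -> (x u <= x w)%R.
Proof.
move E: (D u) => k; elim: k u E w => [|k IH] u E w Cu Cw uw.
  by rewrite (D0 Cu E); apply: leftmost.
have [p [Cp pu Ep]] := D_parent Cu E.
rewrite leNgt; apply/negP => wu.
have pw : (x p <= x w)%R by apply: IH => //; lia.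
have up : (x u <= x p + 1)%R by apply: adj_near; rewrite adj_sym.
have pw' : p != w by apply/eqP => pw'; move: uw; rewrite -pw' Ep; lia.
have : G p w by apply: near_adj => //; lra.
by move=> /(D_adj Cp)[_]; lia.
Qed.

(** A parent [p] of [v] lies one layer earlier, hence not to the right of [u], and [v] is within 1
    of [p]. *)
Lemma layer_spread u v : C u -> C v -> D u = D v -> (x v <= x u + 1)%R.
Proof.
move=> Cu Cv; case E: (D v) => [|k] Eu.
  by rewrite (D0 Cu Eu) (D0 Cv E); lra.
have [p [Cp pv Ep]] := D_parent Cv E.
have pu : (x p <= x u)%R by apply: farther_right => //; lia.
have : (x v <= x p + 1)%R by apply: adj_near; rewrite adj_sym.
by lra.
Qed.

Lemma piece_next u v : ~~ separator v -> D v = (D u).+1 -> piece u = piece v.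
Proof.
rewrite /separator /residue /piece => Hv E.
move: Hv; have -> : D v + q - i = (D u + q - i).+1 by lia.
by rewrite divnS ?(leq_ltn_trans _ iq) // /dvdn => /negPf ->.
Qed.

Lemma layer_of_piece u v : piece u = piece v -> residue u = residue v -> D u = D v.
Proof.
rewrite /piece /residue => E1 E2.
have := divn_eq (D u + q - i) q; have := divn_eq (D v + q - i) q.
by rewrite E1 E2; lia.
Qed.

Local Notation row v := (x v - (D v)%:R)%R.

Lemma arrow_row u v : arrow u v -> (row u <= row v)%R.
Proof.
move=> /and5P[Cu Cv _ _ /orP[/andP[/eqP E nG]|/andP[/eqP E Guv]]]; rewrite E -natr1.
  have uv : (x u <= x v)%R by apply: farther_right => //; lia.
  have : (x u + 1 <= x v)%R.
    rewrite leNgt; apply: contra nG => H; apply: near_adj => //; last by lra.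
    by apply/eqP => uv'; move: E; rewrite uv'; lia.
  by lra.
have := adj_near Guv; lra.
Qed.

Lemma connect_row u v : connect arrow u v -> (row u <= row v)%R.
Proof.
case/connectP => p; elim: p u => [|w p IH] u /=; first by move=> _ ->.
by case/andP => /arrow_row H1 H2 E; apply: le_trans H1 _; apply: IH.
Qed.

Lemma connect_height u v : connect arrow u v -> height u <= height v.
Proof.
move=> H; apply/subset_leq_card/fintype.subsetP => w; rewrite !inE => Hw.
exact: connect_trans H.
Qed.

(** The down-set of [u] is contained in that of [v] and is no smaller, so they coincide and [v] lies
    below [u]. *)
Lemma connect_back u v : connect arrow u v -> height v <= height u -> connect arrow v u.
Proof.
move=> H le.
have sub : [pred w | connect arrow w u] \subset [pred w | connect arrow w v].
  by apply/fintype.subsetP => w; rewrite !inE => Hw; exact: connect_trans H.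
have /subset_cardP/(_ sub)/(_ v) : height u = height v.
  by apply/eqP; rewrite eqn_leq le connect_height.
by rewrite !inE connect0.
Qed.

(** The number is the index of a separating vertex or the residue of a layer. Two bits mark
    separating vertices and vertices of earlier stages; the other five are the properties collected
    in [tau]. *)
Definition label_type : finType :=
  ('I_q.+1 * (bool * bool * bool * bool * bool * bool * bool))%type.

Lemma card_label_type : #|{: label_type}| = q.+1 * 128.
Proof. by rewrite !card_prod card_ord !card_bool. Qed.

(* The processed vertices are those before stage [p], or at stage [p] and of
   height at most [h].  Within a layer of the current piece, all of them see the
   same remaining vertices, except for those equivalent under [connect arrow] to
   a remaining vertex of a neighbouring layer, which share their left endpoint,
   and for the extreme points of a layer of spread exactly 1. *)
Lemma width_labels (p h : nat) : #|[pred v | C v && separator v]| <= q ->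
  exists tau : 'I_n -> label_type, forall a b u, C a -> C b -> C u ->
    (stage a < p) || (stage a == p) && (height a <= h) ->
    (stage b < p) || (stage b == p) && (height b <= h) ->
    (p < stage u) || (stage u == p) && (h <= height u) ->
    u != a -> u != b -> tau a = tau b -> G a u = G b u.
Proof.
move=> Xq.
pose U u := C u && ((p < stage u) || (stage u == p) && (h <= height u)).
(* Generically a processed vertex misses the remaining vertices of the next layer and sees those of
   the previous one. [odd_one] marks an exception, which amounts to an arrow from a remaining vertex
   to [a]. *)
pose odd_one a := [exists u, U u &&
  ((D u == (D a).+1) && G a u || (D a == (D u).+1) && ~~ G a u)].
(* Only at distance exactly 1 can two vertices of one layer fail to be adjacent; [low] and [high]
   mark the two ends of such a layer. *)
pose low a := [exists u, [&& C u, D u == D a & x u == (x a + 1)%R]].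
pose high a := [exists u, [&& C u, D u == D a & x a == (x u + 1)%R]].
pose sepseq := enum [pred v | C v && separator v].
pose tau a : label_type :=
  if separator a then (inord (index a sepseq), (true, false, false, false, false, false, false))
  else if stage a < p then (ord0, (false, true, false, false, false, false, false))
  else (inord (residue a), (false, false, odd_one a, low a, high a, lc a, rc a)).
exists tau => a b u Ca Cb Cu Aa Ab Uu ua ub; rewrite /tau.
case Xa: (separator a); case Xb: (separator b); try by [case: ifP].
  case=> /(congr1 val) E.
  have ina v : C v -> separator v -> v \in sepseq by rewrite mem_enum inE => -> ->.
  have lt v : C v -> separator v -> index v sepseq < q.+1.
    move=> Cv Xv; apply: (@leq_trans (size sepseq)); first by rewrite index_mem ina.
    by rewrite -cardE leqW.
  move: E; rewrite /= !inordK ?lt // => E.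
  by rewrite -[a](nth_index a (ina _ Ca Xa)) E nth_index ?ina.
(* An edge joins equal or consecutive layers, and the piece changes only on entering a separating
   layer. *)
have stage_ua c w : C c -> ~~ separator c -> ~~ separator w -> G c w -> stage c = stage w.
  move=> Cc Xc Xw Gcw; rewrite /stage (negPf Xc) (negPf Xw); congr (_.+1).
  have [Cw dw] := D_adj Cc Gcw.
  have [_ dc] : C c /\ D c <= (D w).+1 by apply: D_adj => //; rewrite adj_sym.
  case: (ltngtP (D c) (D w)) => H.
  - by apply: piece_next => //; move: dw H; clear; lia.
  - by apply/esym; apply: piece_next => //; move: dc H; clear; lia.
  - by rewrite /piece H.
have sep_stage v : 0 < stage v -> ~~ separator v by rewrite /stage; case: ifP.
have no_earlier c : C c -> ~~ separator c -> stage c < p -> G c u = false.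
  move=> Cc Xc cp; apply/negP => Gcu.
  have pu : p <= stage u by case/orP: Uu => [/ltnW|/andP[/eqP->]].
  have Xu : ~~ separator u by apply: sep_stage; move: cp pu; clear; lia.
  by have := stage_ua _ _ Cc Xc Xu Gcu; move: cp pu; clear; lia.
case: ifP => ap; case: ifP => bp //.
  by rewrite !no_earlier ?Xa ?Xb.
case=> /(congr1 val) Er Eodd Elow Ehigh El Erc.
have q0 : 0 < q by exact: leq_ltn_trans iq.
move: Er; rewrite /= !inordK ?ltnS ?(ltnW (ltn_pmod _ q0)) // => Er.
have current c : (stage c < p) = false ->
    (stage c < p) || (stage c == p) && (height c <= h) -> stage c = p /\ height c <= h.
  by move=> -> /= /andP[/eqP].
have [sa ha] := current _ ap Aa; have [sb hb] := current _ bp Ab.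
have Dab : D a = D b.
  apply: layer_of_piece Er; move: sa; rewrite -sb /stage Xa Xb.
  by case.
have p0 : 0 < p by rewrite -sa /stage Xa.
have UX w : U w -> ~~ separator w.
  by case/andP => _ H; apply: sep_stage; case/orP: H => [|/andP[/eqP ->]] //; apply: leq_ltn_trans.
have same_x : x a = x b -> G a u = G b u by move=> Ex; apply: twins.
(* The arrow gives [height w <= height c <= h <= height w]: equal heights make the arrow reversible,
   so the rows of [w] and [c] are tied. *)
have UE w c : U w -> ~~ separator c -> stage c = p -> height c <= h ->
    (D w = (D c).+1 \/ D c = (D w).+1) -> arrow w c ->
    connect arrow w c /\ connect arrow c w.
  move=> Uw Xc sc hc Dwc wc; have Xw := UX _ Uw.
  have Ep : piece w = piece c.
    by case: Dwc => E; [apply/esym; apply: piece_next|apply: piece_next].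
  have sw : stage w = p by rewrite -sc /stage (negPf Xw) (negPf Xc) Ep.
  have hw : h <= height w by case/andP: Uw => _; rewrite sw ltnn eqxx.
  have cwc := connect1 wc.
  split=> //; apply: connect_back => //; exact: leq_trans hw.
have odd_conn c : C c -> ~~ separator c -> stage c = p -> height c <= h ->
    odd_one c -> exists w, [/\ U w, D w = (D c).+1 \/ D c = (D w).+1,
      connect arrow w c & connect arrow c w].
  move=> Cc Xc sc hc /existsP[w /andP[Uw Hw]]; exists w.
  have Dw : D w = (D c).+1 \/ D c = (D w).+1.
    by case/orP: Hw => /andP[/eqP]; [left|right].
  have wc : arrow w c.
    rewrite /arrow Cc Xc (UX _ Uw) /=; case/andP: (Uw) => -> _ /=.
    by rewrite adj_sym; case/orP: Hw => ->; rewrite ?orbT.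
  by have [] := UE _ _ Uw Xc sc hc Dw wc.
case Oa: (odd_one a).
  have Ob : odd_one b by rewrite -Eodd.
  have Xna : ~~ separator a by rewrite Xa.
  have Xnb : ~~ separator b by rewrite Xb.
  have [w [Uw Dw wa aw]] := odd_conn _ Ca Xna sa ha Oa.
  (* The witness [w] of [a] lies in a layer next to that of [b], so the matrix compares the two
     directly. *)
  have cmp : arrow w b \/ arrow b w.
    have Cw : C w by case/andP: Uw.
    rewrite /arrow Cb Cw (UX _ Uw) Xnb /= -Dab adj_sym.
    case: Dw => ->; case: (G b w); rewrite ?eqxx ?andbT ?andbF ?orbT /=; by [left|right].
  have [wb bw] : connect arrow w b /\ connect arrow b w.
    case: cmp => H; first by apply: (UE w b) => //; rewrite -Dab.
    have bw := connect1 H; split=> //.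
    have ba := connect_trans bw wa.
    (* Here [b] is below [w], hence below [a]. The witness [w'] of [b] gives
       [height a <= h <= height w' <= height b], which closes the cycle. *)
    have hE : height a <= height b.
      have Uha := connect_height aw; have := connect_height bw.
      have [w' [Uw' Dw' wb' bw']] := odd_conn _ Cb Xnb sb hb Ob.
      have Ep v c : ~~ separator v -> ~~ separator c ->
         (D v = (D c).+1 \/ D c = (D v).+1) -> stage v = stage c.
        move=> Xv Xc Dvc; rewrite /stage (negPf Xv) (negPf Xc); congr (_.+1).
        by case: Dvc => E; [apply/esym; apply: piece_next|apply: piece_next].
      have hw' : h <= height w'.
        have sw' : stage w' = p by rewrite -sb; apply: Ep => //; exact: UX.
        by case/andP: Uw' => _; rewrite sw' ltnn eqxx.
      by have := connect_height wb'; move: ha hw'; clear; lia.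
    exact: connect_trans wa (connect_back ba hE).
  apply: same_x.
  have := connect_row wa; have := connect_row aw; have := connect_row wb.
  by have := connect_row bw; rewrite Dab; lra.
have Ob : odd_one b = false by rewrite -Eodd.
(* Two low vertices of a layer coincide: each has a vertex exactly 1 to its right, and the spread of
   the layer is at most 1. The case of [high] is symmetric. *)
case La: (low a).
  have /existsP[w /and3P[Cw /eqP Dw /eqP xw]] : low a by [].
  have /existsP[w' /and3P[Cw' /eqP Dw' /eqP xw']] : low b by rewrite -Elow.
  apply: same_x.
  have : (x w' <= x a + 1)%R by apply: layer_spread => //; rewrite ?Dw ?Dw' ?Dab.
  have : (x w <= x b + 1)%R by apply: layer_spread => //; rewrite ?Dw ?Dw' ?Dab.
  by lra.
have Lb : low b = false by rewrite -Elow.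
case Ha: (high a).
  have /existsP[w /and3P[Cw /eqP Dw /eqP xw]] : high a by [].
  have /existsP[w' /and3P[Cw' /eqP Dw' /eqP xw']] : high b by rewrite -Ehigh.
  apply: same_x.
  have : (x a <= x w' + 1)%R by apply: layer_spread => //; rewrite ?Dw ?Dw' ?Dab.
  have : (x b <= x w + 1)%R by apply: layer_spread => //; rewrite ?Dw ?Dw' ?Dab.
  by lra.
have Hb : high b = false by rewrite -Ehigh.
(* Without exceptions adjacency to [u] is a matter of layers only: same layer or previous layer. *)
have inner c : C c -> ~~ odd_one c -> ~~ low c -> ~~ high c -> u != c ->
    G c u = ((D u == D c) || (D c == (D u).+1)).
  move=> Cc /existsPn Oc /existsPn Lc /existsPn Hc uc.
  have /norP[nu nd] : ~~ ((D u == (D c).+1) && G c u || (D c == (D u).+1) && ~~ G c u).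
    by have := Oc u; rewrite /U Cu Uu.
  have dG : G c u -> D u <= (D c).+1 /\ D c <= (D u).+1.
    move=> Gcu; have [_ H1] := D_adj Cc Gcu.
    have Guc : G u c by rewrite adj_sym.
    by have [_ H2] := D_adj Cu Guc.
  case: (ltngtP (D u) (D c)) => Duc /=.
  - case: (D c =P (D u).+1) nd => [E|E] /=; first by rewrite negbK.
    by move=> _; apply/negP => /dG; move: E Duc; clear; lia.
  - case: (D u =P (D c).+1) nu => [E|E] /=; first by move=> /negPf->; rewrite E; clear; lia.
    by move=> _; apply/idP/idP => [/dG|]; move: E Duc; clear; lia.
  - apply: near_adj; first by rewrite eq_sym.
      have := layer_spread Cu Cc Duc; rewrite le_eqVlt => /orP[H|//].
      by have := Hc u; rewrite Cu Duc eqxx H.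
    have := layer_spread Cc Cu (esym Duc); rewrite le_eqVlt => /orP[H|//].
    by have := Lc u; rewrite Cu Duc eqxx H.
by rewrite (inner a) ?(inner b) ?Oa ?La ?Ha ?Ob ?Lb ?Hb ?Dab.
Qed.

End Width.

(** * The program and the values it computes *)

Lemma pair_index_inj n s t s' t' : t < n -> t' < n ->
  s * n + t = s' * n + t' -> s = s' /\ t = t'.
Proof.
move=> tn tn' E; have n0 : 0 < n by exact: leq_ltn_trans tn.
have Es : s = s'.
  by rewrite -[s]addn0 -(divn_small tn) -divnMDl // E divnMDl // divn_small // addn0.
by split=> //; move: E; rewrite Es => /addnI.
Qed.

Definition idxE : expr := EAdd (mulE 0 (EVar 8) (EVar 0)) (EVar 9).

(** Row [c] of array [k] is computed from row [c - 1]. The command serves twice: for distances in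
    the graph and for the down-sets behind the heights. *)
Definition closureC (k : nat) (src rel : expr) : cmd :=
  CFor 8 2 (CFor 9 0 (storeC k idxE
    (EIf (eqE (EVar 8) (ECst 0)) (eqE (EVar 9) src)
      (orE (arr2E k (ESub (EVar 8) (ECst 1)) (EVar 9))
        (ltE (ECst 0) (ESum 10 0
          (andE (arr2E k (ESub (EVar 8) (ECst 1)) (EVar 10)) rel))))))).

Lemma closure_fill k src rel r m (e : nat -> nat -> bool) s : k < 32 -> r 2 = (r 0).+1 ->
  (forall c v m', agrees (r 1) [:: k] m m' ->
     ev src (update (update r 8 c) 9 v) m' = s) ->
  (forall c v u m', v < r 0 -> u < r 0 -> agrees (r 1) [:: k] m m' ->
     ev rel (update (update (update r 8 c) 9 v) 10 u) m' = e u v) ->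
  let m' := den (closureC k src rel) r m in
  agrees (r 1) [:: k] m m' /\ forall c v, c <= r 0 -> v < r 0 ->
    arr (r 1) m' k (c * r 0 + v) = reach (r 0) e s c v.
Proof.
move=> k32 r2 Hsrc Hrel.
have [|||H1 H2] := @for_fill2 (closureC k src rel) _ _ _ _ _ _ _ r m
  (fun c v => c * r 0 + v) (fun c v => reach (r 0) e s c v) (erefl _) k32 isT isT.
- by [].
- by move=> c t c' t' _ tn _ tn'; apply: pair_index_inj.
- move=> c v m' cn vn Hm' Hp _; rewrite r2 in cn; split.
    by apply: ev_addE => //; apply: ev_mulE.
  have -> : nat_of_bool (reach (r 0) e s c v) = if c == 0 then nat_of_bool (v == s)
      else nat_of_bool (reach (r 0) e s (c - 1) v ||
        (0 < \sum_(u < r 0) (reach (r 0) e s (c - 1) u && e u v))).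
    by case: c {cn Hp} => [|c]; rewrite ?subn1.
  apply: (ev_ifE (p := c == 0)) => [|_|c0]; first by apply: ev_eqE.
    by apply: ev_eqE => //; apply: Hsrc.
  have cc : c - 1 < c by lia.
  have cr : c - 1 <= r 0 by lia.
  apply: ev_orE => [|_].
    by apply: ev_arr2E => //; apply: Hp.
  apply: ev_ltE => //; apply: ev_sumE => u; apply: ev_andE => [|_].
    by apply: ev_arr2E => //; apply: Hp => //; exact: (ltn_ord u).
  by apply: Hrel => //; exact: (ltn_ord u).
split=> // c v cn vn; apply: H2 => //.
by rewrite r2 ltnS.
Qed.

Section Model.
Variables (n : nat) (g : nat -> nat -> bool) (q W z i : nat).

Definition mD (v : nat) : nat := dist n g z v.
Definition mC (v : nat) : bool := mD v < n.
Definition mP (v : nat) : nat := \sum_(x < n.+1) (x.+1 * q <= mD v + q - i).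
Definition mX (v : nat) : bool := mD v + q - i - mP v * q == 0.
Definition mArrow (u v : nat) : bool :=
  [&& mC u, mC v, ~~ mX u, ~~ mX v &
    (mD v == mD u + 1) && ~~ g u v || (mD u == mD v + 1) && g u v].
(** The down-set of [v] is what [v] reaches against the arrows; [n] rounds are enough. *)
Definition mH (v : nat) : nat :=
  \sum_(u < n) reach n (fun a b => mArrow b a) v n u.
Definition mStage (v : nat) : nat := if mX v then 0 else mP v + 1.
(** Mixed radix packing of stage, height (at most [n]) and vertex (below [n]), so that comparing
    numbers compares lexicographically. The vertex as last digit makes the keys distinct. *)
Definition mCode (v : nat) : nat := n * (n.+1 * mStage v + mH v) + v.
Definition mN : nat := \sum_(v < n) mC v.
Definition mPos (v : nat) : nat := rank n mC mCode v.
Definition mOrd (j : nat) : nat := unrank n mC mCode j.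
Definition mAdj (x y : nat) : bool := g (mOrd x) (mOrd y).
Definition mLevels (j : nat) : level := levels n mN W mAdj j.
(** An overflowing level spoils the levels after it, but the first overflow is itself recorded in
    its length. Levels beyond [mN] are computed as well and must be ignored. *)
Definition mOk : bool :=
  \sum_(j < n.+1) ((j <= mN) && (W < len (mLevels j))) == 0.
Definition mOut (out : nat -> nat) (v : nat) : nat :=
  if mC v && mOk then nat_of_bool (chosen n mN W mAdj (mPos v)) else out v.

End Model.

Lemma mCode_inj n g q z i c c' : c < n -> c' < n -> mC n g z c -> mC n g z c' ->
  mCode n g q z i c = mCode n g q z i c' -> c = c'.
Proof.
move=> cn cn' _ _; rewrite /mCode ![n * _]mulnC.
by case/(pair_index_inj cn cn').
Qed.

(* Variables: 0 the number n of vertices, 1 the base address n * n, 2 n + 1,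
   3 q, 5 W, 6 z, 7 i, 17 the number of powers of n + 1, 18 2 W.
   Arrays: 0 and 4 reachability in at most c steps, 1 distances, 2 pieces,
   3 arrows, 5 heights, 6 sorting keys, 7 positions, 8 order, 9 adjacency of
   positions, 10-13 the levels, 14-20, 22 and 23 the candidates of a level,
   21 size of the component and success flag, 24 decoding of the best set,
   25 output, 26 powers of n + 1, 27 new output. *)
Definition adjE (u v : expr) : expr := EMem (EAdd (mulE 0 u (EVar 0)) v).
Definition compE (v : expr) : expr := ltE (arrE 1 v) (EVar 0).
Definition offE (v : expr) : expr := ESub (EAdd (arrE 1 v) (EVar 3)) (EVar 7).
Definition sepE (v : expr) : expr :=
  eqE (ESub (offE v) (mulE 2 (arrE 2 v) (EVar 3))) (ECst 0).
Definition distC : cmd := CFor 9 0 (storeC 1 (EVar 9)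
  (ESum 8 0 (notE (arr2E 0 (EVar 8) (EVar 9))))).
Definition pieceC : cmd := CFor 9 0 (storeC 2 (EVar 9)
  (ESum 8 2 (leE (mulE 2 (EAdd (EVar 8) (ECst 1)) (EVar 3)) (offE (EVar 9))))).
Definition arrowC : cmd := CFor 8 0 (CFor 9 0 (storeC 3 idxE
  (andE (compE (EVar 8)) (andE (compE (EVar 9)) (andE (notE (sepE (EVar 8)))
    (andE (notE (sepE (EVar 9)))
      (orE (andE (eqE (arrE 1 (EVar 9)) (EAdd (arrE 1 (EVar 8)) (ECst 1)))
                 (notE (adjE (EVar 8) (EVar 9))))
           (andE (eqE (arrE 1 (EVar 8)) (EAdd (arrE 1 (EVar 9)) (ECst 1)))
                 (adjE (EVar 8) (EVar 9)))))))))).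
Definition heightC : cmd := CFor 11 0 (CSeq
  (closureC 4 (EVar 11) (arr2E 3 (EVar 9) (EVar 10)))
  (storeC 5 (EVar 11) (ESum 10 0 (arr2E 4 (EVar 0) (EVar 10))))).
Definition codeC : cmd := CFor 9 0 (storeC 6 (EVar 9)
  (EAdd (mulE 0 (EVar 0) (EAdd (mulE 2 (EVar 2)
      (EIf (sepE (EVar 9)) (ECst 0) (EAdd (arrE 2 (EVar 9)) (ECst 1))))
    (arrE 5 (EVar 9)))) (EVar 9))).
Definition posC : cmd := CFor 9 0 (storeC 7 (EVar 9)
  (ESum 10 0 (andE (compE (EVar 10)) (ltE (arrE 6 (EVar 10)) (arrE 6 (EVar 9)))))).
Definition ordC : cmd := CFor 9 0 (storeC 8 (EVar 9)
  (ESum 10 0 (EIf (andE (compE (EVar 10)) (eqE (arrE 7 (EVar 10)) (EVar 9)))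
     (EVar 10) (ECst 0)))).
Definition ordadjC : cmd := CFor 8 0 (CFor 9 0 (storeC 9 idxE
  (adjE (arrE 8 (EVar 8)) (arrE 8 (EVar 9))))).
Definition sizeC : cmd := storeC 21 (ECst 0) (ESum 9 0 (compE (EVar 9))).

Definition env0 (n : nat) : nat -> nat := update (fun=> 0) 0 n.
Definition env1 (n q E : nat) : nat -> nat :=
  update (update (update (update (env0 n) 1 (n * n)) 2 n.+1) 3 q) 17 E.
Definition env2 (n q E W : nat) : nat -> nat :=
  update (update (env1 n q E) 5 W) 18 (W + W).

Definition input_ok (n : nat) (g : nat -> nat -> bool) (m : nat -> nat) : Prop :=
  forall u v, u < n -> v < n -> m (u * n + v) = g u v.

Lemma input_agrees n g ks m m' :
  agrees (n * n) ks m m' -> input_ok n g m -> input_ok n g m'.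
Proof. by move=> [H _] I u v un vn; rewrite H ?I //; nia. Qed.

Section Order.
Variables (n : nat) (g : nat -> nat -> bool) (q E W z i : nat).
Hypothesis zn : z < n.
Local Notation r := (update (update (env2 n q E W) 6 z) 7 i).
Local Notation b := (n * n).
Local Notation mD := (mD n g z).
Local Notation mC := (mC n g z).
Local Notation mP := (mP n g q z i).
Local Notation mX := (mX n g q z i).
Local Notation mArrow := (mArrow n g q z i).
Local Notation mH := (mH n g q z i).
Local Notation mCode := (mCode n g q z i).
Local Notation mPos := (mPos n g q z i).
Local Notation mOrd := (mOrd n g q z i).
Local Notation mAdj := (mAdj n g q z i).
Local Notation mN := (mN n g z).

Lemma mP_le v : mP v <= n.+1.
Proof.
rewrite -[X in _ <= X]card_ord -sum1_card; apply: leq_sum => x _; exact: leq_b1.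
Qed.

Lemma ev_adjE s m eu ewv u v : input_ok n g m -> s 0 = n -> fresh 30 eu ->
  ev eu s m = u -> ev ewv s m = v -> u < n -> v < n -> ev (adjE eu ewv) s m = g u v.
Proof.
move=> I s0 fu Eu Ev un vn; rewrite -I // /adjE.
rewrite -[LHS]/(m (ev (EAdd (mulE 0 eu (EVar 0)) ewv) s m)); congr (m _).
apply: ev_addE => //; apply: ev_mulE => //; rewrite s0 //; exact: ltnW.
Qed.

Lemma dist_stage m : input_ok n g m ->
  let m' := den (CSeq (closureC 0 (EVar 6) (adjE (EVar 10) (EVar 9))) distC) r m in
  agrees b [:: 0; 1] m m' /\ forall v, v < n -> arr b m' 1 v = mD v.
Proof.
move=> I; rewrite [den _ _ _]/=.
have [//||A1 F1] := @closure_fill 0 (EVar 6) (adjE (EVar 10) (EVar 9)) r m g z isT (erefl _).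
  move=> c v u m' vn un /input_agrees/(_ I) I'.
  by apply: (ev_adjE I').
set m1 := den _ r m in A1 F1 *.
have [//||A2 F2 _] := @for_fill distC _ _ _ _ _ r m1 id mD (erefl _) isT isT; last first.
  by split=> //; apply: agrees_trans A1 A2 => k; rewrite !inE => /eqP->.
move=> v m' vn A' _ _; split=> //.
 apply: ev_sumE => c; apply: ev_notE.
apply: ev_arr2E => //; first exact: ltnW (ltn_ord c).
rewrite (proj2 A') //; apply: F1 => //; exact: ltnW (ltn_ord c).
Qed.

Lemma ev_compE s m e v : (forall v, v < n -> arr b m 1 v = mD v) ->
  s 0 = n -> s 1 = b -> ev e s m = v -> v < n -> ev (compE e) s m = mC v.
Proof.
move=> F s0 s1 Ee vn; apply: ev_ltE => //; apply: ev_arrE.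
by rewrite s1 Ee F.
Qed.

Lemma ev_offE s m e v : (forall v, v < n -> arr b m 1 v = mD v) ->
  s 1 = b -> s 3 = q -> s 7 = i -> ev e s m = v -> v < n ->
  ev (offE e) s m = mD v + q - i.
Proof.
move=> F s1 s3 s7 Ee vn; apply: ev_subE => //; apply: ev_addE => //.
by apply: ev_arrE; rewrite s1 Ee F.
Qed.

Lemma ev_sepE s m e v : (forall v, v < n -> arr b m 1 v = mD v) ->
  (forall v, v < n -> arr b m 2 v = mP v) ->
  s 1 = b -> s 2 = n.+1 -> s 3 = q -> s 7 = i -> fresh 30 e -> ev e s m = v -> v < n ->
  ev (sepE e) s m = mX v.
Proof.
move=> F F2 s1 s2 s3 s7 fe Ee vn; apply: ev_eqE => //; apply: ev_subE.
  exact: ev_offE.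
apply: ev_mulE => //; last by rewrite s2; exact: mP_le.
  by rewrite /= fe.
by apply: ev_arrE; rewrite s1 Ee F2.
Qed.

Lemma mOrd_lt j : mOrd j < n.
Proof. by apply: unrank_lt; [exact: leq_ltn_trans zn|exact: mCode_inj]. Qed.

Definition order_facts (m : nat -> nat) : Prop :=
  [/\ input_ok n g m, forall v, v < n -> arr b m 1 v = mD v,
      forall v, v < n -> arr b m 7 v = mPos v,
      forall x y, x < n -> y < n -> arr b m 9 (x * n + y) = mAdj x y
    & arr b m 21 0 = mN].

Definition orderC : cmd :=
  CSeq (CSeq (closureC 0 (EVar 6) (adjE (EVar 10) (EVar 9))) distC)
  (CSeq pieceC (CSeq arrowC (CSeq heightC (CSeq codeC (CSeq posC
  (CSeq ordC (CSeq ordadjC sizeC))))))).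

Lemma order_stage m : input_ok n g m ->
  agrees b [:: 0; 1; 2; 3; 4; 5; 6; 7; 8; 9; 21] m (den orderC r m) /\
  order_facts (den orderC r m).
Proof.
move=> I0; rewrite /orderC.
rewrite -[den _ r m]/(den sizeC r (den ordadjC r (den ordC r (den posC r (den codeC r
  (den heightC r (den arrowC r (den pieceC r
  (den (CSeq (closureC 0 (EVar 6) (adjE (EVar 10) (EVar 9))) distC) r m))))))))).
have [A1 D1] := dist_stage I0.
set m1 := den _ r m in A1 D1 *; clearbody m1; have I1 := input_agrees A1 I0.
have [//||A2 P2 _] := @for_fill pieceC _ _ _ _ _ r m1 id mP (erefl _) isT isT.
  move=> v m' vn A' _ _; split=> //; apply: ev_sumE => x; apply: ev_leE.
    by apply: ev_mulE => //; rewrite -[RHS]addn1; apply: ev_addE.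
  by apply: ev_offE => // w wn; rewrite (proj2 A') // D1.
set m2 := den pieceC r m1 in A2 P2 *; clearbody m2; have I2 := input_agrees A2 I1.
have D2 v : v < n -> arr b m2 1 v = mD v by move=> vn; rewrite (proj2 A2) // D1.
have [|//|||A3 R3] := @for_fill2 arrowC _ _ _ _ _ _ _ r m2 (fun u v => u * n + v)
  mArrow (erefl _) isT isT.
- by [].
- by move=> c t c' t' _ tn _ tn'; apply: pair_index_inj.
- move=> u v m' un vn A' _ _.
  have I' := input_agrees A' I2.
  have D' w : w < n -> arr b m' 1 w = mD w by move=> wn; rewrite (proj2 A') // D2.
  have P' w : w < n -> arr b m' 2 w = mP w by move=> wn; rewrite (proj2 A') // P2.
  split; first by apply: ev_addE => //; apply: ev_mulE => //; exact: ltnW.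
  apply: ev_andE => [|_]; first exact: ev_compE.
  apply: ev_andE => [|_]; first exact: ev_compE.
  apply: ev_andE => [|_]; first by apply: ev_notE; apply: ev_sepE.
  apply: ev_andE => [|_]; first by apply: ev_notE; apply: ev_sepE.
  have Eadj s : s 0 = n -> s 8 = u -> s 9 = v -> ev (adjE (EVar 8) (EVar 9)) s m' = g u v.
    by move=> *; apply: (ev_adjE I').
  have Ed s k w : s 1 = b -> s k = w -> w < n -> ev (arrE 1 (EVar k)) s m' = mD w.
    by move=> s1 sk wn; apply: ev_arrE; rewrite s1 /= sk D'.
  apply: ev_orE => [|_]; apply: ev_andE => [|_].
  + by apply: ev_eqE; [exact: Ed|apply: ev_addE => //; exact: Ed].
  + by apply: ev_notE; apply: Eadj.
  + by apply: ev_eqE; [exact: Ed|apply: ev_addE => //; exact: Ed].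
  + exact: Eadj.
set m3 := den arrowC r m2 in A3 R3 *; clearbody m3; have I3 := input_agrees A3 I2.
have D3 v : v < n -> arr b m3 1 v = mD v by move=> vn; rewrite (proj2 A3) // D2.
have P3 v : v < n -> arr b m3 2 v = mP v by move=> vn; rewrite (proj2 A3) // P2.
(* The reachability table 4 is rebuilt for every source, so [for_fill] does not apply; the invariant
   retains only the heights already stored. *)
pose IH t m' := agrees b [:: 4; 5] m3 m' /\ forall v, v < t -> arr b m' 5 v = mH v.
have [A4 H4] : IH n (den heightC r m3).
  apply: (@for_inv IH 11 0 _ r m3); first by split; [exact: agrees_refl|].
  move=> t m' tn [A' H'].
  rewrite -[den _ _ _]/(den (storeC 5 (EVar 11) (ESum 10 0 (arr2E 4 (EVar 0) (EVar 10))))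
    (update r 11 t) (den (closureC 4 (EVar 11) (arr2E 3 (EVar 9) (EVar 10)))
    (update r 11 t) m')).
  have [//||A'' F''] := @closure_fill 4 (EVar 11) (arr2E 3 (EVar 9) (EVar 10))
    (update r 11 t) m' (fun u v => mArrow v u) t isT (erefl _).
    move=> c v u m'' vn un A''; apply: ev_arr2E => //; first exact: ltnW.
    by rewrite (proj2 A'') // (proj2 A') //; apply: R3.
  set m'' := den (closureC _ _ _) _ m' in A'' F'' *; clearbody m''.
  have Ah : agrees b [:: 4; 5] m3 m''.
    by apply: (agrees_trans _ _ A' A'') => // k; rewrite !inE => ->.
  split.
    apply: (agrees_trans _ _ Ah (@store_agrees 5 _ _ (update r 11 t) m'' isT)) => //.
    by move=> k; rewrite !inE => ->; rewrite orbT.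
  move=> v vt; rewrite (@arr_store 5 _ _ (update r 11 t)) // eqxx andTb.
  rewrite -[ev (EVar 11) _ _]/t.
  case: (v =P t) => [->|vt'].
    apply: ev_sumE => u; apply: ev_arr2E => //.
    by apply: F'' => //; exact: (ltn_ord u).
  rewrite (proj2 A'') // H' //; lia.
set m4 := den heightC r m3 in A4 H4 *; clearbody m4; have I4 := input_agrees A4 I3.
have D4 v : v < n -> arr b m4 1 v = mD v by move=> vn; rewrite (proj2 A4) // D3.
have P4 v : v < n -> arr b m4 2 v = mP v by move=> vn; rewrite (proj2 A4) // P3.
have [//||A5 C5 _] := @for_fill codeC _ _ _ _ _ r m4 id mCode (erefl _) isT isT.
  move=> v m' vn A' _ _.
  have D' w : w < n -> arr b m' 1 w = mD w by move=> wn; rewrite (proj2 A') // D4.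
  have P' w : w < n -> arr b m' 2 w = mP w by move=> wn; rewrite (proj2 A') // P4.
  have H' w : w < n -> arr b m' 5 w = mH w by move=> wn; rewrite (proj2 A') // H4.
  split=> //; apply: ev_addE => //; apply: ev_mulE => //; apply: ev_addE.
    apply: ev_mulE => //; apply: (ev_ifE (p := mX v)) => [|//|_]; first exact: ev_sepE.
    by apply: ev_addE => //; apply: ev_arrE; apply: P'.
  by apply: ev_arrE; apply: H'.
set m5 := den codeC r m4 in A5 C5 *; clearbody m5; have I5 := input_agrees A5 I4.
have D5 v : v < n -> arr b m5 1 v = mD v by move=> vn; rewrite (proj2 A5) // D4.
have [//||A6 S6 _] := @for_fill posC _ _ _ _ _ r m5 id mPos (erefl _) isT isT.
  move=> v m' vn A' _ _.
  have D' w : w < n -> arr b m' 1 w = mD w by move=> wn; rewrite (proj2 A') // D5.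
  have C' w : w < n -> arr b m' 6 w = mCode w by move=> wn; rewrite (proj2 A') // C5.
  split=> //; apply: ev_sumE => u; have un : u < n := ltn_ord u.
  apply: ev_andE => [|_]; first exact: ev_compE.
  by apply: ev_ltE; apply: ev_arrE; apply: C'.
set m6 := den posC r m5 in A6 S6 *; clearbody m6; have I6 := input_agrees A6 I5.
have D6 v : v < n -> arr b m6 1 v = mD v by move=> vn; rewrite (proj2 A6) // D5.
have [//||A7 O7 _] := @for_fill ordC _ _ _ _ _ r m6 id mOrd (erefl _) isT isT.
  move=> v m' vn A' _ _.
  have D' w : w < n -> arr b m' 1 w = mD w by move=> wn; rewrite (proj2 A') // D6.
  have S' w : w < n -> arr b m' 7 w = mPos w by move=> wn; rewrite (proj2 A') // S6.
  split=> //; apply: ev_sumE => u; have un : u < n := ltn_ord u.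
  apply: (ev_ifE (p := mC u && (mPos u == v))) => // [].
  apply: ev_andE => [|_]; first exact: ev_compE.
  by apply: ev_eqE => //; apply: ev_arrE; apply: S'.
set m7 := den ordC r m6 in A7 O7 *; clearbody m7; have I7 := input_agrees A7 I6.
have D7 v : v < n -> arr b m7 1 v = mD v by move=> vn; rewrite (proj2 A7) // D6.
have S7 v : v < n -> arr b m7 7 v = mPos v by move=> vn; rewrite (proj2 A7) // S6.
have [|//|||A8 G8] := @for_fill2 ordadjC _ _ _ _ _ _ _ r m7 (fun u v => u * n + v)
  mAdj (erefl _) isT isT.
- by [].
- by move=> c t c' t' _ tn _ tn'; apply: pair_index_inj.
- move=> u v m' un vn A' _ _; have I' := input_agrees A' I7.
  have O' w : w < n -> arr b m' 8 w = mOrd w by move=> wn; rewrite (proj2 A') // O7.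
  split; first by apply: ev_addE => //; apply: ev_mulE => //; exact: ltnW.
  by apply: (ev_adjE I') => //; try exact: mOrd_lt; apply: ev_arrE; apply: O'.
set m8 := den ordadjC r m7 in A8 G8 *; clearbody m8; have I8 := input_agrees A8 I7.
have D8 v : v < n -> arr b m8 1 v = mD v by move=> vn; rewrite (proj2 A8) // D7.
have S8 v : v < n -> arr b m8 7 v = mPos v by move=> vn; rewrite (proj2 A8) // S7.
have A9 : agrees b [:: 21] m8 (den sizeC r m8) by exact: (@store_agrees 21 _ _ r).
have N9 : arr b (den sizeC r m8) 21 0 = mN.
  rewrite (@arr_store 21 _ _ r) // eqxx andTb -[ev (ECst 0) _ _]/0 eqxx.
  apply: ev_sumE => v; have vn : v < n := ltn_ord v.
  exact: ev_compE.
set m9 := den sizeC r m8 in A9 N9 *; clearbody m9.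
split; last first.
  split=> //.
  - exact: input_agrees A9 I8.
  - by move=> v vn; rewrite (proj2 A9) // D8.
  - by move=> v vn; rewrite (proj2 A9) // S8.
  - by move=> x y xn yn; rewrite (proj2 A9) //; apply: G8.
have step ks ma mb : all (mem [:: 0; 1; 2; 3; 4; 5; 6; 7; 8; 9; 21]) ks ->
    agrees b [:: 0; 1; 2; 3; 4; 5; 6; 7; 8; 9; 21] m ma -> agrees b ks ma mb ->
    agrees b [:: 0; 1; 2; 3; 4; 5; 6; 7; 8; 9; 21] m mb.
  by move=> /allP H; apply: agrees_trans.
apply: (step _ m8 _ _ _ A9) => //; apply: (step _ m7 _ _ _ A8) => //.
apply: (step _ m6 _ _ _ A7) => //; apply: (step _ m5 _ _ _ A6) => //.
apply: (step _ m4 _ _ _ A5) => //; apply: (step _ m3 _ _ _ A4) => //.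
apply: (step _ m2 _ _ _ A3) => //; apply: (step _ m1 _ _ _ A2) => //.
exact: (step _ m _ _ _ A1).
Qed.


End Order.

(** * The dynamic program as a command *)

Definition arrWE (k : nat) (j x : expr) : expr := arrE k (EAdd (mulE 0 j (EVar 5)) x).
Definition weightE (j : expr) : expr :=
  arrE 26 (ESub (ESub (arrE 21 (ECst 0)) (ECst 1)) j).
Definition stateE (c : expr) : expr := EIf (ltE c (EVar 5)) c (ESub c (EVar 5)).
Definition level0C : cmd :=
  CSeq (storeC 10 (ECst 0) (ECst 1)) (CSeq (CFor 9 5 (storeC 11 (EVar 9) (ECst 0)))
    (CSeq (CFor 9 5 (storeC 12 (EVar 9) (ECst 0)))
          (CFor 9 5 (storeC 13 (EVar 9) (ECst 0))))).
Definition backC : cmd := storeC 22 (ECst 0)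
  (ESum 9 0 (andE (ltE (EVar 9) (EVar 8)) (arr2E 9 (EVar 9) (EVar 8)))).
Definition fwdC : cmd := storeC 23 (ECst 0)
  (ESum 9 0 (EIf (andE (ltE (EVar 8) (EVar 9)) (andE (ltE (EVar 9) (arrE 21 (ECst 0)))
    (arr2E 9 (EVar 8) (EVar 9)))) (weightE (EVar 9)) (ECst 0))).
Definition digitC : cmd := CFor 10 5 (storeC 14 (EVar 10)
  (ESum 9 0 (leE (mulE 0 (EAdd (EVar 9) (ECst 1)) (weightE (EVar 8)))
                 (arrWE 11 (EVar 8) (EVar 10))))).
Definition csigC : cmd := CFor 10 18 (storeC 15 (EVar 10)
  (EAdd (ESub (arrWE 11 (EVar 8) (stateE (EVar 10)))
              (mulE 0 (arrE 14 (stateE (EVar 10))) (weightE (EVar 8))))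
        (EIf (ltE (EVar 10) (EVar 5)) (ECst 0) (arrE 23 (ECst 0))))).
Definition cvalC : cmd := CFor 10 18 (storeC 16 (EVar 10)
  (EAdd (arrWE 12 (EVar 8) (stateE (EVar 10)))
        (EIf (ltE (EVar 10) (EVar 5)) (arrE 14 (stateE (EVar 10)))
             (ESub (arrE 22 (ECst 0)) (arrE 14 (stateE (EVar 10))))))).
Definition csetC : cmd := CFor 10 18 (storeC 17 (EVar 10)
  (EAdd (arrWE 13 (EVar 8) (stateE (EVar 10)))
        (EIf (ltE (EVar 10) (EVar 5)) (ECst 0) (weightE (EVar 8))))).
Definition validE (c : expr) : expr := ltE (stateE c) (arrE 10 (EVar 8)).
(** All pairs of candidates are compared, without sorting or hashing: a factor polynomial in [W] is
    absorbed by the time bound. *)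
Definition keepC : cmd := CFor 10 18 (storeC 18 (EVar 10)
  (andE (validE (EVar 10)) (eqE (ESum 11 18
    (andE (validE (EVar 11)) (andE (eqE (arrE 15 (EVar 11)) (arrE 15 (EVar 10)))
      (orE (ltE (arrE 16 (EVar 10)) (arrE 16 (EVar 11)))
           (andE (eqE (arrE 16 (EVar 11)) (arrE 16 (EVar 10)))
                 (ltE (EVar 11) (EVar 10))))))) (ECst 0)))).
Definition rankC : cmd := CFor 10 18 (storeC 19 (EVar 10)
  (ESum 11 18 (andE (arrE 18 (EVar 11)) (ltE (EVar 11) (EVar 10))))).
Definition pickC : cmd := CFor 10 5 (storeC 20 (EVar 10)
  (ESum 11 18 (EIf (andE (arrE 18 (EVar 11)) (eqE (arrE 19 (EVar 11)) (EVar 10)))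
                   (EVar 11) (ECst 0)))).
Definition lenC : cmd := storeC 10 (EAdd (EVar 8) (ECst 1)) (ESum 11 18 (arrE 18 (EVar 11))).
Definition copyC (k k' : nat) : cmd := CFor 10 5
  (storeC k (EAdd (mulE 0 (EAdd (EVar 8) (ECst 1)) (EVar 5)) (EVar 10))
            (arrE k' (arrE 20 (EVar 10)))).
Definition stepC : cmd :=
  CSeq backC (CSeq fwdC (CSeq digitC (CSeq csigC (CSeq cvalC (CSeq csetC (CSeq keepC
  (CSeq rankC (CSeq pickC (CSeq lenC (CSeq (copyC 11 15) (CSeq (copyC 12 16)
  (copyC 13 17)))))))))))).
Definition dpC : cmd := CSeq level0C (CFor 8 0 stepC).

Section DynProg.
Variables (n q E W z i N : nat) (a : nat -> nat -> bool).
Hypotheses (n0 : 0 < n) (Nn : N <= n) (W0 : 0 < W).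
Local Notation r := (update (update (env2 n q E W) 6 z) 7 i).
Local Notation b := (n * n).
Local Notation levels := (levels n N W a).
Local Notation ks := [:: 10; 11; 12; 13; 14; 15; 16; 17; 18; 19; 20; 22; 23].

Definition dp_facts (m : nat -> nat) : Prop :=
  [/\ forall x y, x < n -> y < n -> arr b m 9 (x * n + y) = a x y,
      arr b m 21 0 = N & forall t, t < n -> arr b m 26 t = n.+1 ^ t].

Definition level_facts (j : nat) (s : level) (m : nat -> nat) : Prop :=
  [/\ arr b m 10 j = len s,
      forall t, t < W -> arr b m 11 (j * W + t) = lsig s t,
      forall t, t < W -> arr b m 12 (j * W + t) = lval s t
    & forall t, t < W -> arr b m 13 (j * W + t) = lset s t].

Lemma dp_facts_agrees ks' m m' : agrees b ks' m m' ->
  (9 \notin ks') && (21 \notin ks') && (26 \notin ks') -> dp_facts m -> dp_facts m'.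
Proof.
move=> [_ A] /andP[/andP[k9 k21] k26] [H1 H2 H3].
by split=> *; rewrite (A, A, A) ?(H1, H2, H3).
Qed.

Lemma level_facts_agrees j s ks' m m' : agrees b ks' m m' ->
  (10 \notin ks') && (11 \notin ks') && (12 \notin ks') && (13 \notin ks') ->
  level_facts j s m -> level_facts j s m'.
Proof.
move=> [_ A] /andP[/andP[/andP[k1 k2] k3] k4] [H1 H2 H3 H4].
by split=> [|t tW|t tW|t tW]; rewrite A ?(H1, H2, H3, H4).
Qed.

Lemma ev_arrWE s m k ej ex j x v : s 0 = n -> s 1 = b -> s 5 = W -> fresh 30 ej ->
  ev ej s m = j -> ev ex s m = x -> j <= n -> arr b m k (j * W + x) = v ->
  ev (arrWE k ej ex) s m = v.
Proof.
move=> s0 s1 s5 fj Ej Ex jn <-; apply: ev_arrE; rewrite s1; congr arr.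
by apply: ev_addE => //; apply: ev_mulE => //; rewrite s0.
Qed.

Lemma ev_weightE s m e j : dp_facts m -> s 1 = b -> ev e s m = j ->
  ev (weightE e) s m = weight n N j.
Proof.
move=> [_ F2 F3] s1 Ee; apply: ev_arrE; rewrite s1 /weight.
have -> : ev (ESub (ESub (arrE 21 (ECst 0)) (ECst 1)) e) s m = N.-1 - j.
  apply: ev_subE => //; rewrite -subn1; apply: ev_subE => //; apply: ev_arrE.
  by rewrite s1.
by apply: F3; apply: leq_ltn_trans (leq_subr _ _) _; move: Nn; case: (N) => //.
Qed.

Lemma ev_stateE s m e c : s 5 = W -> ev e s m = c -> ev (stateE e) s m = cstate W c.
Proof.
move=> s5 Ee; apply: (ev_ifE (p := c < W)) => [|//|_]; first by apply: ev_ltE.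
by apply: ev_subE.
Qed.

Lemma cstate_lt c : c < W + W -> cstate W c < W.
Proof. by move=> cW; rewrite /cstate; case: (ltnP c W) => // H; rewrite ltn_subLR. Qed.

Lemma level0_stage m :
  agrees b ks m (den level0C r m) /\ level_facts 0 (levels 0) (den level0C r m).
Proof.
rewrite -[den level0C r m]/(den (CFor 9 5 (storeC 13 (EVar 9) (ECst 0))) r
  (den (CFor 9 5 (storeC 12 (EVar 9) (ECst 0))) r
  (den (CFor 9 5 (storeC 11 (EVar 9) (ECst 0))) r
  (den (storeC 10 (ECst 0) (ECst 1)) r m)))).
have A0 := @store_agrees 10 (ECst 0) (ECst 1) r m isT.
have F0 : arr b (den (storeC 10 (ECst 0) (ECst 1)) r m) 10 0 = 1.
  by rewrite (@arr_store 10 _ _ r).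
set m1 := den _ r m in A0 F0 *; clearbody m1.
have fillk k m' : k < 32 -> let m'' := den (CFor 9 5 (storeC k (EVar 9) (ECst 0))) r m' in
  agrees b [:: k] m' m'' /\ forall t, t < W -> arr b m'' k t = 0.
  move=> k32; have [//|//|A F _] := @for_fill _ _ _ _ _ _ r m' id (fun=> 0)
    (erefl (CFor 9 5 (storeC k (EVar 9) (ECst 0)))) k32 isT.
  by split.
have [A1 F1] := fillk 11 m1 isT; set m2 := den _ r m1 in A1 F1 *; clearbody m2.
have [A2 F2] := fillk 12 m2 isT; set m3 := den _ r m2 in A2 F2 *; clearbody m3.
have [A3 F3] := fillk 13 m3 isT; set m4 := den _ r m3 in A3 F3 *; clearbody m4.
split.
  have step k ma mb : k \in ks -> agrees b ks m ma -> agrees b [:: k] ma mb ->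
      agrees b ks m mb.
    move=> H; apply: agrees_trans => // k'; rewrite inE => /eqP ->; exact: H.
  apply: (step _ m3 _ _ _ A3) => //; apply: (step _ m2 _ _ _ A2) => //.
  by apply: (step _ m1 _ _ _ A1) => //; apply: (step _ m _ _ _ A0).
split=> [|t tW|t tW|t tW]; rewrite ?mul0n ?add0n.
- by rewrite (proj2 A3) // (proj2 A2) // (proj2 A1).
- by rewrite (proj2 A3) // (proj2 A2) // F1.
- by rewrite (proj2 A3) // F2.
- exact: F3.
Qed.

Section Step.
Variables (j : nat) (s : level).
Hypothesis jn : j < n.
Local Notation r' := (update r 8 j).
Local Notation keep := (ckeep n N W a j s).

(** The last conclusion keeps the earlier levels: the loop runs on to [n], yet afterwards the set is
    read from level [N] and the lengths of all levels are checked. *)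
Lemma step_stage m : dp_facts m -> level_facts j s m ->
  let m' := den stepC r' m in
  [/\ agrees b ks m m', level_facts j.+1 (next_level n N W a j s) m'
    & forall j' s', j' <= j -> level_facts j' s' m -> level_facts j' s' m'].
Proof.
move=> D0 L0; rewrite -[den stepC r' m]/(den (copyC 13 17) r' (den (copyC 12 16) r'
  (den (copyC 11 15) r' (den lenC r' (den pickC r' (den rankC r' (den keepC r'
  (den csetC r' (den cvalC r' (den csigC r' (den digitC r' (den fwdC r'
  (den backC r' m))))))))))))).
have A1 : agrees b [:: 22] m (den backC r' m) by exact: (@store_agrees 22 _ _ r').
have F1 : arr b (den backC r' m) 22 0 = back_deg n a j.
  rewrite (@arr_store 22 _ _ r') // eqxx andTb -[ev (ECst 0) _ _]/0 eqxx.
  apply: ev_sumE => l; apply: ev_andE => [|lj]; first by apply: ev_ltE.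
  have ln : l < n := ltn_ord l; apply: ev_arr2E => //; first exact: ltnW.
  by case: D0 => H _ _; apply: H.
set m1 := den _ r' m in A1 F1 *; clearbody m1.
have D1 := dp_facts_agrees A1 isT D0; have L1 := level_facts_agrees A1 isT L0.
have A2 : agrees b [:: 23] m1 (den fwdC r' m1) by exact: (@store_agrees 23 _ _ r').
have F2 : arr b (den fwdC r' m1) 23 0 = fwd_code n N a j.
  rewrite (@arr_store 23 _ _ r') // eqxx andTb -[ev (ECst 0) _ _]/0 eqxx.
  apply: ev_sumE => l; have ln : l < n := ltn_ord l.
  apply: (ev_ifE (p := [&& j < l, l < N & a j l])) => [|_|//]; last exact: ev_weightE.
  apply: ev_andE => [|_]; first by apply: ev_ltE.
  apply: ev_andE => [|_].
    by apply: ev_ltE => //; apply: ev_arrE; case: D1.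
  apply: ev_arr2E => //; first exact: ltnW.
  by case: D1 => H _ _; apply: H.
set m2 := den _ r' m1 in A2 F2 *; clearbody m2.
have G2 : arr b m2 22 0 = back_deg n a j by rewrite (proj2 A2).
have D2 := dp_facts_agrees A2 isT D1; have L2 := level_facts_agrees A2 isT L1.
have [//||A3 F3 _] := @for_fill digitC _ _ _ _ _ r' m2 id
  (fun t => digit n N j (lsig s t)) (erefl _) isT isT.
  move=> t m' tW A' _ _; split=> //.
  have D' := dp_facts_agrees A' isT D2; have L' := level_facts_agrees A' isT L2.
  apply: ev_sumE => x; apply: ev_leE.
    apply: ev_mulE => //; last exact: ev_weightE.
    by rewrite -[RHS]addn1; apply: ev_addE.
  apply: ev_arrWE => //; first exact: ltnW.
  by case: L' => _ H _ _; apply: H.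
set m3 := den _ r' m2 in A3 F3 *; clearbody m3.
have D3 := dp_facts_agrees A3 isT D2; have L3 := level_facts_agrees A3 isT L2.
have G3 : arr b m3 22 0 = back_deg n a j by rewrite (proj2 A3).
have E3 : arr b m3 23 0 = fwd_code n N a j by rewrite (proj2 A3).
have dig_le t : digit n N j t <= n.
  rewrite -[X in _ <= X]card_ord -sum1_card; apply: leq_sum => x _; exact: leq_b1.
have jn' : j <= n by exact: ltnW.
have [//||A4 F4 _] := @for_fill csigC _ _ _ _ _ r' m3 id
  (csig n N W a j s) (erefl _) isT isT.
  move=> c m' cW A' _ _; split=> //; have stW := cstate_lt cW.
  have D' := dp_facts_agrees A' isT D3; have L' := level_facts_agrees A' isT L3.
  have st : ev (stateE (EVar 10)) (update r' 10 c) m' = cstate W c by apply: ev_stateE.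
  apply: ev_addE; last first.
    apply: (ev_ifE (p := c < W)) => [|//|_]; first by apply: ev_ltE.
    by apply: ev_arrE; rewrite (proj2 A').
  apply: ev_subE.
    by apply: (ev_arrWE (x := cstate W c)) => //; case: L' => _ H _ _; apply: H.
  apply: ev_mulE => //; last exact: ev_weightE.
  by apply: ev_arrE; rewrite st (proj2 A') // F3.
set m4 := den _ r' m3 in A4 F4 *; clearbody m4.
have D4 := dp_facts_agrees A4 isT D3; have L4 := level_facts_agrees A4 isT L3.
have [//||A5 F5 _] := @for_fill cvalC _ _ _ _ _ r' m4 id
  (cval n N W a j s) (erefl _) isT isT.
  move=> c m' cW A' _ _; split=> //; have stW := cstate_lt cW.
  have D' := dp_facts_agrees A' isT D4; have L' := level_facts_agrees A' isT L4.
  have st : ev (stateE (EVar 10)) (update r' 10 c) m' = cstate W c by apply: ev_stateE.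
  have dg : ev (arrE 14 (stateE (EVar 10))) (update r' 10 c) m' =
      digit n N j (lsig s (cstate W c)).
    by apply: ev_arrE; rewrite st (proj2 A') // (proj2 A4) // F3.
  apply: ev_addE; last first.
    apply: (ev_ifE (p := c < W)) => [|//|_]; first by apply: ev_ltE.
    by apply: ev_subE => //; apply: ev_arrE; rewrite (proj2 A') // (proj2 A4).
  by apply: (ev_arrWE (x := cstate W c)) => //; case: L' => _ _ H _; apply: H.
set m5 := den _ r' m4 in A5 F5 *; clearbody m5.
have D5 := dp_facts_agrees A5 isT D4; have L5 := level_facts_agrees A5 isT L4.
have G5 c : c < W + W -> arr b m5 15 c = csig n N W a j s c.
  by move=> cW; rewrite (proj2 A5) // F4.
have [//||A6 F6 _] := @for_fill csetC _ _ _ _ _ r' m5 id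
  (cset n N W j s) (erefl _) isT isT.
  move=> c m' cW A' _ _; split=> //; have stW := cstate_lt cW.
  have D' := dp_facts_agrees A' isT D5; have L' := level_facts_agrees A' isT L5.
  have st : ev (stateE (EVar 10)) (update r' 10 c) m' = cstate W c by apply: ev_stateE.
  apply: ev_addE; last first.
    apply: (ev_ifE (p := c < W)) => [|//|_]; first by apply: ev_ltE.
    exact: ev_weightE.
  by apply: (ev_arrWE (x := cstate W c)) => //; case: L' => _ _ _ H; apply: H.
set m6 := den _ r' m5 in A6 F6 *; clearbody m6.
have D6 := dp_facts_agrees A6 isT D5; have L6 := level_facts_agrees A6 isT L5.
have G6 c : c < W + W -> arr b m6 15 c = csig n N W a j s c.
  by move=> cW; rewrite (proj2 A6) // G5.
have H6 c : c < W + W -> arr b m6 16 c = cval n N W a j s c.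
  by move=> cW; rewrite (proj2 A6) // F5.
have [//||A7 F7 _] := @for_fill keepC _ _ _ _ _ r' m6 id
  (fun c => keep c) (erefl _) isT isT.
  move=> c m' cW A' _ _; split=> //.
  have L' := level_facts_agrees A' isT L6.
  have vd rr e c' : rr 1 = b -> rr 5 = W -> rr 8 = j -> ev e rr m' = c' ->
      ev (validE e) rr m' = cvalid W s c'.
    move=> r1 r5 r8 Ee; apply: ev_ltE; first exact: ev_stateE.
    by apply: ev_arrE; rewrite r1 /= r8; case: L'.
  have G' c' : c' < W + W -> arr b m' 15 c' = csig n N W a j s c'.
    by move=> cW'; rewrite (proj2 A') // G6.
  have H' c' : c' < W + W -> arr b m' 16 c' = cval n N W a j s c'.
    by move=> cW'; rewrite (proj2 A') // H6.
  apply: ev_andE => [|_]; first exact: vd.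
  apply: ev_eqE => //; apply: ev_sumE => c'; have cW' : c' < W + W := ltn_ord c'.
  apply: ev_andE => [|_]; first exact: vd.
  apply: ev_andE => [|_].
    by apply: ev_eqE; apply: ev_arrE; apply: G'.
  apply: ev_orE => [|_]; first by apply: ev_ltE; apply: ev_arrE; apply: H'.
  apply: ev_andE => [|_]; first by apply: ev_eqE; apply: ev_arrE; apply: H'.
  by apply: ev_ltE.
set m7 := den _ r' m6 in A7 F7 *; clearbody m7.
have [//||A8 F8 _] := @for_fill rankC _ _ _ _ _ r' m7 id
  (rank (W + W) keep id) (erefl _) isT isT.
  move=> c m' cW A' _ _; split=> //; apply: ev_sumE => c'.
  have cW' : c' < W + W := ltn_ord c'.
  apply: ev_andE => [|_]; last by apply: ev_ltE.
  by apply: ev_arrE; rewrite (proj2 A') //; apply: F7.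
set m8 := den _ r' m7 in A8 F8 *; clearbody m8.
have G8 c : c < W + W -> arr b m8 18 c = keep c.
  by move=> cW; rewrite (proj2 A8) // F7.
have [//||A9 F9 _] := @for_fill pickC _ _ _ _ _ r' m8 id
  (unrank (W + W) keep id) (erefl _) isT isT.
  move=> t m' tW A' _ _; split=> //; apply: ev_sumE => c'.
  have cW' : c' < W + W := ltn_ord c'.
  apply: (ev_ifE (p := keep c' && (rank (W + W) keep id c' == t))) => // [].
  apply: ev_andE => [|_]; first by apply: ev_arrE; rewrite (proj2 A') //; apply: G8.
  by apply: ev_eqE => //; apply: ev_arrE; rewrite (proj2 A') //; apply: F8.
set m9 := den _ r' m8 in A9 F9 *; clearbody m9.
have G9 c : c < W + W -> arr b m9 18 c = keep c.
  by move=> cW; rewrite (proj2 A9) // G8.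
have Aall : agrees b [:: 14; 15; 16; 17; 18; 19; 20; 22; 23] m m9.
  have step k ma mb : k \in [:: 14; 15; 16; 17; 18; 19; 20; 22; 23] ->
      agrees b [:: 14; 15; 16; 17; 18; 19; 20; 22; 23] m ma -> agrees b [:: k] ma mb ->
      agrees b [:: 14; 15; 16; 17; 18; 19; 20; 22; 23] m mb.
    move=> H; apply: agrees_trans => // k'; rewrite inE => /eqP ->; exact: H.
  apply: (step _ m8 _ _ _ A9) => //; apply: (step _ m7 _ _ _ A8) => //.
  apply: (step _ m6 _ _ _ A7) => //; apply: (step _ m5 _ _ _ A6) => //.
  apply: (step _ m4 _ _ _ A5) => //; apply: (step _ m3 _ _ _ A4) => //.
  apply: (step _ m2 _ _ _ A3) => //; apply: (step _ m1 _ _ _ A2) => //.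
  exact: (step _ m _ _ _ A1).
have P9 c : c < W + W -> [/\ arr b m9 15 c = csig n N W a j s c,
    arr b m9 16 c = cval n N W a j s c & arr b m9 17 c = cset n N W j s c].
  move=> cW; rewrite !(proj2 A9) // !(proj2 A8) // !(proj2 A7) //.
  by rewrite G6 // H6 // F6.
clear A1 F1 A2 F2 A3 F3 A4 F4 A5 F5 A6 F6 A7 F7 A8 F8 A9 D1 L1 D2 L2 D3 L3 D4 L4 D5 L5 D6 L6.
clear G2 G3 E3 G5 G6 H6 G8 m1 m2 m3 m4 m5 m6 m7 m8.
have pick_lt t : unrank (W + W) keep id t < W + W.
  by apply: unrank_lt => //; rewrite addn_gt0 W0.
have A10 : agrees b [:: 10] m9 (den lenC r' m9) by exact: (@store_agrees 10 _ _ r').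
have F10 x : arr b (den lenC r' m9) 10 x =
    if x == j.+1 then \sum_(c < W + W) keep c else arr b m9 10 x.
  rewrite (@arr_store 10 _ _ r') // eqxx andTb.
  have -> : ev (EAdd (EVar 8) (ECst 1)) r' m9 = j.+1 by rewrite -[RHS]addn1; apply: ev_addE.
  case: ifP => // _; apply: ev_sumE => c; apply: ev_arrE; apply: G9.
  exact: (ltn_ord c).
set m10 := den _ r' m9 in A10 F10 *; clearbody m10.
(* Signatures, values and sets are selected in the same way. Row [j.+1] of width [W] is disjoint
   from the rows up to [j], which therefore survive. *)
have copy k k' (h : nat -> nat) m' : k < 32 -> k' < 32 -> k' != k -> 20 != k ->
    (forall c, c < W + W -> arr b m' k' c = h c) ->
    (forall t, t < W -> arr b m' 20 t = unrank (W + W) keep id t) ->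
    [/\ agrees b [:: k] m' (den (copyC k k') r' m'),
     forall t, t < W -> arr b (den (copyC k k') r' m') k (j.+1 * W + t)
        = h (unrank (W + W) keep id t)
     & forall j' t, j' <= j -> t < W -> arr b (den (copyC k k') r' m') k (j' * W + t)
        = arr b m' k (j' * W + t)].
  move=> k32 k32' kk k20 Hh Hp.
  have [||A F K] := @for_fill (copyC k k') _ _ _ _ _ r' m' (fun t => j.+1 * W + t)
    (fun t => h (unrank (W + W) keep id t)) (erefl _) k32 isT.
  - by move=> t t' _ _ /addnI.
  - move=> t m'' tW A' _ _; split.
      apply: ev_addE => //; apply: ev_mulE => //.
      by rewrite -[RHS]addn1; apply: ev_addE.
    apply: ev_arrE; rewrite (_ : ev _ _ _ = unrank (W + W) keep id t).
      by rewrite (proj2 A') ?inE //; apply: Hh.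
    by apply: ev_arrE; rewrite (proj2 A') ?inE //; apply: Hp.
  split=> // j' t jj tW; apply: K => t' tW' /(pair_index_inj tW tW')[E' _].
  by move: jj; rewrite E' ltnn.
have [A11 F11 K11] : [/\ _, _ & _] := copy 11 15 (csig n N W a j s) m10 isT isT isT isT
   (fun c cW => etrans (congr1 (fun f => f c) (proj2 A10 15 isT isT)) (let: And3 p _ _ := P9 c cW in p))
   (fun t tW => etrans (congr1 (fun f => f t) (proj2 A10 20 isT isT)) (F9 t tW)).
set m11 := den _ r' m10 in A11 F11 K11 *; clearbody m11.
have H12 c : c < W + W -> arr b m11 16 c = cval n N W a j s c.
  by move=> cW; rewrite (proj2 A11) // (proj2 A10) //; case: (P9 c cW).
have Q12 t : t < W -> arr b m11 20 t = unrank (W + W) keep id t.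
  by move=> tW; rewrite (proj2 A11) // (proj2 A10) // F9.
have [A12 F12 K12] : [/\ _, _ & _] := copy 12 16 _ m11 isT isT isT isT H12 Q12.
set m12 := den _ r' m11 in A12 F12 K12 *; clearbody m12.
have H13 c : c < W + W -> arr b m12 17 c = cset n N W j s c.
  by move=> cW; rewrite (proj2 A12) // (proj2 A11) // (proj2 A10) //; case: (P9 c cW).
have Q13 t : t < W -> arr b m12 20 t = unrank (W + W) keep id t.
  by move=> tW; rewrite (proj2 A12) // Q12.
have [A13 F13 K13] : [/\ _, _ & _] := copy 13 17 _ m12 isT isT isT isT H13 Q13.
set m13 := den _ r' m12 in A13 F13 K13 *; clearbody m13.
split.
- have step ks' ma mb : all (mem ks) ks' -> agrees b ks m ma -> agrees b ks' ma mb ->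
      agrees b ks m mb by move=> /allP H; apply: agrees_trans.
  apply: (step _ m12 _ _ _ A13) => //; apply: (step _ m11 _ _ _ A12) => //.
  apply: (step _ m10 _ _ _ A11) => //; apply: (step _ m9 _ _ _ A10) => //.
  exact: (step _ m _ _ _ Aall).
- split=> [|t tW|t tW|t tW].
  + by rewrite (proj2 A13) // (proj2 A12) // (proj2 A11) // F10 eqxx.
  + by rewrite (proj2 A13) // (proj2 A12) // F11.
  + by rewrite (proj2 A13) // F12.
  + by rewrite F13.
- move=> j' s' jj [H1 H2 H3 H4]; split=> [|t tW|t tW|t tW].
  + rewrite (proj2 A13) // (proj2 A12) // (proj2 A11) // F10 ifF.
      by rewrite (proj2 Aall).
    by move: jj; clear; lia.
  + by rewrite (proj2 A13) // (proj2 A12) // K11 // (proj2 A10) // (proj2 Aall) // H2.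
  + by rewrite (proj2 A13) // K12 // (proj2 A11) // (proj2 A10) // (proj2 Aall) // H3.
  + rewrite K13 // (proj2 A12) // (proj2 A11) // (proj2 A10) // (proj2 Aall) // H4 //.
Qed.

End Step.

Lemma dp_stage m : dp_facts m -> agrees b ks m (den dpC r m) /\
  forall j, j <= n -> level_facts j (levels j) (den dpC r m).
Proof.
move=> D0; rewrite -[den dpC r m]/(den (CFor 8 0 stepC) r (den level0C r m)).
have [A0 L0] := level0_stage m; set m0 := den level0C r m in A0 L0 *; clearbody m0.
pose I t m' := agrees b ks m m' /\ forall j, j <= t -> level_facts j (levels j) m'.
apply: (@for_inv I 8 0 stepC r m0).
  by split=> // j; rewrite leqn0 => /eqP ->.
move=> t m' tn [A L]; have D' := dp_facts_agrees A isT D0.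
have [A' L' K'] := step_stage tn D' (L t (leqnn t)).
split; first exact: agrees_trans A A'.
move=> j; rewrite leq_eqVlt => /orP[/eqP ->|jt]; first exact: L'.
by apply: K' => //; apply: L.
Qed.

End DynProg.

(** * Decoding the best set and looping over the guesses *)

Definition peelC : cmd := CFor 9 0 (storeC 24 (EVar 9)
  (EIf (eqE (EVar 9) (ECst 0)) (arrWE 13 (arrE 21 (ECst 0)) (ECst 0))
    (EIf (leE (weightE (ESub (EVar 9) (ECst 1))) (arrE 24 (ESub (EVar 9) (ECst 1))))
      (ESub (arrE 24 (ESub (EVar 9) (ECst 1))) (weightE (ESub (EVar 9) (ECst 1))))
      (arrE 24 (ESub (EVar 9) (ECst 1)))))).
Definition okC : cmd := storeC 21 (ECst 1)
  (eqE (ESum 9 2 (andE (leE (EVar 9) (arrE 21 (ECst 0)))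
                       (ltE (EVar 5) (arrE 10 (EVar 9))))) (ECst 0)).
(** The new output goes to a separate array and is copied back by [saveC], because [for_fill] gives
    no hold on unwritten cells of the array being filled. *)
Definition newC : cmd := CFor 9 0 (storeC 27 (EVar 9)
  (EIf (andE (compE (EVar 9)) (arrE 21 (ECst 1)))
    (leE (weightE (arrE 7 (EVar 9))) (arrE 24 (arrE 7 (EVar 9))))
    (arrE 25 (EVar 9)))).
Definition saveC : cmd := CFor 9 0 (storeC 25 (EVar 9) (arrE 27 (EVar 9))).
Definition bodyC : cmd := CSeq orderC (CSeq dpC
  (CSeq peelC (CSeq okC (CSeq newC saveC)))).
Definition finalC : cmd := CFor 9 0 (CStore (EVar 9) (arrE 25 (EVar 9))).
Definition mainC : cmd := CSeq (CFor 6 0 (CFor 7 3 bodyC)) finalC.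

Section Main.
Variables (n : nat) (g : nat -> nat -> bool) (q E W : nat).
Hypothesis W0 : 0 < W.
Local Notation b := (n * n).
Local Notation ks := (iota 0 26 ++ [:: 27]).

Lemma mN_le z : mN n g z <= n.
Proof.
rewrite -[X in _ <= X]card_ord -sum1_card; apply: leq_sum => x _; exact: leq_b1.
Qed.

Definition pow_facts (m : nat -> nat) : Prop :=
  forall t, t < n -> arr b m 26 t = n.+1 ^ t.

Lemma body_stage z i m : z < n -> input_ok n g m -> pow_facts m ->
  let m' := den bodyC (update (update (env2 n q E W) 6 z) 7 i) m in
  agrees b ks m m' /\
  forall v, v < n -> arr b m' 25 v = mOut n g q W z i (arr b m 25) v.
Proof.
move=> zn I0 Q0; set r := update _ _ _.
have n0 : 0 < n by exact: leq_ltn_trans zn.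
pose N := mN n g z; have Nn : N <= n := mN_le z.
pose a := mAdj n g q z i.
rewrite -[den bodyC r m]/(den saveC r (den newC r (den okC r (den peelC r
  (den dpC r (den orderC r m)))))).
have [A1 [I1 D1 S1 G1 N1]] := @order_stage n g q E W z i zn m I0.
rewrite -/r in A1 I1 D1 S1 G1 N1.
set m1 := den orderC r m in A1 I1 D1 S1 G1 N1 *; clearbody m1.
have F1 : dp_facts n N a m1.
  by split=> // t tn; rewrite (proj2 A1) // Q0.
have [A2 L2] := @dp_stage n q E W z i N a n0 Nn W0 m1 F1; rewrite -/r in A2 L2.
set m2 := den dpC r m1 in A2 L2 *; clearbody m2.
have F2 := dp_facts_agrees A2 isT F1.
have D2 v : v < n -> arr b m2 1 v = mD n g z v by move=> vn; rewrite (proj2 A2) // D1.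
have S2 v : v < n -> arr b m2 7 v = mPos n g q z i v.
  by move=> vn; rewrite (proj2 A2) // S1.
pose K := lset (levels n N W a N) 0.
have [//||A3 F3 _] := @for_fill peelC _ _ _ _ _ r m2 id (fun x => peel n N x K) (erefl _) isT isT.
  move=> x m' xn A' Hx _; split=> //; have F' := dp_facts_agrees A' isT F2.
  have -> : peel n N x K = if x == 0 then K else
     if weight n N (x - 1) <= peel n N (x - 1) K
     then peel n N (x - 1) K - weight n N (x - 1) else peel n N (x - 1) K.
    by case: x {xn Hx} => [|x] //; rewrite subn1.
  apply: (ev_ifE (p := x == 0)) => [|_|x0]; first by apply: ev_eqE.
    apply: (@ev_arrWE n W _ _ _ _ _ N 0) => //.
      by apply: ev_arrE; case: F'.
    rewrite (proj2 A') //; case: (L2 N Nn) => _ _ _ H; exact: H.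
  have Ep s : s 1 = b -> s 9 = x ->
      ev (arrE 24 (ESub (EVar 9) (ECst 1))) s m' = peel n N (x - 1) K.
    move=> s1 s9; apply: ev_arrE; rewrite s1 (_ : ev _ _ _ = x - 1); last by rewrite -s9.
    by apply: Hx; move: x0; clear; lia.
  have Ew : ev (weightE (ESub (EVar 9) (ECst 1))) (update r 9 x) m' = weight n N (x - 1).
    exact: (@ev_weightE n N a n0 Nn).
  apply: (ev_ifE (p := weight n N (x - 1) <= peel n N (x - 1) K)) => [|_|_].
  - by apply: ev_leE; [exact: Ew|exact: Ep].
  - by apply: ev_subE; [exact: Ep|exact: Ew].
  - exact: Ep.
set m3 := den peelC r m2 in A3 F3 *; clearbody m3.
have F3' := dp_facts_agrees A3 isT F2.
have D3 v : v < n -> arr b m3 1 v = mD n g z v by move=> vn; rewrite (proj2 A3) // D2.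
have S3 v : v < n -> arr b m3 7 v = mPos n g q z i v.
  by move=> vn; rewrite (proj2 A3) // S2.
have L3 j : j <= n -> arr b m3 10 j = len (levels n N W a j).
  by move=> jn; rewrite (proj2 A3) //; case: (L2 j jn).
have A4 : agrees b [:: 21] m3 (den okC r m3) by exact: (@store_agrees 21 _ _ r).
have K4 x : arr b (den okC r m3) 21 x =
    if x == 1 then nat_of_bool (mOk n g q W z i) else arr b m3 21 x.
  rewrite (@arr_store 21 _ _ r) // eqxx andTb -[ev (ECst 1) _ _]/1.
  case: ifP => // _; apply: ev_eqE => //; apply: ev_sumE => j.
  have jn : j <= n by rewrite -ltnS; exact: (ltn_ord j).
  apply: ev_andE => [|_]; first by apply: ev_leE => //; apply: ev_arrE; case: F3'.
  by apply: ev_ltE => //; apply: ev_arrE; apply: L3.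
set m4 := den okC r m3 in A4 K4 *; clearbody m4.
have F4 : dp_facts n N a m4.
  case: F3' => H1 H2 H3; split; last by move=> t tn; rewrite (proj2 A4) // H3.
    by move=> x y xn yn; rewrite (proj2 A4) // H1.
  by rewrite K4.
have D4 v : v < n -> arr b m4 1 v = mD n g z v by move=> vn; rewrite (proj2 A4) // D3.
have S4 v : v < n -> arr b m4 7 v = mPos n g q z i v.
  by move=> vn; rewrite (proj2 A4) // S3.
have P4 x : x < n -> arr b m4 24 x = peel n N x K by move=> xn; rewrite (proj2 A4) // F3.
have O4 : arr b m4 25 = arr b m 25.
  by rewrite (proj2 A4) // (proj2 A3) // (proj2 A2) // (proj2 A1).
have [//||A5 F5 _] := @for_fill newC _ _ _ _ _ r m4 id
   (mOut n g q W z i (arr b m 25)) (erefl _) isT isT.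
  move=> v m' vn A' _ _; split=> //.
  have F' := dp_facts_agrees A' isT F4.
  have Es s : s 1 = b -> s 9 = v -> ev (arrE 7 (EVar 9)) s m' = mPos n g q z i v.
    by move=> s1 s9; apply: ev_arrE; rewrite s1 /= s9 (proj2 A') // S4.
  apply: (ev_ifE (p := mC n g z v && mOk n g q W z i)) => [|/andP[Cv _]|_].
  - apply: ev_andE => [|_]; last by apply: ev_arrE; rewrite (proj2 A') // K4.
    by apply: ev_compE => // w wn; rewrite (proj2 A') // D4.
  - have pn : mPos n g q z i v < n by apply: leq_trans (@rank_lt n (mC n g z) (mCode n g q z i) v vn Cv) Nn.
    apply: ev_leE; first by apply: (@ev_weightE n N a n0 Nn _ _ _ _ F') => //; apply: Es.
    apply: ev_arrE; rewrite (proj2 A') // (_ : ev _ _ _ = mPos n g q z i v); last exact: Es.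
    exact: P4.
  - by apply: ev_arrE; rewrite (proj2 A') // -O4.
set m5 := den newC r m4 in A5 F5 *; clearbody m5.
have [//||A6 F6 _] := @for_fill saveC _ _ _ _ _ r m5 id
   (mOut n g q W z i (arr b m 25)) (erefl _) isT isT.
  move=> v m' vn A' _ _; split=> //; apply: ev_arrE; rewrite (proj2 A') //.
  exact: F5.
split=> //.
have step ks' ma mb : all (mem ks) ks' -> agrees b ks m ma -> agrees b ks' ma mb ->
    agrees b ks m mb by move=> /allP H; apply: agrees_trans.
apply: (step _ m5 _ _ _ A6) => //; apply: (step _ m4 _ _ _ A5) => //.
apply: (step _ m3 _ _ _ A4) => //; apply: (step _ m2 _ _ _ A3) => //.
apply: (step _ m1 _ _ _ A2) => //; exact: (step _ m _ _ _ A1).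
Qed.

Definition outs_at (z i : nat) (o : nat -> nat) : nat -> nat :=
  iteri i (fun i o => mOut n g q W z i o) o.
Definition outs (z : nat) (o : nat -> nat) : nat -> nat :=
  iteri z (fun z o => outs_at z q o) o.

Lemma main_stage m : input_ok n g m -> pow_facts m ->
  forall v, v < n -> den mainC (env2 n q E W) m v = outs n (arr b m 25) v.
Proof.
move=> I0 Q0; pose r := env2 n q E W.
rewrite -[den mainC _ m]/(den finalC r (den (CFor 6 0 (CFor 7 3 bodyC)) r m)).
have [A1 F1] : agrees b ks m (den (CFor 6 0 (CFor 7 3 bodyC)) r m) /\
   forall v, v < n -> arr b (den (CFor 6 0 (CFor 7 3 bodyC)) r m) 25 v
     = outs n (arr b m 25) v.
  pose J z m' := agrees b ks m m' /\
    forall v, v < n -> arr b m' 25 v = outs z (arr b m 25) v.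
  apply: (@for_inv J 6 0 (CFor 7 3 bodyC) r m); first by split; first exact: agrees_refl.
  move=> z m1 zn [A1 F1].
  pose H i m' := agrees b ks m m' /\
    forall v, v < n -> arr b m' 25 v = outs_at z i (outs z (arr b m 25)) v.
  apply: (@for_inv H 7 3 bodyC (update r 6 z) m1); first by split.
  move=> i m2 iq [A2 F2].
  have I2 := input_agrees A2 I0.
  have Q2 : pow_facts m2 by move=> t tn; rewrite (proj2 A2) // Q0.
  have [A3 F3] := body_stage i zn I2 Q2.
  split; first exact: agrees_trans A2 A3.
  move=> v vn; rewrite F3 // /outs_at /= /mOut; case: ifP => // _; exact: F2.
set m1 := den _ r m in A1 F1 *; clearbody m1.
(* The result overwrites part of the input: [t < n] implies [t < n * n], so these writes never reach
   the arrays from which they are read. *)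
pose J t m' := (forall v, v < t -> m' v = outs n (arr b m 25) v) /\
  forall x, b <= x -> m' x = m1 x.
have [H _] : J n (den finalC r m1).
  apply: (@for_inv J 9 0 (CStore (EVar 9) (arrE 25 (EVar 9))) r m1) => //.
  move=> t m' tn [H1 H2].
  have tb : t < b by move: (tn : t < n); clear; nia.
  have Ev : ev (arrE 25 (EVar 9)) (update r 9 t) m' = outs n (arr b m 25) t.
    by rewrite -F1 //; apply: ev_arrE; apply: H2; rewrite -addnA leq_addr.
  rewrite -[den _ _ _]/(update m' t (ev (arrE 25 (EVar 9)) (update r 9 t) m')) Ev.
  split=> [v vt|x bx]; rewrite /update.
    by case: eqP => [->|vt'] //; apply: H1; move: vt vt'; clear; lia.
  by rewrite ifF ?H2 //; move: tb bx; clear; lia.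
exact: H.
Qed.

End Main.

(** * The machine program *)

(** Commands never assign a variable, but loop bounds such as [q] and [W] have to be computed at run
    time; top-level items supply these assignments. *)
Inductive item := ILet of nat & expr | ICmd of cmd.

Definition icode (it : item) (p : nat) : seq instr :=
  match it with
  | ILet x e => ecode e 32 p ++ [:: SetConst 33 0; Add x 32 33]
  | ICmd c => ccode c 32 p
  end.

Definition ienv (it : item) (r m : nat -> nat) : nat -> nat :=
  if it is ILet x e then update r x (ev e r m) else r.

Definition imem (it : item) (r m : nat -> nat) : nat -> nat :=
  if it is ICmd c then den c r m else m.

Definition icost (it : item) (M : nat) : nat :=
  match it with ILet _ e => ecost e M + 2 | ICmd c => ccost c M end.

Definition iok (rs : seq nat) (it : item) : bool :=
  match it with
  | ILet x e => [&& x < 32, below 32 e & bounded rs e]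
  | ICmd c => cbelow 32 c && cbounded rs c
  end.

Fixpoint items_code (its : seq item) (p : nat) : seq instr :=
  if its is it :: its' then icode it p ++ items_code its' (p + size (icode it p))
  else [::].

Fixpoint items_bounded (rs : seq nat) (M : nat) (its : seq item) (r m : nat -> nat) : Prop :=
  if its is it :: its' then
    (forall y, y \in rs -> r y <= M) /\
    items_bounded rs M its' (ienv it r m) (imem it r m)
  else True.

Fixpoint items_mem (its : seq item) (r m : nat -> nat) : nat -> nat :=
  if its is it :: its' then items_mem its' (ienv it r m) (imem it r m) else m.

Definition items_cost (its : seq item) (M : nat) : nat :=
  \sum_(it <- its) icost it M.

Lemma item_runs rs M P it r m rr p : all (ltn^~ 32) rs -> iok rs it ->
  code_at P p (icode it p) -> (forall x, x < 32 -> rr x = r x) ->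
  (forall y, y \in rs -> r y <= M) ->
  exists2 rr', runs P (icost it M) (Config p rr m)
                 (Config (p + size (icode it p)) rr' (imem it r m))
    & forall x, x < 32 -> rr' x = ienv it r m x.
Proof.
move=> Hrs ok cod agr HM.
have HM' y : y \in rs -> rr y <= M.
  by move=> yrs; rewrite agr ?HM //; exact: (allP Hrs).
case: it ok cod => [x e|c] /=.
  move=> /and3P[x32 Be Ce] /code_at_cat[ce /code_at_cons[c0 /code_at_cons[c1 _]]].
  have [r1 [R1 E1 H1]] := ecode_runs Hrs Be Ce m (leqnn 32) ce HM'.
  exists (update (update r1 33 0) x (ev e rr m)).
    apply: runs_trans R1 _; apply: (runs_cons c0) => //.
    apply: (runs_cons c1) => //=.
    rewrite (_ : update r1 33 0 32 = ev e rr m) // (_ : update r1 33 0 33 = 0) // addn0.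
    rewrite size_cat /= addnA addn2; exact: runs_refl.
  move=> y y32; rewrite /update; case: eqP => // _; first exact: ev_ext Be agr.
  by rewrite ifF ?H1 ?agr //; move: y32; clear; lia.
move=> /andP[Bc Cc] cc.
have [r1 R1 H1] := ccode_runs Hrs Bc Cc m (leqnn 32) cc HM'.
exists r1; first by rewrite (den_ext m Bc (fun x xv => esym (agr x xv))).
by move=> x x32; rewrite H1 ?agr.
Qed.

Lemma items_runs rs M P its r m rr p : all (ltn^~ 32) rs -> all (iok rs) its ->
  code_at P p (items_code its p) -> (forall x, x < 32 -> rr x = r x) ->
  items_bounded rs M its r m ->
  exists rr', runs P (items_cost its M) (Config p rr m)
                 (Config (p + size (items_code its p)) rr' (items_mem its r m)).
Proof.
move=> Hrs; elim: its r m rr p => [|it its IH] r m rr p /=.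
  by move=> _ _ _ _; exists rr; rewrite addn0 /items_cost big_nil; exact: runs_refl.
move=> /andP[ok oks] /code_at_cat[c1 c2] agr [HM HB].
have [r1 R1 H1] := item_runs m Hrs ok c1 agr HM.
have [r2 R2] := IH _ _ r1 _ oks c2 H1 HB.
exists r2; rewrite /items_cost big_cons size_cat addnA.
exact: runs_trans R1 R2.
Qed.

Lemma items_mem_let x e its r m v : ev e r m = v ->
  items_mem (ILet x e :: its) r m = items_mem its (update r x v) m.
Proof. by move=> <-. Qed.

Lemma items_mem_cmd c its r m :
  items_mem (ICmd c :: its) r m = items_mem its r (den c r m).
Proof. by []. Qed.

Lemma items_bounded_let rs M x e its r m v : (forall y, y \in rs -> r y <= M) ->
  ev e r m = v -> items_bounded rs M its (update r x v) m ->
  items_bounded rs M (ILet x e :: its) r m.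
Proof. by move=> HM <-. Qed.

Lemma items_bounded_cmd rs M c its r m : (forall y, y \in rs -> r y <= M) ->
  items_bounded rs M its r (den c r m) -> items_bounded rs M (ICmd c :: its) r m.
Proof. by []. Qed.

Lemma items_cost_poly its : exists K D, forall M, items_cost its M <= K * M.+1 ^ D.
Proof.
elim: its => [|it its [K [D H]]].
  by exists 0, 0 => M; rewrite /items_cost big_nil.
have [K' [D' H']] : exists K D, forall M, icost it M <= K * M.+1 ^ D.
  case: it => [x e|c] /=; last exact: ccost_poly.
  have [K' [D' H']] := ecost_poly e; exists (K' + 2), D' => M.
  have : 0 < M.+1 ^ D' by rewrite expn_gt0.
  by have := H' M; lia.
exists (K' + K), (D' + D) => M; rewrite /items_cost big_cons.
apply: leq_trans (leq_add (H' M) (H M)) _.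
by rewrite mulnDl leq_add // leq_mul2l leq_pexp2l ?orbT //; lia.
Qed.

Definition dbl7E (e : expr) : expr :=
  EDbl (EDbl (EDbl (EDbl (EDbl (EDbl (EDbl e)))))).
Definition powC : cmd := CFor 9 17 (storeC 26 (EVar 9)
  (EIf (eqE (EVar 9) (ECst 0)) (ECst 1)
    (mulE 2 (EVar 2) (arrE 26 (ESub (EVar 9) (ECst 1)))))).
(** The powers of [n.+1] are tabulated first: those below exponent [n] serve as weights, and the one
    with exponent [128 * q.+1] is [W]. *)
Definition maxcut_items : seq item :=
  [:: ILet 1 (mulE 0 (EVar 0) (EVar 0));
      ILet 2 (EAdd (EVar 0) (ECst 1));
      ILet 3 (ESum 8 0 (ltE (mulE 0 (EVar 8) (EVar 8)) (EVar 0)));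
      ILet 17 (EAdd (EAdd (EVar 0) (dbl7E (EAdd (EVar 3) (ECst 1)))) (ECst 1));
      ICmd powC;
      ILet 5 (arrE 26 (dbl7E (EAdd (EVar 3) (ECst 1))));
      ILet 18 (EAdd (EVar 5) (EVar 5));
      ICmd mainC].
Definition maxcut_program : program := items_code maxcut_items 0.

(** The rounded-up square root, again by counting: the numbers with square below [n] form an initial
    segment. *)
Definition root_up (n : nat) : nat := \sum_(x < n) (x * x < n).
(** The cardinality of [label_type] for [q = root_up n]. *)
Definition cap_exp (n : nat) : nat := (root_up n).+1 * 128.
Definition cap (n : nat) : nat := n.+1 ^ cap_exp n.
Definition loop_bound (n : nat) : nat := n + cap_exp n + 1 + (cap n + cap n).

Lemma ev_dbl7E e r m : ev (dbl7E e) r m = ev e r m * 128.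
Proof. by rewrite /=; lia. Qed.

Lemma maxcut_items_ok : all (iok [:: 0; 2; 3; 5; 17; 18]) maxcut_items.
Proof. by vm_compute. Qed.

(** The quantities are variables tied by equations, which keeps the large powers symbolic wherever
    the proof computes. *)
Lemma maxcut_runs_gen n g m q ce X W L : q = \sum_(x < n) (x * x < n) ->
  ce = q.+1 * 128 -> X = n + ce + 1 -> W = n.+1 ^ ce -> L = X + (W + W) ->
  input_ok n g m ->
  exists k rr m', [/\ k <= items_cost maxcut_items L,
    iter k (step maxcut_program) (Config 0 (env0 n) m) =
      Config (size maxcut_program) rr m'
    & forall v, v < n -> m' v = outs n g q W n (arr (n * n) m 25) v].
Proof.
move=> qE capE XE WE BE I0; pose rs := [:: 0; 2; 3; 5; 17; 18].
have W0 : 0 < W by rewrite WE expn_gt0.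
pose r1 := update (env0 n) 1 (n * n).
pose r2 := update r1 2 n.+1.
pose r3 := update r2 3 q.
pose r4 := update r3 17 X.
pose m4 := den powC r4 m.
pose r5 := update r4 5 W.
pose r6 := update r5 18 (W + W).
have E1 : ev (mulE 0 (EVar 0) (EVar 0)) (env0 n) m = n * n by apply: ev_mulE.
have E2 : ev (EAdd (EVar 0) (ECst 1)) r1 m = n.+1.
  by rewrite -[RHS]addn1; apply: ev_addE.
have E3 : ev (ESum 8 0 (ltE (mulE 0 (EVar 8) (EVar 8)) (EVar 0))) r2 m = q.
  rewrite qE; apply: ev_sumE => x; apply: ev_ltE => //; apply: ev_mulE => //.
  exact: ltnW (ltn_ord x).
have E128 m' r : r 3 = q -> ev (dbl7E (EAdd (EVar 3) (ECst 1))) r m' = ce.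
  by move=> r3q; rewrite ev_dbl7E capE /= r3q addn1.
have E4 : ev (EAdd (EAdd (EVar 0) (dbl7E (EAdd (EVar 3) (ECst 1)))) (ECst 1)) r3 m = X.
  by rewrite XE; apply: ev_addE => //; apply: ev_addE => //; apply: E128.
have [//||A5 F5 _] := @for_fill powC _ _ _ _ _ r4 m id (fun t => n.+1 ^ t) (erefl _) isT isT.
  move=> t m' tX A' Hp _; split=> //.
  have -> : n.+1 ^ t = if t == 0 then 1 else n.+1 * n.+1 ^ (t - 1).
    by case: t {tX Hp} => [|t] //; rewrite subn1 expnS.
  apply: (ev_ifE (p := t == 0)) => [|//|t0]; first by apply: ev_eqE.
  apply: ev_mulE => //; apply: ev_arrE; apply: Hp.
  by move: t0; rewrite /= /update /=; clear; lia.
rewrite -/m4 in A5 F5.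
have E5 : ev (arrE 26 (dbl7E (EAdd (EVar 3) (ECst 1)))) r4 m4 = W.
  apply: ev_arrE; rewrite E128 // WE; apply: F5.
  by rewrite -[r4 17]/X XE; clear; lia.
have E6 : ev (EAdd (EVar 5) (EVar 5)) r5 m4 = W + W by apply: ev_addE.
have memE : items_mem maxcut_items (env0 n) m = den mainC r6 m4.
  rewrite /maxcut_items (items_mem_let _ _ E1) (items_mem_let _ _ E2).
  rewrite (items_mem_let _ _ E3) (items_mem_let _ _ E4) items_mem_cmd.
  by rewrite (items_mem_let _ _ E5) (items_mem_let _ _ E6) items_mem_cmd.
have qn : q <= n.
  rewrite qE -[X in _ <= X]card_ord -sum1_card; apply: leq_sum => x _; exact: leq_b1.
have bnd r : r \in [:: env0 n; r1; r2; r3; r4; r5; r6] -> forall y, y \in rs ->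
    r y <= L.
  have [B0 B2 B3] : [/\ n <= L, n.+1 <= L & q <= L].
    by move: BE XE qn; clear; split; lia.
  have [B5 B17 B18] : [/\ W <= L, X <= L & W + W <= L].
    by move: BE; clear; split; lia.
  rewrite !inE => Hr y; rewrite !inE.
  by case/or4P: Hr => [/eqP->|/eqP->|/eqP->|]; last case/or4P => /eqP->;
    case/or4P => [/eqP->|/eqP->|/eqP->|]; try by [|case/or3P => /eqP->].
have HB : items_bounded rs (L) maxcut_items (env0 n) m.
  rewrite /maxcut_items.
  apply: (items_bounded_let _ E1); first by apply: bnd; rewrite !inE eqxx.
  apply: (items_bounded_let _ E2); first by apply: bnd; rewrite !inE eqxx ?orbT.
  apply: (items_bounded_let _ E3); first by apply: bnd; rewrite !inE eqxx ?orbT.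
  apply: (items_bounded_let _ E4); first by apply: bnd; rewrite !inE eqxx ?orbT.
  apply: items_bounded_cmd; first by apply: bnd; rewrite !inE eqxx ?orbT.
  apply: (items_bounded_let _ E5); first by apply: bnd; rewrite !inE eqxx ?orbT.
  apply: (items_bounded_let _ E6); first by apply: bnd; rewrite !inE eqxx ?orbT.
  by apply: items_bounded_cmd; first by apply: bnd; rewrite !inE eqxx ?orbT.
clear E5 E6; have r6E : r6 = env2 n q X W by [].
rewrite {}r6E in memE *; clearbody m4.
have code0 : code_at maxcut_program 0 (items_code maxcut_items 0) by move=> k _.
have [rr [k kT Ek]] := @items_runs rs (L) maxcut_program maxcut_items (env0 n) m
  (env0 n) 0 isT maxcut_items_ok code0 (fun _ _ => erefl) HB.
rewrite memE add0n -/maxcut_program in Ek.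
exists k, rr, (den mainC (env2 n q X W) m4); split; [exact: kT|exact: Ek|].
have I4 := input_agrees A5 I0.
have Q4 : pow_facts n m4.
  by move=> t tn; apply: F5; rewrite -[r4 17]/X XE; move: tn; clear; lia.
rewrite -(proj2 A5 25 isT isT).
exact: (main_stage _ _ W0 I4 Q4).
Qed.

Lemma maxcut_runs n g m : input_ok n g m ->
  exists k rr m', [/\ k <= items_cost maxcut_items (loop_bound n),
    iter k (step maxcut_program) (Config 0 (env0 n) m) =
      Config (size maxcut_program) rr m'
    & forall v, v < n ->
        m' v = outs n g (root_up n) (cap n) n (arr (n * n) m 25) v].
Proof. exact: maxcut_runs_gen. Qed.

(** * Correctness of the computed cut *)

Lemma sum_unrank M (k : nat -> bool) (code : nat -> nat) (H : nat -> nat) :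
  (forall c c', c < M -> c' < M -> k c -> k c' -> code c = code c' -> c = c') ->
  \sum_(c < M | k c) H c = \sum_(x < \sum_(c < M) k c) H (unrank M k code x).
Proof.
move=> cI; set L := \sum_(c < M) k c.
rewrite -(big_mkord k H) -(big_mkord xpredT (fun x => H (unrank M k code x))).
rewrite -big_filter -(big_map (unrank M k code) xpredT H).
apply: perm_big; apply: uniq_perm.
- by rewrite filter_uniq // iota_uniq.
- rewrite map_inj_in_uniq ?iota_uniq // => x y; rewrite !mem_index_iota /=.
  move=> /(rank_surj cI)[c [cM kc <-]] /(rank_surj cI)[d [dM kd <-]].
  by rewrite !unrank_rank // => ->.
- move=> c; rewrite mem_filter mem_index_iota /=; apply/andP/mapP.
    move=> [kc cM]; exists (rank M k code c); last by rewrite unrank_rank.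
    by rewrite mem_index_iota /=; apply: rank_lt.
  move=> [x]; rewrite mem_index_iota /= => /(rank_surj cI)[d [dM kd <-]] ->.
  by rewrite unrank_rank.
Qed.

Lemma sum_square N (P : nat -> nat -> nat) : (forall x, P x x = 0) ->
  \sum_(x < N) \sum_(y < N) P x y = \sum_(x < N) \sum_(y < x) (P x y + P y x).
Proof.
move=> P0; elim: N => [|N IH]; first by rewrite !big_ord0.
rewrite big_ord_recr /= [RHS]big_ord_recr /= -IH.
under eq_bigr do rewrite big_ord_recr /=.
by rewrite big_split /= big_ord_recr /= P0 addn0 -addnA -big_split /= addnC
  addnC; congr (_ + _); apply: eq_bigr => y _; rewrite addnC.
Qed.

Lemma code_lex n s h v s' h' v' : v < n -> v' < n -> h <= n -> h' <= n ->
  n * (n.+1 * s + h) + v <= n * (n.+1 * s' + h') + v' ->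
  (s < s') || (s == s') && (h <= h').
Proof.
move=> vn vn' hn hn' H.
have {H vn vn'} : n.+1 * s + h <= n.+1 * s' + h'.
  rewrite leqNgt; apply/negP => AB; move: H.
  have := leq_mul2l n (n.+1 * s' + h').+1 (n.+1 * s + h); rewrite AB orbT mulnS.
  by move: vn vn'; clear; lia.
case: (ltngtP s s') => //= [ss|->]; last by rewrite leq_add2l.
have := leq_mul2l n.+1 s'.+1 s; rewrite ss orbT mulnS.
by move: hn hn'; clear; lia.
Qed.

Definition gnat (n : nat) (G : sgraph 'I_n) (u v : nat) : bool :=
  if insub u is Some u' then if insub v is Some v' then G u' v' else false else false.

Section Optimal.
Variables (n : nat) (G : sgraph 'I_n) (q W : nat).
Local Notation g := (gnat G).
Implicit Types (z : 'I_n) (S T : nat -> bool).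

Lemma gnatE (u v : 'I_n) : g u v = G u v.
Proof. by rewrite /gnat !valK. Qed.

Lemma gnat_sym u v : g u v = g v u.
Proof.
rewrite /gnat; case: (insub u : option 'I_n) => [u'|]; case: (insub v : option 'I_n) => [v'|] //.
exact: adj_sym.
Qed.

Lemma gnat_irr u : g u u = false.
Proof. by rewrite /gnat; case: (insub u : option 'I_n) => [u'|] //; exact: adj_irr. Qed.

Lemma mC_connect z (v : 'I_n) : mC n g z v = connect G z v.
Proof.
rewrite /mC /mD (dist_lt _ (ltn_ord z)).
rewrite (_ : Ordinal (ltn_ord z) = z); last exact: val_inj.
by apply: eq_connect => x y; rewrite gnatE.
Qed.

Lemma connect_G_sym : connect_sym G.
Proof. apply: sym_connect_sym; exact: adj_sym. Qed.

(** Orienting a cut edge from [S] outwards counts it exactly once, so sums over ordered pairs give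
    the size of the cut. *)
Definition out_edges S (u : 'I_n) : nat := \sum_(v < n) [&& G u v, S u & ~~ S v].
Definition cut_on z S : nat := \sum_(u < n | connect G z u) out_edges S u.

Lemma cut_on_ext z S T : (forall v : 'I_n, connect G z v -> S v = T v) ->
  cut_on z S = cut_on z T.
Proof.
move=> H; apply: eq_bigr => u zu; apply: eq_bigr => v _; rewrite H //.
case Guv: (G u v) => //=; rewrite H //; apply: connect_trans zu _; exact: connect1.
Qed.

Lemma cut_on_connect z z' S : connect G z z' -> cut_on z S = cut_on z' S.
Proof.
move=> zz'; apply: eq_bigl => u.
by rewrite (same_connect connect_G_sym zz').
Qed.

Local Notation N z := (mN n g z).
Local Notation ord z i := (mOrd n g q z i).

(** Edges never leave the component, so both sums can be reindexed by positions; the ordered pairs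
    are then folded into pairs with [y < x]. *)
Lemma cut_on_cutv z i S :
  cut_on z S = cutv (mAdj n g q z i) (N z) (fun x => S (ord z i x)).
Proof.
have cI := @mCode_inj n g q z i.
pose Q u v := nat_of_bool [&& g u v, S u & ~~ S v].
have -> : cut_on z S = \sum_(u < n | mC n g z u) \sum_(v < n | mC n g z v) Q u v.
  rewrite /cut_on; apply: eq_big => [u|u zu]; first by rewrite mC_connect.
  rewrite [RHS]big_mkcond /=; apply: eq_bigr => v _; rewrite /Q gnatE mC_connect.
  case: ifP => // /negP zv; case Guv: (G u v) => //.
  by case: zv; apply: connect_trans zu _; exact: connect1.
rewrite (sum_unrank (fun u => \sum_(v < n | mC n g z v) Q u v) cI).
under eq_bigr do rewrite (sum_unrank _ cI).
rewrite (@sum_square _ (fun x y => Q (ord z i x) (ord z i y))); last first.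
  by move=> x; rewrite /Q gnat_irr.
apply: eq_bigr => x _; apply: eq_bigr => y _; rewrite /Q /mAdj.
rewrite [g (ord z i y) (ord z i x)]gnat_sym.
by case: (g _ _); case: (S (ord z i x)); case: (S (ord z i y)).
Qed.

Definition opt_on (o : nat -> nat) z : Prop :=
  forall S, cut_on z S <= cut_on z (fun v => o v != 0).

Lemma ord_spec z i x : x < N z -> exists v : 'I_n,
  [/\ mC n g z v, mPos n g q z i v = x & ord z i x = v].
Proof.
have cI := @mCode_inj n g q z i.
move=> /(rank_surj cI)[c [cn kc Ex]]; exists (Ordinal cn); split=> //.
by rewrite -Ex; apply: unrank_rank.
Qed.

Lemma mOk_len z i : mOk n g q W z i ->
  forall j, j <= N z -> len (mLevels n g q W z i j) <= W.
Proof.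
rewrite /mOk => H j jN; rewrite leqNgt; apply/negP => Hj; move: H.
have jn : j < n.+1 by rewrite ltnS; apply: leq_trans jN _; exact: mN_le.
by rewrite (bigD1 (Ordinal jn)) //= jN Hj.
Qed.

(** This holds for every start vertex and every residue: the quality of the order influences only
    whether [mOk] holds. *)
Lemma mOut_opt z i o : mOk n g q W z i -> opt_on (mOut n g q W z i o) z.
Proof.
move=> ok S; rewrite !(cut_on_cutv z i).
have := dp_optimal (@mN_le n g z) (mOk_len ok) (fun x => S (ord z i x)).
move=> /leq_trans; apply; apply: eq_leq.
apply: eq_bigr => x _; apply: eq_bigr => y _.
have xN := ltn_ord x; have yN := ltn_trans (ltn_ord y) xN.
have [u [Cu Pu ->]] := ord_spec i xN; have [v [Cv Pv ->]] := ord_spec i yN.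
by rewrite /mOut Cu Cv ok /= !eqb0 !negbK Pu Pv.
Qed.

(** A later round either succeeds on the same component and is optimal again, or leaves the output
    on that component alone. *)
Lemma mOut_keep z z' i o : opt_on o z -> opt_on (mOut n g q W z' i o) z.
Proof.
move=> H; case zz: (connect G z' z).
  case ok: (mOk n g q W z' i).
    by move=> S; rewrite -!(cut_on_connect _ zz); apply: mOut_opt.
  move=> S; apply: leq_trans (H S) _; apply: eq_leq; apply: cut_on_ext => v _.
  by rewrite /mOut ok andbF.
move=> S; apply: leq_trans (H S) _; apply: eq_leq; apply: cut_on_ext => v zv.
rewrite /mOut mC_connect ifF //; apply/negP => /andP[z'v _].
by move: zz; rewrite (connect_trans z'v) // connect_G_sym.
Qed.

Lemma outs_opt z i o : i < q -> mOk n g q W z i -> opt_on (outs n g q W n o) z.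
Proof.
move=> iq ok.
have keep_at t k o' : t < n -> opt_on o' z -> opt_on (outs_at n g q W t k o') z.
  by move=> tn Ho; elim: k => //= k IH; apply: (@mOut_keep z (Ordinal tn)).
have ach k o' : i < k -> opt_on (outs_at n g q W z k o') z.
  elim: k => // k IH; rewrite ltnS leq_eqVlt => /orP[/eqP <-|ik] /=.
    exact: mOut_opt.
  by apply: mOut_keep; apply: IH.
suff : forall t, t <= n -> z < t -> opt_on (outs n g q W t o) z by apply.
elim=> // t IH tn; rewrite ltnS leq_eqVlt => /orP[/eqP E|zt]; rewrite /outs /=.
  by rewrite -E; apply: ach.
by apply: keep_at => //; apply: IH => //; exact: ltnW.
Qed.

Lemma cut_on_total S : (\sum_(u < n) out_edges S u) =
  \sum_(r < n | fingraph.root G r == r) cut_on r S.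
Proof.
rewrite (partition_big (fingraph.root G) (fun r => fingraph.root G r == r)) /=; last first.
  by move=> u _; rewrite root_root //; exact: connect_G_sym.
apply: eq_bigr => r /eqP rr; apply: eq_bigl => u.
by rewrite -[in LHS]rr eq_sym (root_connect connect_G_sym).
Qed.

(** The edges across [S] correspond to the ordered pairs leaving [S]: such a pair is recovered from
    its edge, since only one end lies in [S]. *)
Lemma card_cut (S : {set 'I_n}) :
  cut_size G S = \sum_(u < n) out_edges (fun v => [exists w : 'I_n, (val w == v) && (w \in S)]) u.
Proof.
have inS (v : 'I_n) : [exists w : 'I_n, (val w == v) && (w \in S)] = (v \in S).
  apply/existsP/idP => [[w /andP[/eqP/val_inj ->]]//|vS].
  by exists v; rewrite eqxx.
pose A := [set p : 'I_n * 'I_n | [&& G p.1 p.2, p.1 \in S & p.2 \notin S]]%SET.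
have setI2 (u v : 'I_n) : u != v -> #|([set u; v] :&: S)%SET| = (u \in S) + (v \in S).
  move=> uv; rewrite finset.setIUl cardsU.
  have -> : ([set u] :&: S :&: ([set v] :&: S) = finset.set0)%SET.
    apply/finset.setP => w; rewrite !inE; case: eqP => //= ->; rewrite (negPf uv).
    by rewrite andbF.
  have c1 w : #|([set w] :&: S)%SET| = (w \in S).
    case wS: (w \in S).
      by rewrite (finset.setIidPl _) ?cards1 // finset.sub1set.
    by apply/eqP; rewrite cards_eq0 finset.setI_eq0 disjoints1 wS.
  by rewrite cards0 subn0 !c1.
have -> : cut_size G S = #|A|.
  rewrite /cut_size.
  have -> : ([set E in edges G | #|E :&: S| == 1%N] = [set [set p.1; p.2] | p in A])%SET.
    apply/finset.setP => X; rewrite inE; apply/andP/imsetP.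
      move=> [/imsetP[[u v] Guv ->]]; rewrite /= in Guv *.
      have Guv' : G u v by move: Guv; rewrite inE.
      have uv : u != v by apply/eqP => uv; move: Guv'; rewrite uv adj_irr.
      rewrite setI2 //; case uS: (u \in S); case vS: (v \in S) => // _.
        by exists (u, v); rewrite // inE /= Guv' uS vS.
      by exists (v, u); rewrite ?[[set u; v]%SET]finset.setUC // inE /= adj_sym Guv' uS vS.
    move=> [[u v]]; rewrite inE /= => /and3P[Guv uS vS] ->.
    have uv : u != v by apply/eqP => uv; move: Guv; rewrite uv adj_irr.
    rewrite setI2 // uS (negPf vS); split=> //.
    by apply/imsetP; exists (u, v); rewrite ?inE.
  apply: card_in_imset => -[u v] [u' v']; rewrite !inE /=.
  move=> /and3P[_ uS vS] /and3P[_ uS' vS'] /finset.setP E.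
  have Eu : u = u'.
    have := E u; rewrite !inE eqxx /= => /esym/orP[/eqP//|/eqP uv'].
    by rewrite -uv' uS in vS'.
  have Ev : v = v'.
    have := E v; rewrite !inE eqxx orbT => /esym/orP[/eqP vu'|/eqP//].
    by rewrite vu' uS' in vS.
  by rewrite Eu Ev.
rewrite -sum1_card (eq_bigl (fun p : 'I_n * 'I_n =>
    xpredT p.1 && [&& G p.1 p.2, p.1 \in S & p.2 \notin S])); last first.
  by move=> p; rewrite inE.
rewrite -(pair_big_dep xpredT (fun u v : 'I_n => [&& G u v, u \in S & v \notin S])
  (fun _ _ => 1)) /=; apply: eq_bigr => u _.
by rewrite big_mkcond /=; apply: eq_bigr => v _; rewrite !inS; case: ifP.
Qed.

Lemma opt_maximum o :
  (forall v : 'I_n, exists2 z : 'I_n, connect G v z & opt_on o z) ->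
  maximum_cut G [set v : 'I_n | o v != 0]%SET.
Proof.
move=> H T; rewrite !card_cut !cut_on_total; apply: leq_sum => r _.
have [z rz Hz] := H r; rewrite !(cut_on_connect _ rz).
apply: leq_trans (Hz _) _; apply: eq_leq; apply: cut_on_ext => v _.
apply/idP/existsP => [ov|[w /andP[/eqP <-]]]; last by rewrite inE.
by exists v; rewrite eqxx inE.
Qed.

End Optimal.

(** * Success for a leftmost start vertex and a sparse residue *)

Section Leftmost.
Variables (R : realType) (n : nat) (G : sgraph 'I_n).
Variables (x : 'I_n -> R) (lc rc : 'I_n -> bool).
Hypothesis near_adj : forall u v, u != v -> (x u < x v + 1)%R -> (x v < x u + 1)%R -> G u v.
Hypothesis adj_near : forall u v, G u v -> (x u <= x v + 1)%R.
Hypothesis twins : forall u v w, x u = x v -> lc u = lc v -> rc u = rc v ->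
  w != u -> w != v -> G u w = G v w.
Variables (q W : nat) (nq : n <= q * q) (hW : n.+1 ^ (q.+1 * 128) <= W).
Local Notation g := (gnat G).

Section Start.
Variables (z : 'I_n) (i : nat) (iq : i < q).
Local Notation C := (fun v : 'I_n => mC n g z v).
Local Notation D := (fun v : 'I_n => mD n g z v).

Lemma mP_piece (v : 'I_n) : mP n g q z i v = piece D q i v.
Proof.
have q0 : 0 < q by exact: leq_ltn_trans iq.
rewrite /mP sum_div // /piece.
have dn : mD n g z v <= n.
  rewrite -[X in _ <= X]card_ord -sum1_card; apply: leq_sum => c _; exact: leq_b1.
(* A distance is at most [n], so the [n.+1] multiples tried by [mP] cover the quotient. *)
apply: (@leq_trans ((n + q) %/ q)).
  by apply: leq_div2r; apply: leq_trans (leq_subr _ _) _; rewrite leq_add2r.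
rewrite divnDr ?dvdnn // divnn q0 addn1 ltnS; exact: leq_div.
Qed.

Lemma mX_separator (v : 'I_n) : mX n g q z i v = separator D q i v.
Proof.
rewrite /mX mP_piece /separator /residue /piece.
by congr (_ == 0); rewrite {1}(divn_eq (mD n g z v + q - i) q) addKn.
Qed.

Lemma mStage_stage (v : 'I_n) : mStage n g q z i v = stage D q i v.
Proof. by rewrite /mStage mX_separator mP_piece addn1. Qed.

Lemma mArrow_arrow (u v : 'I_n) : mArrow n g q z i u v = arrow G C D q i u v.
Proof. by rewrite /mArrow !mX_separator gnatE !addn1. Qed.

Lemma mH_height (v : 'I_n) : mH n g q z i v = height G C D q i v.
Proof.
rewrite /mH /height -sum1_card [RHS]big_mkcond /=; apply: eq_bigr => u _.
rewrite (reach_connect _ (ltn_ord v)) //.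
rewrite (_ : Ordinal (ltn_ord v) = v); last exact: val_inj.
have := connect_rev (arrow G C D q i) v u; rewrite inE /= => <-.
have -> : connect (fun a b : 'I_n => mArrow n g q z i b a) v u =
    connect (fun a b => arrow G C D q i b a) v u.
  by apply: eq_connect => a b; exact: mArrow_arrow.
by case: (connect _ _ _).
Qed.

Hypothesis z_left : forall v, connect G z v -> (x z <= x v)%R.
Hypothesis few : #|[pred v | C v && separator D q i v]| <= q.
Local Notation N := (mN n g z).
Local Notation ord := (mOrd n g q z i).

Lemma levels_small j : j <= N -> len (mLevels n g q W z i j) <= W.
Proof.
(* Strong induction: soundness of table [j] requires the earlier tables to fit, and soundness
   together with few labels makes table [j] fit. *)
have [k] := ubnP j; elim: k j => // k IH j jk jN.
have Hs : sound_level n N (mAdj n g q z i) j (mLevels n g q W z i j).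
  apply: levels_sound => //; first exact: mN_le.
  by move=> j' jj'; apply: IH; [exact: leq_trans jj' _|exact: ltnW (leq_trans jj' _)].
have zE : Ordinal (ltn_ord z) = z by exact: val_inj.
have D0 v : C v -> D v = 0 -> v = z.
  by move=> _ /(dist_eq0 (ltn_ord z)); rewrite zE.
have Dadj u v : C u -> G u v -> C v /\ D v <= (D u).+1.
  by move=> Cu Guv; apply: (dist_adj (ltn_ord z)) => //; rewrite gnatE.
have Dpar v c : C v -> D v = c.+1 -> exists u, [/\ C u, G u v & D u = c].
  move=> Cv /(dist_parent (ltn_ord z) Cv)[u [Cu uv Du]]; exists u.
  by rewrite -gnatE.
have left v : C v -> (x z <= x v)%R by rewrite mC_connect; exact: z_left.
have Wl : n.+1 ^ #|{: label_type q}| <= W by rewrite card_label_type.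
apply: leq_trans Wl.
(* At the end no vertex remains, and a constant label will do. *)
have [jN'|jN'] := ltnP j N; last first.
  apply: (@sound_level_len _ _ _ (mN_le n g z) _ _ (label_type q)
    (fun=> (ord0, (false, false, false, false, false, false, false))) jN Hs).
  by move=> a b l _ _ _ /andP[jl lN]; have := leq_trans lN (leq_trans jN' jl); rewrite ltnn.
(* The first remaining vertex [v0] provides the stage and height thresholds. Ties with it may occur
   on both sides, hence the weak inequalities in [width_labels]. *)
have [v0 [Cv0 Pv0 Ov0]] := ord_spec q i jN'.
have [tau Htau] := width_labels near_adj adj_near twins left D0 Dadj Dpar iq
  (stage D q i v0) (height G C D q i v0) few.
pose tau' t : label_type q := if insub (ord t) is Some v then tau v
  else (ord0, (false, false, false, false, false, false, false)).
apply: (@sound_level_len _ _ _ (mN_le n g z) _ _ (label_type q) tau' jN Hs).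
move=> a b l aj bj Et /andP[jl lN].
have aN : a < N by exact: ltn_trans jN'.
have bN : b < N by exact: ltn_trans jN'.
have [va [Ca Pa Oa]] := ord_spec q i aN; have [vb [Cb Pb Ob]] := ord_spec q i bN.
have [vl [Cl Pl Ol]] := ord_spec q i lN.
move: Et; rewrite /tau' Oa Ob !valK => Et.
have hn v : height G C D q i v <= n by rewrite -[X in _ <= X]card_ord max_card.
have code_le (u v : 'I_n) : C u -> C v -> mPos n g q z i u <= mPos n g q z i v ->
    (stage D q i u < stage D q i v) ||
    (stage D q i u == stage D q i v) && (height G C D q i u <= height G C D q i v).
  move=> Cu Cv uv; apply: (@code_lex n _ _ u _ _ v) => //.
  rewrite -!mStage_stage -!mH_height leqNgt; apply/negP => Hc.
  have := rank_mono (k := mC n g z) (code := mCode n g q z i) (ltn_ord v) Cv Hc.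
  by rewrite ltnNge uv.
rewrite /mAdj Oa Ob Ol !gnatE; apply: Htau => //.
- by apply: code_le => //; rewrite Pa Pv0 ltnW.
- by apply: code_le => //; rewrite Pb Pv0 ltnW.
- have := code_le v0 vl Cv0 Cl; rewrite Pv0 Pl jl eq_sym => /(_ isT).
  by [].
- by apply/eqP => E; move: aj; rewrite -Pa -E Pl ltnNge jl.
- by apply/eqP => E; move: bj; rewrite -Pb -E Pl ltnNge jl.
Qed.

Lemma leftmost_ok : mOk n g q W z i.
Proof.
rewrite /mOk -leqn0 leqNgt.
rewrite (sum_bool_exists _ (fun j => (j <= N) && (W < len (mLevels n g q W z i j)))).
by apply/existsP => -[j /andP[jN]]; rewrite ltnNge levels_small.
Qed.

End Start.

(** Averaging: a vertex is separating only for the residue [D v %% q], so [q] classes of more than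
    [q] vertices each would exceed [q * q >= n]. *)
Lemma few_separators (C : pred 'I_n) (D : 'I_n -> nat) : 0 < q ->
  exists2 i, i < q & #|[pred v | C v && separator D q i v]| <= q.
Proof.
move=> q0; have [/existsP[i Hi]|/existsPn H] := boolP [exists i : 'I_q,
   #|[pred v | C v && separator D q i v]| <= q]; first by exists i.
have : \sum_(i < q) q.+1 <= \sum_(i < q) #|[pred v | C v && separator D q i v]|.
  by apply: leq_sum => i _; rewrite ltnNge H.
have : \sum_(i < q) #|[pred v | C v && separator D q i v]| <= n.
  under eq_bigr do rewrite -sum1_card big_mkcond /=.
  rewrite exchange_big /= -[X in _ <= X]card_ord -sum1_card; apply: leq_sum => v _.
  have lt : D v %% q < q by rewrite ltn_mod.
  rewrite (bigD1 (Ordinal lt)) //= big1 ?addn0; first by case: ifP.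
  move=> i /eqP ni; case: ifP => //; rewrite inE => /andP[_].
  rewrite /separator /residue => /dvdnP[k Ek]; case: ni; apply: val_inj => /=.
  have E : D v + q = k * q + i by rewrite -Ek subnK // ltnW // ltn_addl.
  by rewrite -(modnDr (D v) q) E modnMDl modn_small.
rewrite sum_nat_const card_ord mulnS => H1 H2.
by have := leq_trans H2 (leq_trans H1 nq); rewrite -[X in _ <= X]add0n leq_add2r leqn0 -leqn0 leqNgt q0.
Qed.

Lemma component_ok (w : 'I_n) : exists2 z : 'I_n, connect G w z &
  exists2 i, i < q & mOk n g q W z i.
Proof.
have [z wz Hz] := @arg_minP _ _ _ w (connect G w) x (connect0 G w).
have q0 : 0 < q by case: q nq (ltn_ord w) => // H; rewrite ltnNge (leq_trans H).
have [i iq few] := few_separators (fun v => mC n g z v) (fun v => mD n g z v) q0.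
exists z => //; exists i => //; apply: leftmost_ok => //.
by move=> v zv; apply: Hz; apply: connect_trans wz zv.
Qed.

End Leftmost.

(** Otherwise the [q.+1] numbers up to [q] would all have squares below [n], more than were
    counted. *)
Lemma root_up_ge n : n <= root_up n * root_up n.
Proof.
rewrite leqNgt; apply/negP => H; set q := root_up n in H.
have qn : q.+1 <= n by move: H; clear; nia.
have : q.+1 <= q.
  rewrite -[X in X <= _](sum_ltn_ord qn); apply: leq_sum => x _.
  case: (ltnP x q.+1) => // xq; rewrite ltnS in xq.
  by rewrite (leq_ltn_trans (leq_mul xq xq) H).
by rewrite ltnn.
Qed.

Lemma root_up_lt n : 0 < n -> (root_up n).-1 * (root_up n).-1 < n.
Proof.
move=> n0; rewrite ltnNge; apply/negP => H; set q := root_up n in H.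
have [q0|q0] := posnP q; first by move: H; rewrite q0 leqNgt n0.
have qn : q.-1 <= n.
  apply: leq_trans (leq_pred _) _.
  rewrite -[X in _ <= X]card_ord -sum1_card; apply: leq_sum => x _; exact: leq_b1.
have : q <= q.-1.
  rewrite -[X in _ <= X](sum_ltn_ord qn); apply: leq_sum => x _.
  case: (ltnP x q.-1) => xq; first exact: leq_b1.
  by rewrite ltnNge (leq_trans H (leq_mul xq xq)).
by rewrite leqNgt prednK // leqnn.
Qed.

Lemma muig_coordinates (R : realType) (n : nat) (G : sgraph 'I_n) :
  mixed_unit_interval_graph R G ->
  exists (x : 'I_n -> R) (lc rc : 'I_n -> bool),
  [/\ forall u v, u != v -> (x u < x v + 1)%R -> (x v < x u + 1)%R -> G u v,
      forall u v, G u v -> (x u <= x v + 1)%R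
    & forall u v w, x u = x v -> lc u = lc v -> rc u = rc v ->
        w != u -> w != v -> G u w = G v w].
Proof.
move=> [I [HI HG]].
(* [BSide true] is closed as a left bound but open as a right bound, hence the negation of [c.2]. *)
have /fin_all_exists[c Hc] : forall v, exists c : R * bool * bool,
    I v = Interval (BSide c.1.2 c.1.1) (BSide (~~ c.2) (c.1.1 + 1)%R).
  move=> v; have [x H] := HI v; case: H => ->.
  - by exists (x, true, true).
  - by exists (x, false, false).
  - by exists (x, true, false).
  - by exists (x, false, true).
exists (fun v => (c v).1.1), (fun v => (c v).1.2), (fun v => (c v).2).
have mem v t : ((c v).1.1 < t < (c v).1.1 + 1)%R -> t \in I v.
  by rewrite Hc => /andP[H1 H2]; case: (c v) H1 H2 => [[y []] []] /= H1 H2;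
    rewrite in_itv /= ?H1 ?H2 ?(ltW H1) ?(ltW H2).
have mem' v t : t \in I v -> ((c v).1.1 <= t <= (c v).1.1 + 1)%R.
  by rewrite Hc; case: (c v) => [[y []] []] /=; rewrite in_itv /= => /andP[H1 H2];
    rewrite ?H1 ?H2 ?(ltW H1) ?(ltW H2).
split.
- move=> u v uv H1 H2; apply/HG; split; first exact/eqP.
  (* The midpoint of the overlap, which is interior to both intervals whatever their endpoint
     types. *)
  exists (((c u).1.1 + (c v).1.1 + 1) / 2)%R; split; apply: mem; lra.
- move=> u v /HG[_ [t [tu tv]]]; have /andP[Hu _] := mem' _ _ tu.
  by have /andP[_ Hv] := mem' _ _ tv; exact: le_trans Hv.
- move=> u v w E1 E2 E3 wu wv.
  have E : I u = I v by rewrite !Hc E1 E2 E3.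
  apply/idP/idP => /HG[_ H]; apply/HG; split.
  + by apply/eqP; rewrite eq_sym.
  + by rewrite -E.
  + by apply/eqP; rewrite eq_sym.
  + by rewrite E.
Qed.

Lemma nth_allpairs_index (T1 T2 S : Type) (f : T1 -> T2 -> S) (s : seq T1) (t : seq T2)
    x1 x2 y0 u v : u < size s -> v < size t ->
  nth y0 [seq f x y | x <- s, y <- t] (u * size t + v) = f (nth x1 s u) (nth x2 t v).
Proof.
elim: s u => //= a s IH [|u] us vt; rewrite nth_cat size_map.
  by rewrite mul0n add0n vt (nth_map x2).
by rewrite mulSn -addnA ltnNge leq_addr /= addKn IH.
Qed.

Lemma input_input_ok n (G : sgraph 'I_n) : input_ok n (gnat G) (memory (input G)).
Proof.
move=> u v un vn; rewrite -[u]/(val (Ordinal un)) -[v]/(val (Ordinal vn)) gnatE /=.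
have sz : size (enum 'I_n) = n by rewrite size_enum_ord.
have := @nth_allpairs_index _ _ _ (fun i j => nat_of_bool (G i j)) (enum 'I_n) (enum 'I_n)
  (Ordinal un) (Ordinal vn) 0 u v.
rewrite sz un vn => -> //; congr (nat_of_bool (G _ _)); apply: val_inj.
  by rewrite /= nth_enum_ord.
by rewrite /= nth_enum_ord.
Qed.

Lemma maxcut_correct (R : realType) n (G : sgraph 'I_n) : mixed_unit_interval_graph R G ->
  exists2 t, t <= items_cost maxcut_items (loop_bound n) &
    finds_maximum_cut_in maxcut_program G t.
Proof.
move=> HG; have [k [rr [m' [kT Ek Hm]]]] := maxcut_runs (input_input_ok G).
exists k => //; rewrite /finds_maximum_cut_in.
rewrite -[input G]/(Config 0 (env0 n) (memory (input G))) Ek; split.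
  exact: (leqnn (size maxcut_program)).
have [x [lc [rc [H1 H2 H3]]]] := muig_coordinates HG.
set o := outs _ _ _ _ _ _ in Hm.
have -> : output n (Config (size maxcut_program) rr m') = [set v : 'I_n | o v != 0]%SET.
  by apply/finset.setP => v; rewrite !inE /= Hm.
have capW : n.+1 ^ ((root_up n).+1 * 128) <= cap n by rewrite /cap /cap_exp leqnn.
apply: opt_maximum => v.
have [z vz [i iq ok]] := component_ok H1 H2 H3 (root_up_ge n) capW v.
by exists z => //; apply: (outs_opt _ iq ok).
Qed.

(** * Time bound *)

(** With [X = (n + 2) ^ c], each of [n + 2], [c] and the two powers is at most [X], and [4 * X] is
    covered by the two extra factors [n + 2]. *)
Lemma exp_bound n c : 0 < c ->
  (n + c + 1 + (n.+1 ^ c + n.+1 ^ c)).+1 <= (n + 2) ^ (c + 2).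
Proof.
move=> c0; set X := (n + 2) ^ c.
have H1 : n.+1 ^ c <= X by rewrite leq_exp2r // addn2.
have H2 : n + 2 <= X by rewrite -[X in X <= _]expn1 leq_pexp2l // addn2.
have H3 : c < X.
  by apply: leq_trans (ltn_expl c (ltnSn 1)) _; rewrite leq_exp2r // leq_addl.
have -> : (n + 2) ^ (c + 2) = X * ((n + 2) * (n + 2)) by rewrite expnD expnS expn1.
have : 4 <= (n + 2) * (n + 2) by rewrite (@leq_mul 2 2) // leq_addl.
set Y := (n + 2) * (n + 2) => H4.
apply: (@leq_trans (X * 4)); last by rewrite leq_mul2l H4 orbT.
by move: H1 H2 H3; clear; set Z := n.+1 ^ c; lia.
Qed.

Lemma loop_bound_le n : (loop_bound n).+1 <= (n + 2) ^ (cap_exp n + 2).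
Proof. by apply: exp_bound; rewrite /cap_exp muln_gt0. Qed.

Local Open Scope ring_scope.

Lemma root_up_sqrt (R : realType) (n : nat) :
  (root_up n)%:R <= Num.sqrt n%:R + 1 :> R.
Proof.
have [->|n0] := posnP n; first by rewrite /root_up big_ord0 addr_ge0 ?sqrtr_ge0.
have := root_up_lt n0; case: (root_up n) => [|q] /= H; first by rewrite addr_ge0 ?sqrtr_ge0.
rewrite -natr1 lerD2r -[leLHS]ger0_norm // -sqrtr_sqr ler_wsqrtr //.
by rewrite -natrX ler_nat mulnn in H *; exact: ltnW.
Qed.

Theorem theorem3 (R : realType) :
  exists (P : program) (f : nat -> R),
    softO f (fun n => Num.sqrt n%:R) /\
    forall (n : nat) (G : sgraph 'I_n),
      mixed_unit_interval_graph R G ->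
      exists t : nat, t%:R <= 2 `^ f n /\ finds_maximum_cut_in P G t.
Proof.
have [K [d HK]] := items_cost_poly maxcut_items.
pose e n := ((cap_exp n + 2) * d)%N.
(* The base 2 logarithm of [K.+1 * (n + 2) ^ e n]; taking [K.+1] keeps its argument positive. *)
pose f n : R := (ln K.+1%:R + (e n)%:R * ln (n + 2)%:R) / ln 2.
have ln2 : 0 < ln 2 :> R by rewrite ln_gt0 // ltr1n.
exists maxcut_program, f; split; last first.
  move=> n G HG; have [t tT Ht] := maxcut_correct HG; exists t; split=> //.
  have -> : 2 `^ f n = K.+1%:R * (n + 2)%:R ^+ e n.
    rewrite /powR pnatr_eq0 /= /f divfK ?gt_eqF // expRD lnK ?posrE ?ltr0n //.
    by rewrite expRM_natl lnK // posrE ltr0n addn2.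
  rewrite -natrX -natrM ler_nat (leq_trans tT) // (leq_trans (HK _)) //.
  rewrite leq_mul // /e expnM; have [->|d0] := posnP d; first by rewrite !expn0.
  by rewrite leq_exp2r // loop_bound_le.
(* A single logarithmic factor suffices. *)
exists 1%N; apply/eqO_exP.
have ln3 : 0 < ln 3 :> R by rewrite ln_gt0 // ltr1n.
have lnK0 : 0 <= ln K.+1%:R :> R by rewrite ln_ge0 // ler1n.
(* For [s = sqrt n >= 1], the bound [root_up n <= s + 1] gives [cap_exp n + 2 <= 128 * (s + 2) + 2
   <= 386 * s], so 390 is enough. *)
have [a [a0 aE]] : exists a : R, 0 <= a /\ a = 390 by exists 390; split; [exact: ler0n|exact: erefl].
(* The first term absorbs [ln K.+1], since [sqrt n * ln n >= ln 3] once [n >= 3]. The second uses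
   [ln (n + 2) <= 2 * ln n], and the 1 makes the constant positive. *)
exists ((ln K.+1%:R / ln 3 + 2 * a * d%:R + 1) / ln 2).
  by rewrite divr_gt0 // ltr_wpDl // addr_ge0 ?divr_ge0 ?mulr_ge0 // ltW.
near=> n.
have n3 : (3 <= n)%N by near: n; exact: nbhs_infty_ge.
have s1 : 1 <= Num.sqrt n%:R :> R.
  by rewrite -[leLHS]sqrtr1 ler_wsqrtr // ler1n (leq_trans _ n3).
have l3 : ln 3 <= ln n%:R :> R by rewrite ler_ln ?posrE ?ltr0n ?ler_nat // (leq_trans _ n3).
have l0 : 0 < ln n%:R :> R by exact: lt_le_trans l3.
have l2 : ln (n + 2)%:R <= 2 * ln n%:R :> R.
  rewrite mulr_natl -lnXn ?ltr0n ?(leq_trans _ n3) // -natrX ler_ln ?posrE ?ltr0n ?addn2 //.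
    by rewrite ler_nat -addn2 expnS expn1; move: n3; clear; nia.
  by rewrite expn_gt0 (leq_trans _ n3).
have l20 : 0 <= ln (n + 2)%:R :> R by rewrite ln_ge0 // ler1n addn2.
have ce : (cap_exp n + 2)%:R <= a * Num.sqrt n%:R :> R.
  rewrite aE; have := root_up_sqrt R n; rewrite /cap_exp natrD natrM -natr1; move: s1; clear; lra.
rewrite ger0_norm; last first.
  by rewrite divr_ge0 ?(ltW ln2) // addr_ge0 // mulr_ge0.
rewrite [X in _ <= _ * X]ger0_norm; last by rewrite mulr_ge0 ?sqrtr_ge0 ?expr1 ?(ltW l0).
rewrite expr1 /f mulrAC ler_wpM2r ?invr_ge0 ?(ltW ln2) //.
set s := Num.sqrt n%:R in s1 ce *; set l := ln n%:R in l3 l0 l2 *.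
have sl : l <= s * l by rewrite ler_peMl // ltW.
have P1 : ln K.+1%:R <= ln K.+1%:R / ln 3 * (s * l).
  rewrite mulrAC -mulrA ler_peMr // ler_pdivlMr // mul1r; exact: le_trans sl.
have P2 : (e n)%:R * ln (n + 2)%:R <= 2 * a * d%:R * (s * l).
  rewrite /e natrM.
  have -> : 2 * a * d%:R * (s * l) = a * s * d%:R * (2 * l) :> R by ring.
  by rewrite ler_pM // ?mulr_ge0 // ler_wpM2r.
have sl0 : 0 <= s * l by rewrite mulr_ge0 ?sqrtr_ge0 // ltW.
rewrite -[leLHS]addr0 [leRHS]mulrDl [X in _ <= X + _]mulrDl mul1r.
exact: lerD (lerD P1 P2) sl0.
Unshelve. all: by end_near.
Qed.
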